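(* Let $\alpha\in\mathbb R\setminus\{0,1\}$. Suppose either $\lambda=\alpha$ and $\alpha\notin\mathbb N$, or $\lambda=1$ and $\alpha^{-1}\notin\mathbb N$. Then, with all modules given by the Schrödinger representation $\pi_\lambda$: (1)(a) If $\alpha\neq-1$, then for every $k\ge1$ an explicit decomposition of $W_{\lambda,k}$ into irreducible $\mathfrak k_0$-modules is given by $W_{\lambda,k}=K_{\lambda,k}\oplus R_{\lambda,k}$. (1)(b) If $\alpha=-1$, then for every $k\ge1$, $W_{\lambda,k}$ is an indecomposable $\mathfrak k_0$-module, but not an irreducible $\mathfrak k_0$-module. (2) $W_{\lambda,k}$ is an irreducible $\mathfrak k$-module (for every $k\ge 0$). (3) $W_\lambda$ is an irreducible $\mathfrak g$-module and its $\mathfrak k$-type decomposition is $W_\lambda=\bigoplus_{k=0}^\infty W_{\lambda,k}$.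
   Context: $\mathbb N=\{0,1,2,\dots\}$. $x_1,x_2$ are even and $x_3,x_4$ odd real coordinates, $\partial_i=\partial_{x_i}$ (left superderivatives). The Bessel operators are $\mathcal B_\lambda(x_1)=(-\lambda+x_1\partial_1+x_3\partial_3+x_4\partial_4)\partial_1-2\alpha x_2\partial_3\partial_4$, $\mathcal B_\lambda(x_2)=(-\tfrac{\lambda}{\alpha}+x_2\partial_2+x_3\partial_3+x_4\partial_4)\partial_2-2x_1\partial_3\partial_4$, $\mathcal B_\lambda(x_3)=(-2\lambda+2x_1\partial_1+2\alpha x_2\partial_2+2(1+\alpha)x_3\partial_3)\partial_4+x_3\partial_1\partial_2$, $\mathcal B_\lambda(x_4)=(2\lambda-2x_1\partial_1-2\alpha x_2\partial_2-2(1+\alpha)x_4\partial_4)\partial_3+x_4\partial_1\partial_2$. $\mathcal I_\lambda$ is the ideal generated by $2x_1x_2+x_3x_4,\ x_2^2,\ x_2x_3,\ x_2x_4$ if $\lambda=\alpha$, and by $2\alpha x_1x_2+x_3x_4,\ x_1^2,\ x_1x_3,\ x_1x_4$ if $\lambda=1$. $D_\alpha$ is the real Jordan superalgebra with even basis $e_1,e_2$, odd basis $\xi,\eta$ and supercommutative product $e_ie_i=e_i$, $e_1e_2=0$, $e_i\xi=\frac12\xi$, $e_i\eta=\frac12\eta$, $\xi\eta=e_1+\alpha e_2$. $L_a$ is left multiplication by $a$, $\mathrm{Der}(D_\alpha)$ the space of (super)derivations, $\mathfrak{str}(D_\alpha)=\{L_a\}\oplus\mathrm{Der}(D_\alpha)\subset\mathrm{End}(D_\alpha)$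 with supercommutator bracket. $\mathfrak g=\mathrm{TKK}(D_\alpha)=D_\alpha^-\oplus\mathfrak{str}(D_\alpha)\oplus D_\alpha^+\ (\cong D(2,1;\alpha))$ with $D_\alpha^\pm$ copies of $D_\alpha$ (write $a^\pm$), and brackets $[L_a,y^+]=(ay)^+$, $[D,y^+]=(Dy)^+$, $[L_a,u^-]=-(au)^-$, $[D,u^-]=(Du)^-$, $[y^+,u^-]=2L_{yu}+2[L_y,L_u]$, $[D_\alpha^\pm,D_\alpha^\pm]=0$ ($D\in\mathrm{Der}(D_\alpha)$). Subalgebras: $\mathfrak k=\{a^-+I-a^+\mid a\in D_\alpha,\ I\in\mathrm{Der}(D_\alpha)\}$, $\mathfrak k_0=\mathrm{Der}(D_\alpha)$. Let $a\mapsto x_a$ be the linear map with $e_1,e_2,\xi,\eta\mapsto x_1,x_2,x_3,x_4$, extend $\mathcal B_\lambda(x_a)$ linearly in $a$; for $T\in\mathrm{End}(D_\alpha)$ let $\partial_T$ be the superderivation (of the parity of $T$; a first-order differential operator) with $\partial_T(x_b)=x_{T(b)}$. Let $\lambda(2L_{e_1})=\lambda$, $\lambda(2L_{e_2})=\lambda/\alpha$, $\lambda(L_\xi)=\lambda(L_\eta)=0$ (extended linearly). Then $\pi_\lambda(a^-)=-2\imath x_a$, $\pi_\lambda(L_a)=\lambda(L_a)-\partial_{L_a}$, $\pi_\lambda(D)=\partial_D$, $\pi_\lambda(a^+)=-\frac{\imath}{2}\mathcal B_\lambda(x_a)$. These operators preserve the ideal generated by $\mathcal I_\lambda$ in $C^\infty(\mathbb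 R^2,\mathbb C)\otimes\Lambda(x_3,x_4)$, and $W_\lambda=\mathcal P(\mathbb R^{2|2})\exp(-2(x_1+x_2))\bmod\mathcal I_\lambda$ is the image of $(\mathbb C[x_1,x_2]\otimes\Lambda(x_3,x_4))e^{-2(x_1+x_2)}$ in the quotient of $C^\infty(\mathbb R^2,\mathbb C)\otimes\Lambda(x_3,x_4)$ by that ideal, with $\mathfrak g$ acting by $\pi_\lambda$. All functions below are taken in this quotient. Polynomials: $U(-k,b,c)=\sum_{i=0}^k\frac{(-1)^i}{i!}(-k)_i(1-k-b)_i\,c^{k-i}$, $(a)_i=a(a+1)\cdots(a+i-1)$; $\widetilde U_{\alpha,k}(x)=U(-k,-\alpha,4x)$, $\widetilde U_{1,k}(x)=U(-k,-\alpha^{-1},4x)$, $\widetilde V_{\alpha,k}(x)=U(-k,1-\alpha,4x)$, $\widetilde V_{1,k}(x)=U(-k,1-\alpha^{-1},4x)$. Let $(i,j)=(1,2)$ if $\lambda=\alpha$ and $(i,j)=(2,1)$ if $\lambda=1$. Then $W_{\lambda,0}=\mathbb Ce^{-2(x_1+x_2)}$ and for $k\ge1$ $W_{\lambda,k}=\mathbb C\widetilde U_{\lambda,k}(x_i)e^{-2(x_1+x_2)}+\mathbb C\widetilde U_{\lambda,k-1}(x_i)e^{-2(x_i-x_j)}+(\mathbb Cx_3+\mathbb Cx_4)\widetilde V_{\lambda,k-1}(x_i)e^{-2x_i}$, $K_{\lambda,k}=\mathbb C\big(\widetilde U_{\lambda,k}(x_i)e^{-2(x_1+x_2)}+(k-1-\beta)\widetilde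 U_{\lambda,k-1}(x_i)e^{-2(x_i-x_j)}\big)+(\mathbb Cx_3+\mathbb Cx_4)\widetilde V_{\lambda,k-1}(x_i)e^{-2x_i}$ with $\beta=\alpha$ if $\lambda=\alpha$ and $\beta=\alpha^{-1}$ if $\lambda=1$, $R_{\lambda,k}=\mathbb C\big(\widetilde U_{\lambda,k}(x_i)e^{-2(x_1+x_2)}+k\,\widetilde U_{\lambda,k-1}(x_i)e^{-2(x_i-x_j)}\big)$. *)

(* Defs.v *)
From HB Require Import structures.
From mathcomp Require Import all_boot all_order all_algebra.
From mathcomp Require Import generic_quotient ring_quotient complex.
From mathcomp Require Import boolp classical_sets functions reals topology.
From mathcomp Require Import normedtype derive sequences exp.

Set Implicit Arguments.
Unset Strict Implicit.
Unset Printing Implicit Defensive.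

Import Order.TTheory GRing.Theory Num.Theory.
Import numFieldNormedType.Exports.

Local Open Scope classical_set_scope.
Local Open Scope ring_scope.
Local Open Scope complex_scope.

Section RealSmooth.
Variable R : realType.
Implicit Types f g : R * R -> R.

Definition dir1 : R * R := (1, 0).
Definition dir2 : R * R := (0, 1).

(* All iterated partial derivatives of order <= n exist and are continuous.   *)
Fixpoint Cn (n : nat) (f : R * R -> R) : Prop :=
  continuous f /\
  if n is m.+1 then
    [/\ forall p, derivable f p dir1, forall p, derivable f p dir2,
        Cn m ('D_dir1 f) & Cn m ('D_dir2 f)]
  else True.

Definition smooth f := forall n, Cn n f.

Lemma CnS n f : Cn n.+1 f -> Cn n f.
Proof.
elim: n f => [|n IH] f; first by case.
move=> [cf [d1 d2 C1 C2]].
by apply: (conj cf); split; [exact: d1|exact: d2|exact: (IH _ C1)|exact: (IH _ C2)].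
Qed.

Lemma Cn_cst n (a : R) : Cn n (cst a).
Proof.
elim: n a => [|n IH] a; split=> //; try by move=> p; exact: cvg_cst.
split; try by move=> p; exact: derivable_cst.
- by rewrite (_ : 'D_dir1 _ = cst 0) //; apply/funext => p; exact: derive_cst.
- by rewrite (_ : 'D_dir2 _ = cst 0) //; apply/funext => p; exact: derive_cst.
Qed.

Lemma CnD n f g : Cn n f -> Cn n g -> Cn n (f + g).
Proof.
elim: n f g => [|n IH] f g [cf Hf] [cg Hg].
  by split=> // p; apply: cvgD; [exact: cf|exact: cg].
case: Hf Hg => f1 f2 F1 F2 [g1 g2 G1 G2].
split; first by move=> p; apply: cvgD; [exact: cf|exact: cg].
split; try by move=> p; exact: derivableD.
- rewrite (_ : 'D_dir1 _ = 'D_dir1 f + 'D_dir1 g); first exact: IH.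
  by apply/funext => p; exact: deriveD.
- rewrite (_ : 'D_dir2 _ = 'D_dir2 f + 'D_dir2 g); first exact: IH.
  by apply/funext => p; exact: deriveD.
Qed.

Lemma CnM n f g : Cn n f -> Cn n g -> Cn n (f * g).
Proof.
elim: n f g => [|n IH] f g Hf Hg; move: (Hf) (Hg) => [cf Hf'] [cg Hg'].
  by split=> // p; apply: cvgM; [exact: cf|exact: cg].
case: Hf' Hg' => f1 f2 F1 F2 [g1 g2 G1 G2].
have [Cf Cg] := (CnS Hf, CnS Hg).
split; first by move=> p; apply: cvgM; [exact: cf|exact: cg].
split; try by move=> p; exact: derivableM.
- rewrite (_ : 'D_dir1 _ = f * 'D_dir1 g + g * 'D_dir1 f).
    by apply: CnD; exact: IH.
  by apply/funext => p; exact: deriveM.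
- rewrite (_ : 'D_dir2 _ = f * 'D_dir2 g + g * 'D_dir2 f).
    by apply: CnD; exact: IH.
  by apply/funext => p; exact: deriveM.
Qed.

Lemma CnN n f : Cn n f -> Cn n (- f).
Proof.
move=> Hf; rewrite (_ : - f = cst (-1) * f).
  by apply: CnM => //; exact: Cn_cst.
by apply/funext => p; rewrite /= mulN1r.
Qed.

Lemma is_diff_fst (p : R * R) : is_diff p fst fst.
Proof.
have c : continuous (fst : R * R -> R) by move=> q; exact: cvg_fst.
by split; [exact: linear_differentiable | rewrite diff_lin].
Qed.

Lemma is_diff_snd (p : R * R) : is_diff p snd snd.
Proof.
have c : continuous (snd : R * R -> R) by move=> q; exact: cvg_snd.
by split; [exact: linear_differentiable | rewrite diff_lin].
Qed.

Lemma is_diff_expR_lin (a b : R) (p : R * R) :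
  is_diff p (fun q => expR (a * q.1 + b * q.2))
    (fun v => expR (a * p.1 + b * p.2) * (a * v.1 + b * v.2)).
Proof.
have H1 : is_diff p (fun q : R * R => a * q.1 + b * q.2)
                    (fun v => a * v.1 + b * v.2).
  exact: is_diffD (is_diffZ a (is_diff_fst p)) (is_diffZ b (is_diff_snd p)).
have H2 : is_diff (a * p.1 + b * p.2) (@expR R)
            (fun h => h *: expR (a * p.1 + b * p.2)).
  have dx : derivable (@expR R) (a * p.1 + b * p.2) 1 by exact: derivable_expR.
  split; first exact/derivable1_diffP.
  rewrite diff1E; last exact/derivable1_diffP.
  by apply/funext => h; rewrite derive1E (congr1 (@^~ _) (@derive_expR R)).
have := is_diff_comp H1 H2.
set G := (X in is_diff p _ X -> _) => H; apply: (@is_diff_eq _ _ _ _ _ _ _ H).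
by apply/funext => v; rewrite /G /= -[LHS]/(_ * _) mulrC.
Qed.

Lemma smooth_expR_lin (a b : R) :
  smooth (fun q => expR (a * q.1 + b * q.2)).
Proof.
set F := (X in smooth X).
have dF p : differentiable F p by have [] := is_diff_expR_lin a b p.
have DF p v : 'D_v F p = F p * (a * v.1 + b * v.2).
  by rewrite deriveE // (@diff_val _ _ _ _ _ _ _ (is_diff_expR_lin a b p)).
elim=> [|n IH]; split=> //; try by move=> p; exact: differentiable_continuous.
split; try by move=> p; exact: diff_derivable.
- rewrite (_ : 'D_dir1 _ = F * cst a).
    by apply: CnM => //; exact: Cn_cst.
  by apply/funext => p; rewrite DF /= mulr1 mulr0 addr0.
- rewrite (_ : 'D_dir2 _ = F * cst b).
    by apply: CnM => //; exact: Cn_cst.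
  by apply/funext => p; rewrite DF /= mulr1 mulr0 add0r.
Qed.

Lemma smooth_fst : smooth fst.
Proof.
have dF p : differentiable (fst : R * R -> R) p.
  by have [] := is_diff_fst p.
have D p v : 'D_v (fst : R * R -> R) p = v.1.
  by rewrite deriveE // (@diff_val _ _ _ _ _ _ _ (is_diff_fst p)).
case=> [|n]; split=> //; try by move=> p; exact: cvg_fst.
split; try by move=> p; exact: diff_derivable.
- by rewrite (_ : 'D_dir1 _ = cst (1 : R)); [exact: Cn_cst | apply/funext=> p; rewrite D].
- by rewrite (_ : 'D_dir2 _ = cst (0 : R)); [exact: Cn_cst | apply/funext=> p; rewrite D].
Qed.

Lemma smooth_snd : smooth snd.
Proof.
have dF p : differentiable (snd : R * R -> R) p.
  by have [] := is_diff_snd p.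
have D p v : 'D_v (snd : R * R -> R) p = v.2.
  by rewrite deriveE // (@diff_val _ _ _ _ _ _ _ (is_diff_snd p)).
case=> [|n]; split=> //; try by move=> p; exact: cvg_snd.
split; try by move=> p; exact: diff_derivable.
- by rewrite (_ : 'D_dir1 _ = cst (0 : R)); [exact: Cn_cst | apply/funext=> p; rewrite D].
- by rewrite (_ : 'D_dir2 _ = cst (1 : R)); [exact: Cn_cst | apply/funext=> p; rewrite D].
Qed.

Lemma smooth_derive1 f : smooth f -> smooth ('D_dir1 f).
Proof. by move=> sf n; have [_ [_ _]] := sf n.+1. Qed.

Lemma smooth_derive2 f : smooth f -> smooth ('D_dir2 f).
Proof. by move=> sf n; have [_ [_ _]] := sf n.+1. Qed.

End RealSmooth.

Section ComplexSmooth.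
Variable R : realType.
Local Notation C := R[i].
Implicit Types f g : R * R -> C.

Definition re_fun f : R * R -> R := fun p => complex.Re (f p).
Definition im_fun f : R * R -> R := fun p => complex.Im (f p).

Definition csmooth f := smooth (re_fun f) /\ smooth (im_fun f).

Definition csmooth_pred : pred (R * R -> C) := fun f => `[< csmooth f >].

Lemma csmooth_subring : subring_closed csmooth_pred.
Proof.
split.
- by apply/asboolP; split=> n; exact: Cn_cst.
- move=> f g /asboolP[fr fi] /asboolP[gr gi]; apply/asboolP; split=> n.
  + rewrite (_ : re_fun _ = re_fun f + - re_fun g).
      by apply: CnD; [exact: fr | apply: CnN; exact: gr].
    by apply/funext => p; rewrite /re_fun /= -[(f - g) p]/(f p - g p) raddfB.
  + rewrite (_ : im_fun _ = im_fun f + - im_fun g).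
      by apply: CnD; [exact: fi | apply: CnN; exact: gi].
    by apply/funext => p; rewrite /im_fun /= -[(f - g) p]/(f p - g p) raddfB.
- move=> f g /asboolP[fr fi] /asboolP[gr gi]; apply/asboolP; split=> n.
  + rewrite (_ : re_fun _ = re_fun f * re_fun g + - (im_fun f * im_fun g)).
      apply: CnD; first by apply: CnM; [exact: fr | exact: gr].
      by apply: CnN; apply: CnM; [exact: fi | exact: gi].
    apply/funext => p; rewrite -[LHS]/(complex.Re (f p * g p)).
    rewrite -[RHS]/(complex.Re (f p) * complex.Re (g p)
                    - complex.Im (f p) * complex.Im (g p)).
    by case: (f p) (g p) => [a b] [c d].
  + rewrite (_ : im_fun _ = re_fun f * im_fun g + im_fun f * re_fun g).
      by apply: CnD; apply: CnM; [exact: fr|exact: gi|exact: fi|exact: gr].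
    apply/funext => p; rewrite -[LHS]/(complex.Im (f p * g p)).
    rewrite -[RHS]/(complex.Re (f p) * complex.Im (g p)
                    + complex.Im (f p) * complex.Re (g p)).
    by case: (f p) (g p) => [a b] [c d].
Qed.

HB.instance Definition _ :=
  GRing.isSubringClosed.Build (R * R -> C)%type csmooth_pred csmooth_subring.

Record Cinf := MkCinf { cinf_fun :> R * R -> C; _ : csmooth_pred cinf_fun }.

HB.instance Definition _ := [isSub for cinf_fun].
HB.instance Definition _ := [Choice of Cinf by <:].
HB.instance Definition _ := [SubChoice_isSubComNzRing of Cinf by <:].

Lemma cinf_csmooth (f : Cinf) : csmooth f.
Proof. by case: f => f Pf; exact/asboolP. Qed.

Definition mk_cinf f (sf : csmooth f) : Cinf := MkCinf (asboolT sf).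

Lemma csmooth_real (f : R * R -> R) : smooth f -> csmooth (fun p => (f p)%:C).
Proof. by move=> sf; split=> // n; exact: Cn_cst. Qed.

Lemma csmooth_cst (a : C) : csmooth (cst a).
Proof. by split=> n; exact: Cn_cst. Qed.

Definition cinf_cst (a : C) : Cinf := mk_cinf (csmooth_cst a).

Lemma cinfE (f g : Cinf) : (forall p, f p = g p) -> f = g.
Proof. by move=> fg; apply/val_inj/funext. Qed.

Definition cinf_scale (a : C) (f : Cinf) : Cinf := cinf_cst a * f.

Lemma cinf_scaleA a b (f : Cinf) :
  cinf_scale a (cinf_scale b f) = cinf_scale (a * b) f.
Proof. by rewrite /cinf_scale mulrA; congr (_ * _); exact: cinfE. Qed.

Lemma cinf_scale1 : left_id 1 cinf_scale.
Proof.
by move=> f; rewrite -[RHS]mul1r; congr (_ * _); exact: cinfE.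
Qed.

Lemma cinf_scaleDr : right_distributive cinf_scale +%R.
Proof. by move=> a f g; rewrite /cinf_scale mulrDr. Qed.

Lemma cinf_scaleDl (f : Cinf) : {morph cinf_scale^~ f : a b / a + b}.
Proof.
by move=> a b; rewrite /cinf_scale -mulrDl; congr (_ * _); exact: cinfE.
Qed.

HB.instance Definition _ := GRing.Zmodule_isLmodule.Build C Cinf
  cinf_scaleA cinf_scale1 cinf_scaleDr cinf_scaleDl.

Lemma cinf_scaleAl (a : C) (f g : Cinf) : a *: (f * g) = a *: f * g.
Proof. exact: mulrA. Qed.

HB.instance Definition _ := GRing.Lmodule_isLalgebra.Build C Cinf cinf_scaleAl.

Definition cpd_fun (v : R * R) f : R * R -> C :=
  fun p => 'D_v (re_fun f) p +i* 'D_v (im_fun f) p.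

Lemma csmooth_pd1 (f : Cinf) : csmooth (cpd_fun (dir1 R) f).
Proof. by have [fr fi] := cinf_csmooth f; split; exact: smooth_derive1. Qed.

Lemma csmooth_pd2 (f : Cinf) : csmooth (cpd_fun (dir2 R) f).
Proof. by have [fr fi] := cinf_csmooth f; split; exact: smooth_derive2. Qed.

Definition pd1 (f : Cinf) : Cinf := mk_cinf (csmooth_pd1 f).
Definition pd2 (f : Cinf) : Cinf := mk_cinf (csmooth_pd2 f).

Definition cX1 : Cinf := mk_cinf (csmooth_real (@smooth_fst R)).
Definition cX2 : Cinf := mk_cinf (csmooth_real (@smooth_snd R)).
Definition cexp (a b : R) : Cinf := mk_cinf (csmooth_real (smooth_expR_lin a b)).

End ComplexSmooth.

Arguments cX1 {R}.
Arguments cX2 {R}.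

(* C^oo(R^2, C) (x) Lambda(x_3, x_4): the entry of f at (a, b) is the           *)
(* coefficient of x_3^a x_4^b.                                                *)
Notation superfun R := {ffun bool * bool -> Cinf R}.

Section SuperFunctions.
Variable R : realType.
Local Notation C := R[i].
Local Notation SF := (superfun R).

Definition sscal (c : Cinf R) : SF :=
  [ffun s : bool * bool => if s == (false, false) then c else 0].

Definition sf_homog (p : bool) : set SF :=
  [set f : SF | forall s, s.1 (+) s.2 != p -> f s = 0].

(* The sign comes from moving x_3^(u.1) to the left of x_4^(t.2).             *)
Definition smul (f g : SF) : SF :=
  [ffun s => \sum_(t : bool * bool)
     \sum_(u : bool * bool | [&& ~~ (t.1 && u.1), ~~ (t.2 && u.2),
                                 (t.1 || u.1) == s.1 & (t.2 || u.2) == s.2])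
       (-1) ^+ (t.2 && u.1) * (f t * g u)].

Definition i1 : 'I_4 := @Ordinal 4 0 isT.
Definition i2 : 'I_4 := @Ordinal 4 1 isT.
Definition i3 : 'I_4 := @Ordinal 4 2 isT.
Definition i4 : 'I_4 := @Ordinal 4 3 isT.

Definition sX (i : 'I_4) : SF :=
  match val i with
  | 0%N => sscal cX1
  | 1%N => sscal cX2
  | 2%N => [ffun s : bool * bool => if s == (true, false) then 1 else 0]
  | _ => [ffun s : bool * bool => if s == (false, true) then 1 else 0]
  end.

Definition mulx (i : 'I_4) (f : SF) : SF := smul (sX i) f.

Definition sd (i : 'I_4) (f : SF) : SF :=
  match val i with
  | 0%N => [ffun s => pd1 (f s)]
  | 1%N => [ffun s => pd2 (f s)]
  | 2%N => [ffun s : bool * bool => if s.1 then 0 else f (true, s.2)]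
  | _ => [ffun s : bool * bool => if s.2 then 0 else (-1) ^+ s.1 * f (s.1, true)]
  end.

Definition bessel (al lam : R) (i : 'I_4) (f : SF) : SF :=
  match val i with
  | 0%N => let g := sd i1 f in
      - (lam%:C *: g) + mulx i1 (sd i1 g) + mulx i3 (sd i3 g) + mulx i4 (sd i4 g)
      - (2 * al)%:C *: mulx i2 (sd i3 (sd i4 f))
  | 1%N => let g := sd i2 f in
      - ((lam / al)%:C *: g) + mulx i2 (sd i2 g) + mulx i3 (sd i3 g)
      + mulx i4 (sd i4 g) - 2 *: mulx i1 (sd i3 (sd i4 f))
  | 2%N => let g := sd i4 f in
      - ((2 * lam)%:C *: g) + 2 *: mulx i1 (sd i1 g)
      + (2 * al)%:C *: mulx i2 (sd i2 g)
      + (2 * (1 + al))%:C *: mulx i3 (sd i3 g) + mulx i3 (sd i1 (sd i2 f))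
  | _ => let g := sd i3 f in
      (2 * lam)%:C *: g - 2 *: mulx i1 (sd i1 g)
      - (2 * al)%:C *: mulx i2 (sd i2 g)
      - (2 * (1 + al))%:C *: mulx i4 (sd i4 g) + mulx i4 (sd i1 (sd i2 f))
  end.

End SuperFunctions.

(* D_alpha is 'rV[R]_4 in the basis (e_1, e_2, xi, eta) and End(D_alpha) is     *)
(* 'M[R]_4 acting on the right: T b c is the coordinate of T(e_b) on e_c.      *)
Section Jordan.
Variables (R : realType) (al : R).

Definition par (i : 'I_4) : bool := (1 < i)%N.

Definition D_homog (p : bool) (a : 'rV[R]_4) : Prop :=
  forall i, par i != p -> a 0 i = 0.

Definition eb (i : 'I_4) : 'rV[R]_4 := delta_mx 0 i.

Definition jtab (i j : 'I_4) : 'rV[R]_4 :=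
  match val i, val j with
  | 0%N, 0%N => eb i1
  | 1%N, 1%N => eb i2
  | 0%N, 1%N | 1%N, 0%N => 0
  | 0%N, _ | 1%N, _ => 2^-1 *: eb j
  | _, 0%N | _, 1%N => 2^-1 *: eb i
  | 2%N, 3%N => eb i1 + al *: eb i2
  | 3%N, 2%N => - (eb i1 + al *: eb i2)
  | _, _ => 0
  end.

Definition jmul (a b : 'rV[R]_4) : 'rV[R]_4 :=
  \sum_i \sum_j (a 0 i * b 0 j) *: jtab i j.

Definition jL (a : 'rV[R]_4) : 'M[R]_4 := lin1_mx (jmul a).

Definition superder (p : bool) (T : 'M[R]_4) : Prop :=
  (forall b c, par b (+) par c != p -> T b c = 0) /\
  (forall (q : bool) a b, D_homog q a ->
     jmul a b *m T = jmul (a *m T) b + (-1) ^+ (p && q) *: jmul a (b *m T)).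

Definition Der : set 'M[R]_4 :=
  [set T | exists T0 T1, [/\ superder false T0, superder true T1 & T = T0 + T1]].

(* Tkk u a D y stands for u^- + L_a + D + y^+. Since L_a(1) = a and D(1) = 0   *)
(* for D in Der, where 1 = e_1 + e_2, the sum {L_a} + Der is direct.           *)
Record tkk := Tkk {
  tkk_neg : 'rV[R]_4; tkk_L : 'rV[R]_4; tkk_D : 'M[R]_4; tkk_pos : 'rV[R]_4 }.

Definition alg_g : set tkk := [set X | Der (tkk_D X)].

Definition alg_k : set tkk :=
  [set X | exists a I, Der I /\ X = Tkk a 0 I (- a)].

Definition alg_k0 : set tkk := [set X | exists I, Der I /\ X = Tkk 0 0 I 0].

End Jordan.

Section Schroedinger.
Variables (R : realType) (al lam : R).
Local Notation C := R[i].
Local Notation SF := (superfun R).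

Definition mulx_lin (a : 'rV[R]_4) (f : SF) : SF := \sum_i (a 0 i)%:C *: mulx i f.

Definition bessel_lin (a : 'rV[R]_4) (f : SF) : SF :=
  \sum_i (a 0 i)%:C *: bessel al lam i f.

(* The superderivation with x_b |-> x_(T(b)): the x_c d_b are left             *)
(* superderivations of parity |b| + |c|.                                      *)
Definition dT (T : 'M[R]_4) (f : SF) : SF :=
  \sum_b \sum_c (T b c)%:C *: mulx c (sd b f).

Definition lam_L (a : 'rV[R]_4) : R :=
  a 0 i1 * (lam / 2) + a 0 i2 * (lam / al / 2).

Definition schroedinger (X : tkk R) (f : SF) : SF :=
  - (2 * 'i) *: mulx_lin (tkk_neg X) f
  + ((lam_L (tkk_L X))%:C *: f - dT (jL al (tkk_L X)) f)
  + dT (tkk_D X) f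
  + - ('i / 2) *: bessel_lin (tkk_pos X) f.

End Schroedinger.

Section QuotientSpace.
Variables (R : realType) (al lam : R).
Local Notation C := R[i].
Local Notation SF := (superfun R).

(* The two cases lam = al and lam = 1 are exclusive, as al <> 1.               *)
Definition jj : 'I_4 := if lam == al then i2 else i1.

Definition ideal_gen (n : 'I_4) : SF :=
  let x i : SF := sX R i in
  match val n with
  | 0%N => (if lam == al then 2 else (2 * al)%:C) *: smul (x i1) (x i2)
         + smul (x i3) (x i4)
  | 1%N => smul (x jj) (x jj)
  | 2%N => smul (x jj) (x i3)
  | _ => smul (x jj) (x i4)
  end.

(* Left multiples suffice: the generators are homogeneous and the algebra is  *)
(* supercommutative.                                                          *)
Definition ideal_pred : pred SF :=
  fun f => `[< exists h : 'I_4 -> SF, f = \sum_n smul (h n) (ideal_gen n) >].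

Lemma smulDl (f g h : SF) : smul (f + g) h = smul f h + smul g h.
Proof.
apply/ffunP => s; rewrite !ffunE -big_split; apply: eq_bigr => t _ /=.
rewrite -big_split; apply: eq_bigr => u _ /=.
by rewrite ffunE mulrDl mulrDr.
Qed.

Lemma smulZl (a : C) (f g : SF) : smul (a *: f) g = a *: smul f g.
Proof.
apply/ffunP => s; rewrite !ffunE scaler_sumr; apply: eq_bigr => t _ /=.
rewrite scaler_sumr; apply: eq_bigr => u _ /=.
by rewrite ffunE -[a *: f t * g u]scalerAl mulrC -scalerAl mulrC.
Qed.

Lemma ideal_predZD (a : C) (f g : SF) :
  f \in ideal_pred -> g \in ideal_pred -> a *: f + g \in ideal_pred.
Proof.
move=> /asboolP[h ->] /asboolP[k ->]; apply/asboolP.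
exists (fun n => a *: h n + k n).
rewrite scaler_sumr -big_split; apply: eq_bigr => n _ /=.
by rewrite smulDl smulZl.
Qed.

Lemma ideal_pred0 : 0 \in ideal_pred.
Proof.
apply/asboolP; exists (fun=> 0); rewrite big1 // => n _.
by have := smulZl 0 0 (ideal_gen n); rewrite !scale0r.
Qed.

Lemma ideal_zmod_closed : zmod_closed ideal_pred.
Proof.
split; first exact: ideal_pred0.
by move=> f g If Ig; rewrite addrC -scaleN1r ideal_predZD.
Qed.

HB.instance Definition _ :=
  GRing.isZmodClosed.Build SF ideal_pred ideal_zmod_closed.

Definition ideal : zmodClosed SF := GRing.ZmodClosed.clone SF ideal_pred _.

Definition quotSF : Type := Quotient.quot ideal.

HB.instance Definition _ := GRing.Zmodule.on quotSF.

Definition cls (f : SF) : quotSF := \pi_(Quotient.quot ideal)%qT f.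
Definition rep (q : quotSF) : SF := repr (q : Quotient.quot ideal).

Lemma repK q : cls (rep q) = q.
Proof. exact: reprK. Qed.

Lemma clsD f g : cls (f + g) = cls f + cls g.
Proof. by rewrite /cls raddfD. Qed.

Lemma cls_eq f g : (cls f = cls g) <-> (f - g \in ideal_pred).
Proof.
rewrite Quotient.idealrBE; split; [by move=> E; apply/eqP|by move/eqP].
Qed.

Definition quotSF_scale (a : C) (q : quotSF) : quotSF := cls (a *: rep q).

Lemma quotSF_scale_cls a f : quotSF_scale a (cls f) = cls (a *: f).
Proof.
apply/cls_eq; rewrite -scalerBr -[_ *: _]addr0 ideal_predZD ?ideal_pred0 //.
by apply/cls_eq; rewrite repK.
Qed.

Lemma quotSF_scaleA a b q :
  quotSF_scale a (quotSF_scale b q) = quotSF_scale (a * b) q.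
Proof. by rewrite -[q]repK !quotSF_scale_cls scalerA. Qed.

Lemma quotSF_scale1 : left_id 1 quotSF_scale.
Proof. by move=> q; rewrite -[q]repK quotSF_scale_cls scale1r. Qed.

Lemma quotSF_scaleDr : right_distributive quotSF_scale +%R.
Proof.
move=> a p q; rewrite -[p]repK -[q]repK -clsD !quotSF_scale_cls.
by rewrite scalerDr clsD.
Qed.

Lemma quotSF_scaleDl q : {morph quotSF_scale^~ q : a b / a + b}.
Proof.
by move=> a b; rewrite -[q]repK !quotSF_scale_cls scalerDl clsD.
Qed.

HB.instance Definition _ := GRing.Zmodule_isLmodule.Build C quotSF
  quotSF_scaleA quotSF_scale1 quotSF_scaleDr quotSF_scaleDl.

Lemma clsZ (a : C) f : cls (a *: f) = a *: cls f.
Proof. by rewrite -quotSF_scale_cls. Qed.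

(* The operator induced on the quotient; the choice of representative is      *)
(* immaterial because pi_lam(X) preserves the ideal.                          *)
Definition schroedinger_quot (X : tkk R) (q : quotSF) : quotSF :=
  cls (schroedinger al lam X (rep q)).

Definition quot_homog (p : bool) : set quotSF :=
  [set q | exists f, sf_homog p f /\ q = cls f].

End QuotientSpace.

Arguments quot_homog {R} al lam p _.

(* Representation-theoretic notions for operators act X, X in L, on a Z/2-    *)
(* graded space V with homogeneous parts hom p; submodules are graded.        *)
Section Modules.
Variables (K : pzRingType) (V : lmodType K) (G : Type).
Variables (hom : bool -> set V) (act : G -> V -> V) (L : set G).

Record submodule (M : set V) : Prop := {
  submodule0 : M 0;
  submoduleZD : forall (a : K) u v, M u -> M v -> M (a *: u + v);
  submodule_graded : forall u, M u ->
    exists u0 u1, [/\ M u0, M u1, hom false u0, hom true u1 & u = u0 + u1];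
  submodule_act : forall X u, L X -> M u -> M (act X u) }.

Definition irreducible_module (M : set V) : Prop :=
  [/\ submodule M, M <> [set 0] &
      forall N, submodule N -> N `<=` M -> N = [set 0] \/ N = M].

Definition direct_sum (M A B : set V) : Prop :=
  M = [set a + b | a in A & b in B] /\ A `&` B = [set 0].

Definition indecomposable_module (M : set V) : Prop :=
  [/\ submodule M, M <> [set 0] &
      forall A B, submodule A -> submodule B -> direct_sum M A B ->
        A = [set 0] \/ B = [set 0]].

Definition direct_sum_seq (M : set V) (A : nat -> set V) : Prop :=
  M = [set v | exists n (u : nat -> V),
         (forall k, (k < n)%N -> A k (u k)) /\ v = \sum_(k < n) u k] /\
  (forall n (u : nat -> V), (forall k, (k < n)%N -> A k (u k)) ->
     \sum_(k < n) u k = 0 -> forall k, (k < n)%N -> u k = 0).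

Definition spanned (vs : seq V) : set V :=
  [set v | exists c : nat -> K, v = \sum_(n < size vs) c n *: vs`_n].

End Modules.

Section Components.
Variables (R : realType) (al lam : R).
Local Notation C := R[i].
Local Notation SF := (superfun R).

Definition polyfun (c : Cinf R) : Prop :=
  exists n (a : nat -> nat -> C),
    c = \sum_(p < n) \sum_(q < n) a p q *: (cX1 ^+ p * cX2 ^+ q).

Definition Wmod : set (quotSF al lam) :=
  [set q | exists P : SF, (forall s, polyfun (P s)) /\
           q = cls al lam (smul P (sscal (cexp (- 2) (- 2))))].

Definition poch (a : R) (n : nat) : R := \prod_(m < n) (a + m%:R).

Definition Upoly (k : nat) (b : R) (c : Cinf R) : Cinf R :=
  \sum_(m < k.+1)
    ((-1) ^+ m / m`!%:R * poch (- k%:R) m * poch (1 - k%:R - b) m)%:C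
      *: c ^+ (k - m).

Definition beta : R := if lam == al then al else al^-1.
Definition cXi : Cinf R := if lam == al then cX1 else cX2.

Definition Utilde (k : nat) : Cinf R := Upoly k (- beta) (4 *: cXi).
Definition Vtilde (k : nat) : Cinf R := Upoly k (1 - beta) (4 *: cXi).

(* exp(a x_i + b x_j) *)
Definition cexp_ij (a b : R) : Cinf R :=
  if lam == al then cexp a b else cexp b a.

Definition uvec (k : nat) : quotSF al lam :=
  cls al lam (sscal (Utilde k * cexp (- 2) (- 2))).
Definition uvec' (k : nat) : quotSF al lam :=
  cls al lam (sscal (Utilde k * cexp_ij (- 2) 2)).
Definition vvec (n : 'I_4) (k : nat) : quotSF al lam :=
  cls al lam (mulx n (sscal (Vtilde k * cexp_ij (- 2) 0))).

Definition Wcomp (k : nat) : set (quotSF al lam) :=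
  if k is m.+1 then
    spanned [:: uvec k; uvec' m; vvec i3 m; vvec i4 m]
  else spanned [:: cls al lam (sscal (cexp (- 2) (- 2)))].

(* Kcomp and Rcomp are only meaningful for k >= 1.                            *)
Definition Kcomp (k : nat) : set (quotSF al lam) :=
  spanned [:: uvec k + (k%:R - 1 - beta)%:C *: uvec' k.-1;
              vvec i3 k.-1; vvec i4 k.-1].

Definition Rcomp (k : nat) : set (quotSF al lam) :=
  spanned [:: uvec k + k%:R *: uvec' k.-1].

Definition irreducible_rep (L : set (tkk R)) (M : set (quotSF al lam)) : Prop :=
  irreducible_module (quot_homog al lam) (@schroedinger_quot R al lam) L M.

Definition indecomposable_rep (L : set (tkk R)) (M : set (quotSF al lam)) :=
  indecomposable_module (quot_homog al lam) (@schroedinger_quot R al lam) L M.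

End Components.

Arguments Wmod {R} al lam _.
Arguments Wcomp {R} al lam k _.
Arguments Kcomp {R} al lam k _.
Arguments Rcomp {R} al lam k _.

(* Main.v *)
From HB Require Import structures.
Require Import Defs.
From mathcomp Require Import all_boot all_order all_algebra.
From mathcomp Require Import ring lra complex boolp functions topology.
From mathcomp Require Import normedtype derive sequences exp realfun.
From mathcomp Require Import classical_sets reals.

Set Implicit Arguments.
Unset Strict Implicit.
Unset Printing Implicit Defensive.

Import Order.TTheory GRing.Theory Num.Theory.
Local Open Scope ring_scope.

(** Let x_i be the even coordinate whose powers survive in the quotient, x_j
the other one, and E = exp (-2 (x_1 + x_2)).  With the single constant gam
(equal to 1 if lam = al and to al if lam = 1) the ideal is generated by
2 gam x_i x_j + x_3 x_4, x_j^2, x_j x_3, x_j x_4, and every operator has, up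
to a sign, one formula in gam and beta for both values of lam.

Modulo the ideal, x_3 x_4 is -2 gam x_i x_j, while x_j squares to zero and
kills x_3 and x_4.  Hence every element of W is the class [emb a b c d] of
(a(x_i) + b(x_i) x_j + c(x_i) x_3 + d(x_i) x_4) E for polynomials a, b, c, d
([WmodP]), and the class determines them, because they can be read off from
values and x_j-derivatives on the line x_j = 0 ([emb_inj]).  The exponentials exp (-2 (x_i - x_j)) and
exp (-2 x_i) fit in because exp (k x_j) = 1 + k x_j + x_j^2 g with g smooth
([expR_rem]).  All operators preserve the ideal, and they become ordinary
differential operators in one variable on the quadruples (a, b, c, d): these
are the lemmas [act_mulx_ii] to [act_jL].

The polynomials U and V are of Laguerre type; apart from their degrees only four
contiguity relations are used ([lag_deriv], [lag_rec], [lag_euler],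
[lag_contig]).  In the coordinates [kvec m x y z t] on the basis u, u', v_3, v_4 of
W_(m+1) they turn the operators of k into constant matrices ([qT_ii] to
[derO_kvec]), from which the finite-dimensional statements are read off.  Put
kappa = m - beta.  The odd derivations of D_alpha map v_3 and v_4 to multiples
of u + kappa u', and kill an even vector exactly when it is a multiple of
u + (m+1) u'.  These two even vectors are independent unless beta = -1, which
gives the decomposition K + R if alpha is not -1.  If alpha = -1 they agree, and
every submodule not contained in R contains R and the odd part, so that no two
nonzero submodules are complementary.  The operator of e_i^- - e_i^+
has different eigenvalues on u and u', so it separates them and, as kappa is
nonzero for beta not a natural number, W_(m+1) is irreducible under k.

Under g, a nonzero submodule of W contains some class of b(x_i) x_j E.
Multiplication by x_i and the operator b |-> t b'' - beta b', which maps
t^(n+1) to (n+1)(n - beta) t^n, then produce x_j E and everything else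
([lowering_generates], [N_all]).  The K-types span W and are independent
because U and V of index k have degree k ([Wcomp_filt0]). *)

(** * Partial derivatives of smooth complex functions *)

Section Calculus.
Variable R : realType.
Local Notation C := R[i].
Local Notation CF := (Cinf R).
Import numFieldNormedType.Exports.
Local Open Scope classical_set_scope.
Local Open Scope complex_scope.
Implicit Types f g : CF.

Lemma cinfD_fun f g p : (f + g) p = f p + g p. Proof. by []. Qed.
Lemma cinfM_fun f g p : (f * g) p = f p * g p. Proof. by []. Qed.
Lemma cinfZ_fun a f p : (a *: f) p = a * f p. Proof. by []. Qed.

Lemma derivable_re f v : v = dir1 R \/ v = dir2 R ->
  forall p, derivable (re_fun f) p v /\ derivable (im_fun f) p v.
Proof.
have [fr fi] := cinf_csmooth f.
have [_ [r1 r2 _ _]] := fr 1%N.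
have [_ [j1 j2 _ _]] := fi 1%N.
by case=> -> p.
Qed.

Lemma Re_cplxM (x y : C) : complex.Re (x * y) =
  complex.Re x * complex.Re y - complex.Im x * complex.Im y.
Proof. by case: x y => [a b] [c d]. Qed.
Lemma Im_cplxM (x y : C) : complex.Im (x * y) =
  complex.Re x * complex.Im y + complex.Im x * complex.Re y.
Proof. by case: x y => [a b] [c d]. Qed.

Section Dir.
Variables (v : R * R) (hv : v = dir1 R \/ v = dir2 R).

Lemma cpd_funD f g p : cpd_fun v (f + g) p = cpd_fun v f p + cpd_fun v g p.
Proof.
have [fr fi] := @derivable_re f v hv p; have [gr gi] := @derivable_re g v hv p.
rewrite /cpd_fun.
rewrite (_ : re_fun (f + g) = re_fun f + re_fun g); last first.
  by apply/funext => q; rewrite /re_fun cinfD_fun raddfD.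
rewrite (_ : im_fun (f + g) = im_fun f + im_fun g); last first.
  by apply/funext => q; rewrite /im_fun cinfD_fun raddfD.
by rewrite !deriveD.
Qed.

Lemma cpd_funM f g p :
  cpd_fun v (f * g) p = cpd_fun v f p * g p + f p * cpd_fun v g p.
Proof.
have [fr fi] := @derivable_re f v hv p; have [gr gi] := @derivable_re g v hv p.
rewrite /cpd_fun.
rewrite (_ : re_fun (f * g) = re_fun f * re_fun g - im_fun f * im_fun g); last first.
  by apply/funext => q; rewrite /re_fun cinfM_fun Re_cplxM.
rewrite (_ : im_fun (f * g) = re_fun f * im_fun g + im_fun f * re_fun g); last first.
  by apply/funext => q; rewrite /im_fun cinfM_fun Im_cplxM.
have dM (h k : R * R -> R) (dh : derivable h p v) (dk : derivable k p v) :
  'D_v (h * k) p = h p * 'D_v k p + k p * 'D_v h p := deriveM dh dk.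
rewrite (deriveB (derivableM fr gr) (derivableM fi gi)).
rewrite (deriveD (derivableM fr gi) (derivableM fi gr)).
rewrite (dM _ _ fr gr) (dM _ _ fi gi) (dM _ _ fr gi) (dM _ _ fi gr).
rewrite /re_fun /im_fun; case: (f p) (g p) => [a b] [c d] /=.
by congr (_ +i* _) => /=; ring.
Qed.

Lemma cpd_fun_cst (a : C) p : cpd_fun v (cinf_cst a) p = 0.
Proof.
rewrite /cpd_fun (_ : re_fun _ = cst (complex.Re a)) //.
by rewrite (_ : im_fun _ = cst (complex.Im a)) // !derive_cst.
Qed.

Lemma cpd_fun_real (h : R * R -> R) (f : CF) p : (forall q, f q = (h q)%:C) ->
  cpd_fun v f p = ('D_v h p)%:C.
Proof.
move=> fh; rewrite /cpd_fun (_ : re_fun f = h); last first.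
  by apply/funext => q; rewrite /re_fun fh.
rewrite (_ : im_fun f = cst 0); last first.
  by apply/funext => q; rewrite /im_fun fh.
by rewrite derive_cst.
Qed.

End Dir.

Let d1P : dir1 R = dir1 R \/ dir1 R = dir2 R. Proof. by left. Qed.
Let d2P : dir2 R = dir1 R \/ dir2 R = dir2 R. Proof. by right. Qed.

Lemma pd1D f g : pd1 (f + g) = pd1 f + pd1 g.
Proof. by apply: cinfE => p; exact: cpd_funD. Qed.
Lemma pd2D f g : pd2 (f + g) = pd2 f + pd2 g.
Proof. by apply: cinfE => p; exact: cpd_funD. Qed.
Lemma pd1M f g : pd1 (f * g) = pd1 f * g + f * pd1 g.
Proof. by apply: cinfE => p; exact: cpd_funM. Qed.
Lemma pd2M f g : pd2 (f * g) = pd2 f * g + f * pd2 g.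
Proof. by apply: cinfE => p; exact: cpd_funM. Qed.
Lemma pd1c a : pd1 (cinf_cst a) = 0 :> CF.
Proof. by apply: cinfE => p; exact: cpd_fun_cst. Qed.
Lemma pd2c a : pd2 (cinf_cst a) = 0 :> CF.
Proof. by apply: cinfE => p; exact: cpd_fun_cst. Qed.

Lemma derive_fst v (p : R * R) : 'D_v (fst : R * R -> R) p = v.1.
Proof.
have [d _] := is_diff_fst p.
by rewrite deriveE // (@diff_val _ _ _ _ _ _ _ (is_diff_fst p)).
Qed.
Lemma derive_snd v (p : R * R) : 'D_v (snd : R * R -> R) p = v.2.
Proof.
have [d _] := is_diff_snd p.
by rewrite deriveE // (@diff_val _ _ _ _ _ _ _ (is_diff_snd p)).
Qed.

Lemma pd1X1 : pd1 cX1 = 1 :> CF.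
Proof. by apply: cinfE => p; rewrite [LHS](@cpd_fun_real _ fst cX1 p (fun=> erefl)) derive_fst. Qed.
Lemma pd1X2 : pd1 cX2 = 0 :> CF.
Proof. by apply: cinfE => p; rewrite [LHS](@cpd_fun_real _ snd cX2 p (fun=> erefl)) derive_snd. Qed.
Lemma pd2X1 : pd2 cX1 = 0 :> CF.
Proof. by apply: cinfE => p; rewrite [LHS](@cpd_fun_real _ fst cX1 p (fun=> erefl)) derive_fst. Qed.
Lemma pd2X2 : pd2 cX2 = 1 :> CF.
Proof. by apply: cinfE => p; rewrite [LHS](@cpd_fun_real _ snd cX2 p (fun=> erefl)) derive_snd. Qed.

Lemma pd1_exp (a b : R) : pd1 (cexp a b) = a%:C *: cexp a b.
Proof.
apply: cinfE => p; rewrite [LHS](@cpd_fun_real _ _ (cexp a b) p (fun=> erefl)).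
have [d _] := is_diff_expR_lin a b p.
rewrite deriveE // (@diff_val _ _ _ _ _ _ _ (is_diff_expR_lin a b p)) /=.
by rewrite mulr1 mulr0 addr0 mulrC rmorphM.
Qed.
Lemma pd2_exp (a b : R) : pd2 (cexp a b) = b%:C *: cexp a b.
Proof.
apply: cinfE => p; rewrite [LHS](@cpd_fun_real _ _ (cexp a b) p (fun=> erefl)).
have [d _] := is_diff_expR_lin a b p.
rewrite deriveE // (@diff_val _ _ _ _ _ _ _ (is_diff_expR_lin a b p)) /=.
by rewrite mulr1 mulr0 add0r mulrC rmorphM.
Qed.

Lemma cexpD (a b c d : R) : cexp a b * cexp c d = cexp (a + c) (b + d) :> CF.
Proof.
apply: cinfE => p; rewrite cinfM_fun /= -rmorphM -expRD /=; congr ((expR _)%:C).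
by ring.
Qed.

(** This is meant for functions whose successive derivatives are known only as
power series. *)
Lemma smooth_tower (phi : nat -> R -> R) (pr : R * R -> R) :
  (forall n (t : R), is_derive t (1 : R) (phi n) (phi n.+1 t)) ->
  pr = fst \/ pr = snd -> forall n, smooth (phi n \o pr).
Proof.
move=> H prP.
have H2 n p v : is_derive p v (phi n \o pr) (phi n.+1 (pr p) * 'D_v pr p).
  have Hp : is_diff p pr pr.
    by case: prP => ->; [exact: is_diff_fst|exact: is_diff_snd].
  have Hn : is_diff (pr p) (phi n) (fun h => h *: phi n.+1 (pr p)).
    have [dx ex] := H n (pr p).
    split; first exact/derivable1_diffP.
    rewrite diff1E; last exact/derivable1_diffP.
    by apply/funext => h; rewrite derive1E ex.
  have [d1 e1] := is_diff_comp Hp Hn.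
  split; first exact: diff_derivable.
  rewrite deriveE // e1.
  have [d2 e2] := Hp.
  by rewrite deriveE // e2 /= -[LHS]/(_ * _) mulrC.
have cst_pr v : exists c, 'D_v pr = cst c.
  by case: prP => ->; [exists v.1|exists v.2]; apply/funext => q;
    rewrite ?derive_fst ?derive_snd.
move=> n m; elim: m n => [|m IH] n.
  split=> // p; apply: differentiable_continuous.
  have Hp : is_diff p pr pr.
    by case: prP => ->; [exact: is_diff_fst|exact: is_diff_snd].
  apply: differentiable_comp; first by case: Hp.
  by have [dx _] := H n (pr p); apply/derivable1_diffP.
have C0 : continuous (phi n \o pr) by have := IH n; case: (m) => [|m'] [].
have D v : 'D_v (phi n \o pr) = (phi n.+1 \o pr) * 'D_v pr.
  by apply/funext => p; have [_ ->] := H2 n p v.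
split=> //; split.
- by move=> p; case: (H2 n p (dir1 R)).
- by move=> p; case: (H2 n p (dir2 R)).
- rewrite D; have [c ->] := cst_pr (dir1 R).
  by apply: CnM; [exact: IH|exact: Cn_cst].
- rewrite D; have [c ->] := cst_pr (dir2 R).
  by apply: CnM; [exact: IH|exact: Cn_cst].
Qed.

(** Power series whose coefficients are bounded by 1/n! converge everywhere, and
the bound is inherited by the derived series. *)
Lemma cvg_pseries_fact_bound (u : nat -> R) (x : R) :
  (forall n, `|u n| <= n`!%:R^-1) -> cvgn (pseries u x).
Proof.
move=> hu; apply: normed_cvg; rewrite /pseries /=.
apply: (@series_le_cvg _ _ (fun n => exp_coeff `|x| n)) => //=.
- by move=> n; rewrite exp_coeff_ge0.
- move=> n; rewrite normrM normrX exp_coeffE /= mulrC [leRHS]mulrC.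
  by apply: ler_wpM2l => //; exact: exprn_ge0.
exact: is_cvg_series_exp_coeff.
Qed.

Lemma diffs_fact_bound (u : nat -> R) :
  (forall n, `|u n| <= n`!%:R^-1) -> forall n, `|pseries_diffs u n| <= n`!%:R^-1.
Proof.
move=> hu n; rewrite /pseries_diffs normrM ger0_norm //.
apply: (le_trans (ler_wpM2l _ (hu n.+1))) => //.
by rewrite factS natrM invfM mulrA divff ?mul1r // pnatr_eq0.
Qed.

End Calculus.

(** * The second-order remainder of the exponential *)

Section ExpRemainder.
Variable R : realType.
Local Notation C := R[i].
Local Notation CF := (Cinf R).
Import numFieldNormedType.Exports.
Local Open Scope classical_set_scope.
Local Open Scope complex_scope.

Definition rem_coeff (n : nat) : R := (n.+2)`!%:R^-1.

Lemma rem_coeff_bound n : `|rem_coeff n| <= n`!%:R^-1.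
Proof.
rewrite /rem_coeff ger0_norm ?invr_ge0 ?ler0n // lef_pV2 ?posrE ?ltr0n ?fact_gt0 //.
by rewrite ler_nat !factS mulnA leq_pmull.
Qed.

Lemma iter_diffs_bound m n :
  `|iter m (@pseries_diffs R) rem_coeff n| <= n`!%:R^-1.
Proof.
elim: m n => [|m IH] n /=; first exact: rem_coeff_bound.
exact: diffs_fact_bound.
Qed.

(** The m-th derivative of (e^t - 1 - t) / t^2, as an everywhere convergent
power series. *)
Definition rem_fun (m : nat) (t : R) : R :=
  limn (pseries (iter m (@pseries_diffs R) rem_coeff) t).

Lemma is_derive_rem_fun m (t : R) :
  is_derive t (1 : R) (rem_fun m) (rem_fun m.+1 t).
Proof.
apply: (@pseries_snd_diffs _ _ (`|t| + 1)).
- exact/cvg_pseries_fact_bound/iter_diffs_bound.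
- by apply: cvg_pseries_fact_bound => n; exact: (iter_diffs_bound m.+1).
- by apply: cvg_pseries_fact_bound => n; exact: (iter_diffs_bound m.+2).
- by rewrite [ltRHS]ger0_norm ?addr_ge0 // ltrDl.
Qed.

Lemma expR_rem (t : R) : expR t = 1 + t + t ^+ 2 * rem_fun 0 t.
Proof.
have A : (series (exp_coeff t) (n + 2)%N) @[n --> \oo] --> expR t.
  by rewrite (cvg_shiftn 2); exact: is_cvg_series_exp_coeff.
have B : (1 + t + t ^+ 2 * pseries rem_coeff t n) @[n --> \oo]
           --> 1 + t + t ^+ 2 * rem_fun 0 t.
  apply: cvgD; first exact: cvg_cst.
  apply: cvgM; first exact: cvg_cst.
  exact/cvg_pseries_fact_bound/rem_coeff_bound.
apply: cvg_unique A _ => //; move: B; apply: cvg_trans.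
apply: near_eq_cvg; near=> n.
rewrite /pseries /series /= addn2 !big_nat_recl //= /exp_coeff /=.
rewrite expr0 expr1 !fact0 factS fact0 !divr1 addrA; congr (_ + _).
rewrite mulr_sumr; apply: eq_bigr => k _.
by rewrite /rem_coeff mulrCA -exprD add2n mulrC.
Unshelve. all: by end_near.
Qed.

Lemma smooth_rem (c : R) (pr : R * R -> R) : pr = fst \/ pr = snd ->
  smooth (fun q => rem_fun 0 (c * pr q)).
Proof.
move=> prP.
have := @smooth_tower R (fun n t => c ^+ n * rem_fun n (c * t)) pr _ prP 0%N.
rewrite (_ : _ \o pr = fun q => rem_fun 0 (c * pr q)); last first.
  by apply/funext => q /=; rewrite expr0 mul1r.
apply=> n t.
have H1 : is_derive t (1 : R) (fun t => c * t) c.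
  have H := @is_deriveZ _ _ _ (id : R -> R) c t 1 1 (is_derive_id _ _).
  by apply: is_derive_eq H _; exact: mulr1.
have H2 := is_derive_rem_fun n (c * t).
have H3 := is_derive1_comp H2 H1.
have H4 := @is_deriveZ _ _ _ _ (c ^+ n) t 1 _ H3.
by apply: is_derive_eq H4 _; rewrite exprSr -[LHS]/(_ * (_ * _)); ring.
Qed.

Lemma cexp_rem1 (c : R) : exists g : CF,
  cexp c 0 = 1 + c%:C *: cX1 + cX1 ^+ 2 * g.
Proof.
have sg : csmooth (fun q : R * R => (c ^+ 2 * rem_fun 0 (c * q.1))%:C).
  apply: csmooth_real => n.
  by apply: (@CnM _ n (cst (c ^+ 2))); [exact: Cn_cst|apply: smooth_rem; left].
exists (mk_cinf sg); apply: cinfE => p.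
rewrite !(cinfD_fun, cinfM_fun, cinfZ_fun) /= mul0r addr0 expR_rem.
rewrite !(rmorphD, rmorphM, rmorphXn, rmorph1) /=.
by ring.
Qed.

Lemma cexp_rem2 (c : R) : exists g : CF,
  cexp 0 c = 1 + c%:C *: cX2 + cX2 ^+ 2 * g.
Proof.
have sg : csmooth (fun q : R * R => (c ^+ 2 * rem_fun 0 (c * q.2))%:C).
  apply: csmooth_real => n.
  by apply: (@CnM _ n (cst (c ^+ 2))); [exact: Cn_cst|apply: smooth_rem; right].
exists (mk_cinf sg); apply: cinfE => p.
rewrite !(cinfD_fun, cinfM_fun, cinfZ_fun) /= mul0r add0r expR_rem.
rewrite !(rmorphD, rmorphM, rmorphXn, rmorph1) /=.
by ring.
Qed.

End ExpRemainder.

(** * Smooth superfunctions as quadruples of smooth functions *)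

Section CinfConstants.
Variable R : realType.
Local Notation CF := (Cinf R).
Local Open Scope complex_scope.

Lemma cinf_cst_is_zmod : zmod_morphism (@cinf_cst R).
Proof. by move=> a b; apply: cinfE. Qed.
Lemma cinf_cst_is_monoid : monoid_morphism (@cinf_cst R).
Proof. by split=> [|a b]; apply: cinfE. Qed.
HB.instance Definition _ := GRing.isZmodMorphism.Build R[i] CF (@cinf_cst R) cinf_cst_is_zmod.
HB.instance Definition _ := GRing.isMonoidMorphism.Build R[i] CF (@cinf_cst R) cinf_cst_is_monoid.

Definition cinf_real (a : R) : CF := cinf_cst a%:C.
Lemma cinf_real_is_zmod : zmod_morphism cinf_real.
Proof. by move=> a b; rewrite /cinf_real !rmorphB. Qed.
Lemma cinf_real_is_monoid : monoid_morphism cinf_real.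
Proof. by split=> [|a b]; rewrite /cinf_real ?rmorph1 ?rmorphM. Qed.
HB.instance Definition _ := GRing.isZmodMorphism.Build R CF cinf_real cinf_real_is_zmod.
HB.instance Definition _ := GRing.isMonoidMorphism.Build R CF cinf_real cinf_real_is_monoid.

Lemma cinf_scaleE a (f : CF) : a *: f = cinf_cst a * f. Proof. by []. Qed.
Lemma cinf_rscaleE (a : R) (f : CF) : a%:C *: f = cinf_real a * f. Proof. by []. Qed.
Lemma pd1N (f : CF) : pd1 (- f) = - pd1 f.
Proof. by rewrite -mulN1r -(rmorphN1 (@cinf_cst R)) pd1M pd1c mul0r add0r rmorphN1 mulN1r. Qed.
Lemma pd2N (f : CF) : pd2 (- f) = - pd2 f.
Proof. by rewrite -mulN1r -(rmorphN1 (@cinf_cst R)) pd2M pd2c mul0r add0r rmorphN1 mulN1r. Qed.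
Lemma pd10 : pd1 (0 : CF) = 0.
Proof. by rewrite -[X in pd1 X](rmorph0 (@cinf_cst R)) pd1c. Qed.
Lemma pd20 : pd2 (0 : CF) = 0.
Proof. by rewrite -[X in pd2 X](rmorph0 (@cinf_cst R)) pd2c. Qed.

End CinfConstants.

Section SuperQuadruple.
Variable R : realType.
Local Notation CF := (Cinf R).
Local Notation SF := (superfun R).
Local Open Scope complex_scope.

(** The superfunction a + b x_3 + c x_4 + d x_3 x_4. *)
Definition sf (a b c d : CF) : SF := [ffun s : bool * bool =>
  if s.1 then (if s.2 then d else b) else (if s.2 then c else a)].

Lemma sf_eta (f : SF) :
  f = sf (f (false, false)) (f (true, false)) (f (false, true)) (f (true, true)).
Proof. by apply/ffunP => -[[] []]; rewrite ffunE. Qed.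

Lemma sfD a b c d a' b' c' d' :
  sf a b c d + sf a' b' c' d' = sf (a + a') (b + b') (c + c') (d + d').
Proof. by apply/ffunP => -[[] []]; rewrite !ffunE. Qed.
Lemma sfN a b c d : - sf a b c d = sf (- a) (- b) (- c) (- d).
Proof. by apply/ffunP => -[[] []]; rewrite !ffunE. Qed.
Lemma sfZ k a b c d : k *: sf a b c d = sf (k *: a) (k *: b) (k *: c) (k *: d).
Proof. by apply/ffunP => -[[] []]; rewrite !ffunE. Qed.

Lemma big_bool_pair (V : nmodType) (F : bool * bool -> V) (P : pred (bool * bool)) :
  \sum_(t | P t) F t = (if P (true, true) then F (true, true) else 0)
    + (if P (true, false) then F (true, false) else 0)
    + ((if P (false, true) then F (false, true) else 0)
    + (if P (false, false) then F (false, false) else 0)).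
Proof.
rewrite big_mkcond /=.
pose G x y := if P (x, y) then F (x, y) else 0.
rewrite (eq_bigr (fun t => G t.1 t.2)); last by case.
rewrite -(pair_bigA _ G).
by rewrite !big_bool /=.
Qed.

Lemma smul_sf a b c d a' b' c' d' : smul (sf a b c d) (sf a' b' c' d') =
  sf (a * a') (a * b' + b * a') (a * c' + c * a')
     (a * d' + d * a' + b * c' - c * b').
Proof.
apply/ffunP => -[[] []]; rewrite !ffunE; rewrite big_bool_pair /= !big_bool_pair /= !ffunE /=;
 rewrite ?expr0 ?expr1; ring.
Qed.

Lemma sX1E : sX R i1 = sf cX1 0 0 0.
Proof. by apply/ffunP => -[[] []]; rewrite !ffunE. Qed.
Lemma sX2E : sX R i2 = sf cX2 0 0 0.
Proof. by apply/ffunP => -[[] []]; rewrite !ffunE. Qed.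
Lemma sX3E : sX R i3 = sf 0 1 0 0.
Proof. by apply/ffunP => -[[] []]; rewrite !ffunE. Qed.
Lemma sX4E : sX R i4 = sf 0 0 1 0.
Proof. by apply/ffunP => -[[] []]; rewrite !ffunE. Qed.
Lemma sscalE c : sscal c = sf c 0 0 0.
Proof. by apply/ffunP => -[[] []]; rewrite !ffunE. Qed.

Lemma mulx1E a b c d : mulx i1 (sf a b c d) = sf (cX1 * a) (cX1 * b) (cX1 * c) (cX1 * d).
Proof. by rewrite /mulx sX1E smul_sf; congr sf; ring. Qed.
Lemma mulx2E a b c d : mulx i2 (sf a b c d) = sf (cX2 * a) (cX2 * b) (cX2 * c) (cX2 * d).
Proof. by rewrite /mulx sX2E smul_sf; congr sf; ring. Qed.
Lemma mulx3E a b c d : mulx i3 (sf a b c d) = sf 0 a 0 c.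
Proof. by rewrite /mulx sX3E smul_sf; congr sf; ring. Qed.
Lemma mulx4E a b c d : mulx i4 (sf a b c d) = sf 0 0 a (- b).
Proof. by rewrite /mulx sX4E smul_sf; congr sf; ring. Qed.

Lemma sd1E a b c d : sd i1 (sf a b c d) = sf (pd1 a) (pd1 b) (pd1 c) (pd1 d).
Proof. by apply/ffunP => -[[] []]; rewrite !ffunE. Qed.
Lemma sd2E a b c d : sd i2 (sf a b c d) = sf (pd2 a) (pd2 b) (pd2 c) (pd2 d).
Proof. by apply/ffunP => -[[] []]; rewrite !ffunE. Qed.
Lemma sd3E a b c d : sd i3 (sf a b c d) = sf b 0 d 0.
Proof. by apply/ffunP => -[[] []]; rewrite !ffunE. Qed.
Lemma sd4E a b c d : sd i4 (sf a b c d) = sf c (- d) 0 0.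
Proof. by apply/ffunP => -[[] []]; rewrite !ffunE /= ?expr0 ?expr1 ?mul1r ?mulN1r. Qed.

Definition mulxE := (mulx1E, mulx2E, mulx3E, mulx4E).
Definition sdE := (sd1E, sd2E, sd3E, sd4E).
Definition sfE := (sfD, sfN, sfZ).

End SuperQuadruple.

Definition scale_cinf := (cinf_rscaleE, cinf_scaleE).

Section Vec4.
Variable R : realType.

Definition vec4 (a1 a2 a3 a4 : R) : 'rV[R]_4 :=
  \row_(i < 4) match val i with 0 => a1 | 1 => a2 | 2 => a3 | _ => a4 end.

Lemma big4 (V : nmodType) (F : 'I_4 -> V) : \sum_i F i = F i1 + F i2 + F i3 + F i4.
Proof.
rewrite !big_ord_recr big_ord0 /= add0r.
by congr (_ + _ + _ + _); congr F; apply: val_inj.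
Qed.

Lemma forall4 (P : 'I_4 -> Prop) : P i1 -> P i2 -> P i3 -> P i4 -> forall i, P i.
Proof.
move=> h1 h2 h3 h4 [] [|[|[|[|i]]]] // lt_i.
- by rewrite (_ : Ordinal _ = i1) //; apply: val_inj.
- by rewrite (_ : Ordinal _ = i2) //; apply: val_inj.
- by rewrite (_ : Ordinal _ = i3) //; apply: val_inj.
- by rewrite (_ : Ordinal _ = i4) //; apply: val_inj.
Qed.

Lemma vec4_1 a1 a2 a3 a4 : vec4 a1 a2 a3 a4 0 i1 = a1. Proof. by rewrite mxE. Qed.
Lemma vec4_2 a1 a2 a3 a4 : vec4 a1 a2 a3 a4 0 i2 = a2. Proof. by rewrite mxE. Qed.
Lemma vec4_3 a1 a2 a3 a4 : vec4 a1 a2 a3 a4 0 i3 = a3. Proof. by rewrite mxE. Qed.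
Lemma vec4_4 a1 a2 a3 a4 : vec4 a1 a2 a3 a4 0 i4 = a4. Proof. by rewrite mxE. Qed.
Definition vec4_nth := (vec4_1, vec4_2, vec4_3, vec4_4).
Lemma vec4D a1 a2 a3 a4 b1 b2 b3 b4 :
  vec4 a1 a2 a3 a4 + vec4 b1 b2 b3 b4 = vec4 (a1 + b1) (a2 + b2) (a3 + b3) (a4 + b4).
Proof. by apply/rowP; apply: forall4; rewrite mxE !vec4_nth. Qed.
Lemma vec4Z k a1 a2 a3 a4 : k *: vec4 a1 a2 a3 a4 = vec4 (k * a1) (k * a2) (k * a3) (k * a4).
Proof. by apply/rowP; apply: forall4; rewrite mxE !vec4_nth. Qed.

End Vec4.

(** * Linearity of the operators *)

Section LinearOps.
Variable R : realType.
Local Notation CF := (Cinf R).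
Local Notation SF := (superfun R).
Local Open Scope complex_scope.

Definition lin_op (P : SF -> SF) := forall (k : R[i]) f g, P (k *: f + g) = k *: P f + P g.

Lemma lin_smul h : lin_op (smul h).
Proof.
move=> k f g; rewrite (sf_eta h) (sf_eta f) (sf_eta g) !(sfZ, sfD, smul_sf) !cinf_scaleE.
by congr (@sf R); ring.
Qed.

Lemma lin_mulx n : lin_op (mulx n).
Proof. exact: lin_smul. Qed.

Lemma pd1Z (k : R[i]) (f : CF) : pd1 (k *: f) = k *: pd1 f.
Proof. by rewrite !cinf_scaleE pd1M pd1c mul0r add0r. Qed.
Lemma pd2Z (k : R[i]) (f : CF) : pd2 (k *: f) = k *: pd2 f.
Proof. by rewrite !cinf_scaleE pd2M pd2c mul0r add0r. Qed.

Lemma lin_sd n : lin_op (sd n).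
Proof.
move=> k f g; rewrite (sf_eta f) (sf_eta g); move: n.
apply: forall4; rewrite !(sfZ, sfD, sdE) ?pd1D ?pd2D ?pd1Z ?pd2Z //.
  by rewrite !scaler0 !addr0.
by rewrite !cinf_scaleE; congr (@sf R); ring.
Qed.

Lemma lin_comp P Q : lin_op P -> lin_op Q -> lin_op (P \o Q).
Proof. by move=> lP lQ k f g /=; rewrite lQ lP. Qed.
Lemma lin_add P Q : lin_op P -> lin_op Q -> lin_op (fun f => P f + Q f).
Proof. by move=> lP lQ k f g /=; rewrite lQ lP scalerDr addrACA. Qed.
Lemma lin_scale (a : R[i]) P : lin_op P -> lin_op (fun f => a *: P f).
Proof. by move=> lP k f g /=; rewrite lP scalerDr !scalerA mulrC. Qed.
Lemma lin_opp P : lin_op P -> lin_op (fun f => - P f).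
Proof. by move=> lP k f g /=; rewrite lP scalerN opprD. Qed.

Lemma lin_bessel (al lam : R) n : lin_op (bessel al lam n).
Proof.
have ls := lin_sd; have lm := lin_mulx.
have lss m n' : lin_op (fun f => sd m (sd n' f)) by apply: (lin_comp (ls m)).
have lms m n' : lin_op (fun f => mulx m (sd n' f)) by apply: (lin_comp (lm m)).
have lmss m n' p : lin_op (fun f => mulx m (sd n' (sd p f))) by apply: (lin_comp (lm m)).
move: n; apply: forall4; rewrite /bessel /=;
  do ?[apply: lin_add => // | apply: lin_opp => // | apply: lin_scale => //].
Qed.

Lemma lin_sum (I : finType) (P : I -> SF -> SF) :
  (forall i, lin_op (P i)) -> lin_op (fun f => \sum_i P i f).
Proof.
move=> lP k f g; rewrite scaler_sumr -big_split; apply: eq_bigr => i _; exact: lP.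
Qed.

Lemma lin_dT (T : 'M[R]_4) : lin_op (dT T).
Proof.
apply: lin_sum => b; apply: lin_sum => c; apply: lin_scale.
exact: (lin_comp (lin_mulx c) (lin_sd b)).
Qed.

Definition rpolyC (r : R) : {poly R[i]} := r%:C%:P.
Lemma rpolyC_is_zmod : zmod_morphism rpolyC.
Proof. by move=> a b; rewrite /rpolyC !rmorphB. Qed.
Lemma rpolyC_is_monoid : monoid_morphism rpolyC.
Proof. by split=> [|a b]; rewrite /rpolyC ?rmorph1 ?rmorphM. Qed.
HB.instance Definition _ := GRing.isZmodMorphism.Build R {poly R[i]} rpolyC rpolyC_is_zmod.
HB.instance Definition _ := GRing.isMonoidMorphism.Build R {poly R[i]} rpolyC rpolyC_is_monoid.

End LinearOps.

(** * Derivations of the Jordan superalgebra *)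

Section Derivations.
Variables (R : realType) (al : R).
Local Open Scope complex_scope.
Local Notation K := (@cinf_real R).
Local Notation sf := (@sf R).

Lemma jmulE (a b : 'rV[R]_4) : jmul al a b =
  vec4 (a 0 i1 * b 0 i1 + (a 0 i3 * b 0 i4 - a 0 i4 * b 0 i3))
       (a 0 i2 * b 0 i2 + al * (a 0 i3 * b 0 i4 - a 0 i4 * b 0 i3))
       (2^-1 * ((a 0 i1 + a 0 i2) * b 0 i3 + a 0 i3 * (b 0 i1 + b 0 i2)))
       (2^-1 * ((a 0 i1 + a 0 i2) * b 0 i4 + a 0 i4 * (b 0 i1 + b 0 i2))).
Proof.
apply/rowP; rewrite /jmul big4 !(big4 (fun j => _ *: _)) /jtab /=.
by apply: forall4; rewrite !mxE /= ?mulr1n ?mulr0n; ring.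
Qed.

(** xi |-> h xi + e eta, eta |-> f xi - h eta, a copy of sl_2. *)
Definition derE (h e f : R) : 'M[R]_4 := \matrix_(b < 4, c < 4)
  match val b, val c with
  | 2, 2 => h | 2, 3 => e | 3, 2 => f | 3, 3 => - h | _, _ => 0
  end.

(** e_1 |-> p xi + q eta =: w and e_2 |-> - w; the values on xi and eta are then
forced by e_1 xi = xi / 2 and e_1 eta = eta / 2. *)
Definition derO (p q : R) : 'M[R]_4 := \matrix_(b < 4, c < 4)
  match val b, val c with
  | 0, 2 => p | 0, 3 => q | 1, 2 => - p | 1, 3 => - q
  | 2, 0 => 2 * q | 2, 1 => - (2 * al * q)
  | 3, 0 => - (2 * p) | 3, 1 => 2 * al * p | _, _ => 0
  end.

Lemma mulmx_derE (v : 'rV[R]_4) h e f :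
  v *m derE h e f = vec4 0 0 (v 0 i3 * h + v 0 i4 * f) (v 0 i3 * e - v 0 i4 * h).
Proof.
apply/rowP; apply: forall4; rewrite mxE big4 vec4_nth !mxE /=; ring.
Qed.

Lemma mulmx_derO (v : 'rV[R]_4) p q :
  v *m derO p q = vec4 (2 * (v 0 i3 * q - v 0 i4 * p)) (2 * al * (v 0 i4 * p - v 0 i3 * q))
    ((v 0 i1 - v 0 i2) * p) ((v 0 i1 - v 0 i2) * q).
Proof.
apply/rowP; apply: forall4; rewrite mxE big4 vec4_nth !mxE /=; ring.
Qed.

Lemma superder_E h e f : superder al false (derE h e f).
Proof.
split; first by apply: forall4; apply: forall4; rewrite /par /= !mxE.
move=> q a b _; rewrite /= expr0 scale1r.
by rewrite !mulmx_derE !jmulE !vec4_nth vec4D; congr vec4; ring.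
Qed.

Lemma superder_O p q : superder al true (derO p q).
Proof.
split; first by apply: forall4; apply: forall4; rewrite /par /= !mxE.
move=> r a b ar; rewrite /= !mulmx_derO !jmulE !vec4_nth vec4Z vec4D.
have {ar} : if r then a 0 i1 = 0 /\ a 0 i2 = 0 else a 0 i3 = 0 /\ a 0 i4 = 0.
  by case: r ar => ar; split; apply: ar.
case: r => -[-> ->]; rewrite ?expr0 ?expr1; congr vec4; field; by [].
Qed.

Lemma superder_inv p T a b q : superder al p T -> D_homog q a ->
  jmul al a b *m T = jmul al (a *m T) b + (-1) ^+ (p && q) *: jmul al a (b *m T).
Proof. by case=> _; exact. Qed.

Lemma eb_homog (i : 'I_4) : D_homog (par i) (eb R i).
Proof. by move=> j ne; rewrite /eb mxE /=; case: (j =P i) ne => // ->; rewrite eqxx. Qed.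

Lemma ebM i (T : 'M[R]_4) : eb R i *m T = row i T.
Proof. by rewrite /eb rowE. Qed.

Lemma superder_basis p T i j c : superder al p T ->
  (jmul al (eb R i) (eb R j) *m T) 0 c = (jmul al (row i T) (eb R j)) 0 c
     + (-1) ^+ (p && par i) * (jmul al (eb R i) (row j T)) 0 c.
Proof.
move=> sT; rewrite (superder_inv (eb R j) sT (@eb_homog i)) !ebM.
by rewrite mxE [X in _ + X]mxE.
Qed.

(** The idempotents e_1, e_2 force an even derivation to vanish on them, and
xi eta = e_1 + al e_2 then forces trace zero on the span of xi and eta. *)
Lemma superder_E_inv T : superder al false T ->
  T = derE (T i3 i3) (T i3 i4) (T i4 i3).
Proof.
move=> sT; have [z _] := sT.
have := superder_basis i1 i1 i1 sT; have := superder_basis i1 i1 i2 sT.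
have := superder_basis i2 i2 i1 sT; have := superder_basis i2 i2 i2 sT.
have := superder_basis i3 i4 i1 sT.
rewrite !jmulE !mxE !(big4 (fun j => _ * _)) !mxE /= !expr0.
have := z i1 i3 isT; have := z i1 i4 isT; have := z i2 i3 isT; have := z i2 i4 isT.
have := z i3 i1 isT; have := z i3 i2 isT; have := z i4 i1 isT; have := z i4 i2 isT.
move=> z1 z2 z3 z4 z5 z6 z7 z8; rewrite ?(z1, z2, z3, z4, z5, z6, z7, z8).
move=> h5 h1 h2 h3 h4.
have a11 : T i1 i1 = 0 by lra.
have a12 : T i1 i2 = 0 by lra.
have a21 : T i2 i1 = 0 by lra.
have a22 : T i2 i2 = 0 by lra.
rewrite ?(a11, a12, a21, a22) in h5.
by apply/matrixP; apply: forall4; apply: forall4; rewrite !mxE /= //; lra.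
Qed.

(** The relation e_1 e_2 = 0 gives T e_2 = - T e_1; the products e_1 xi and
e_1 eta determine the rest. *)
Lemma superder_O_inv T : superder al true T ->
  T = derO (T i1 i3) (T i1 i4).
Proof.
move=> sT; have [z _] := sT.
have := superder_basis i1 i2 i3 sT; have := superder_basis i1 i2 i4 sT.
have := superder_basis i1 i3 i1 sT; have := superder_basis i1 i3 i2 sT.
have := superder_basis i1 i4 i1 sT; have := superder_basis i1 i4 i2 sT.
rewrite !jmulE !mxE !(big4 (fun j => _ * _)) !mxE /= !expr0.
have := z i1 i1 isT; have := z i1 i2 isT; have := z i2 i1 isT; have := z i2 i2 isT.
have := z i3 i3 isT; have := z i3 i4 isT; have := z i4 i3 isT; have := z i4 i4 isT.
move=> z1 z2 z3 z4 z5 z6 z7 z8; rewrite ?(z1, z2, z3, z4, z5, z6, z7, z8).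
move=> h1 h2 h3 h4 h5 h6.
by apply/matrixP; apply: forall4; apply: forall4; rewrite !mxE /= //; lra.
Qed.

(** Hence the derivations have dimension 3|2 for every value of al. *)
Lemma DerP T : Der al T -> exists h e f p q, T = derE h e f + derO p q.
Proof.
case=> T0 [T1 [/superder_E_inv-> /superder_O_inv-> ->]].
by do 5!eexists.
Qed.

Lemma DerEO h e f p q : Der al (derE h e f + derO p q).
Proof. by exists (derE h e f), (derO p q); split=> //; [exact: superder_E|exact: superder_O]. Qed.

Lemma derE0 : derE 0 0 0 = 0.
Proof. by apply/matrixP; apply: forall4; apply: forall4; rewrite !mxE /= ?oppr0. Qed.
Lemma derO0 : derO 0 0 = 0.
Proof. by apply/matrixP; apply: forall4; apply: forall4; rewrite !mxE /= ?mulr0 ?oppr0. Qed.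
Lemma DerE h e f : Der al (derE h e f).
Proof. by have := DerEO h e f 0 0; rewrite derO0 addr0. Qed.
Lemma DerO p q : Der al (derO p q).
Proof. by have := DerEO 0 0 0 p q; rewrite derE0 add0r. Qed.
Lemma Der0 : Der al 0.
Proof. by have := DerO 0 0; rewrite derO0. Qed.

Lemma dTD T1 T2 f : dT (T1 + T2) f = dT T1 f + dT T2 f :> superfun R.
Proof.
rewrite /dT -big_split; apply: eq_bigr => b _ /=; rewrite -big_split.
by apply: eq_bigr => c _ /=; rewrite mxE rmorphD scalerDl.
Qed.

Lemma dT_derE h e f a b c d : dT (derE h e f) (sf a b c d) =
  sf 0 (K h * b + K f * c) (K e * b - K h * c) 0.
Proof.
rewrite /dT big4 !(big4 (fun c => _ *: _)) !mxE /= !(mulxE, sdE, sfE) !scale_cinf.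
by rewrite !(rmorph0, rmorphN); congr sf; ring.
Qed.

Lemma jLE (v : 'rV[R]_4) b c : jL al v b c = (jmul al v (eb R b)) 0 c.
Proof. by rewrite /jL /lin1_mx mxE. Qed.

Definition jmat (a1 a2 a3 a4 : R) : 'M[R]_4 := \matrix_(b < 4, c < 4)
  match val b, val c with
  | 0, 0 => a1 | 1, 1 => a2 | 0, 2 | 1, 2 => 2^-1 * a3 | 0, 3 | 1, 3 => 2^-1 * a4
  | 2, 0 => - a4 | 2, 1 => - (al * a4) | 3, 0 => a3 | 3, 1 => al * a3
  | 2, 2 | 3, 3 => 2^-1 * (a1 + a2) | _, _ => 0
  end.

Lemma eb_vec4 : [/\ eb R i1 = vec4 1 0 0 0, eb R i2 = vec4 0 1 0 0,
  eb R i3 = vec4 0 0 1 0 & eb R i4 = vec4 0 0 0 1].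
Proof. by split; apply/rowP; apply: forall4; rewrite !mxE. Qed.

Lemma jL_vec4 a1 a2 a3 a4 : jL al (vec4 a1 a2 a3 a4) = jmat a1 a2 a3 a4.
Proof.
have [e1 e2 e3 e4] := eb_vec4.
apply/matrixP; apply: forall4; move=> c; rewrite jLE ?(e1, e2, e3, e4) jmulE !vec4_nth.
all: move: c; apply: forall4; rewrite vec4_nth mxE /=; ring.
Qed.

End Derivations.

(** * The polynomials U and V *)

Section RealLaguerre.
Variables (R : realType) (b : R).

Definition fprod (n k : nat) : R := \prod_(n <= l < k) (b - l%:R).

Lemma fprodSr n k : (n <= k)%N -> fprod n k.+1 = fprod n k * (b - k%:R).
Proof. by move=> nk; rewrite /fprod big_nat_recr. Qed.
Lemma fprodSl n k : (n < k)%N -> fprod n k = (b - n%:R) * fprod n.+1 k.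
Proof. by move=> nk; rewrite /fprod big_ltn. Qed.
Lemma fprodnn n : fprod n n = 1.
Proof. by rewrite /fprod big_geq. Qed.

(** Reversing the order of summation in U(-k, s - b, 4 X) gives these
coefficients; s = 0 is the polynomial U and s = 1 the polynomial V.  In this
form each relation below is an identity between products of b - l. *)
Definition lagR (s k : nat) : {poly R} :=
  \poly_(n < k.+1) (4 ^+ n * 'C(k, n)%:R * fprod (n + s) (k + s)).

Lemma coef_lagR s k n : (lagR s k)`_n = 4 ^+ n * 'C(k, n)%:R * fprod (n + s) (k + s).
Proof.
rewrite coef_poly ltnS; case: leqP => // kn.
by rewrite bin_small // mulr0 mul0r.
Qed.

Lemma coef_natM n (p : {poly R}) m : (n%:R * p)`_m = n%:R * p`_m.
Proof. by rewrite mulr_natl coefMn mulr_natl. Qed.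

Lemma size_lagR s k : size (lagR s k) = k.+1.
Proof.
apply: size_poly_eq; rewrite binn mulr1 fprodnn mulr1 expf_neq0 //.
by rewrite pnatr_eq0.
Qed.

Lemma lagR0 s : lagR s 0 = 1.
Proof.
apply/polyP => n; rewrite coef_lagR coef1; case: n => [|n] /=.
  by rewrite expr0 bin0 fprodnn !mulr1.
by rewrite mulr0 mul0r.
Qed.

Lemma lagR_deriv k : (lagR 0 k.+1)^`() = 4 * k.+1%:R * lagR 1 k.
Proof.
apply/polyP => n; rewrite coef_deriv -mulrA !coef_natM !coef_lagR !addn0 !addn1.
have := mul_bin_diag k.+1 n => /= /(congr1 (fun m => m%:R : R)); rewrite !natrM => e.
rewrite -[LHS]mulr_natl exprS.
transitivity (4 * 4 ^+ n * (n.+1%:R * 'C(k.+1, n.+1)%:R) * fprod n.+1 k.+1); first by ring.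
by rewrite -e; ring.
Qed.

Lemma lagR_rec k : lagR 0 k.+1 = 4 * 'X * lagR 1 k + (b - k%:R)%:P * lagR 0 k.
Proof.
apply/polyP => n; rewrite -mulrA coefD coef_natM coefXM coefCM !coef_lagR.
case: n => [|n] /=; rewrite ?addn0 ?addn1.
  by rewrite !bin0 fprodSr //; ring.
rewrite binS natrD exprS.
case: (leqP n.+1 k) => nk; first by rewrite fprodSr //; ring.
by rewrite bin_small //; ring.
Qed.

Lemma lagR_euler k : 'X * (lagR 1 k)^`() = b%:P * lagR 1 k - (b - k%:R)%:P * lagR 0 k.
Proof.
apply/polyP => n; rewrite coefB !coefCM coefXM.
have -> : (if n == 0%N then 0 else (lagR 1 k)^`()`_n.-1) = n%:R * (lagR 1 k)`_n.
  by case: n => [|n] /=; rewrite ?mul0r // coef_deriv mulr_natl.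
rewrite !coef_lagR !addn0 !addn1; case: (leqP n k) => nk; last first.
  by rewrite bin_small //; ring.
have := fprodSr nk; rewrite fprodSl // => e.
apply: subr0_eq; transitivity (4 ^+ n * 'C(k, n)%:R *
  (fprod n k * (b - k%:R) - (b - n%:R) * fprod n.+1 k.+1)); first by ring.
by rewrite e subrr mulr0.
Qed.

Lemma lagR_contig k : lagR 1 k.+1 = lagR 0 k.+1 - k.+1%:R * lagR 1 k.
Proof.
apply/polyP => n; rewrite coefB coef_natM !coef_lagR !addn0 !addn1.
have := mul_bin_down k.+1 n => /= /(congr1 (fun m => m%:R : R)); rewrite !natrM => e.
rewrite (_ : k.+1%:R * _ = 4 ^+ n * (k.+1%:R * 'C(k, n)%:R) * fprod n.+1 k.+1);
  last by ring.
rewrite e; case: (ltngtP n k.+1) => nk; last first.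
- by rewrite nk !fprodnn subnn; ring.
- by rewrite bin_small //; ring.
rewrite natrB 1?ltnW // fprodSr // (fprodSl nk).
ring.
Qed.

(** The next two lemmas identify the hypergeometric coefficients with those of
[lagR]. *)
Lemma poch_opp k m : (m <= k)%N ->
  (-1) ^+ m / m`!%:R * poch (- k%:R) m = 'C(k, m)%:R :> R.
Proof.
move=> mk; have nz : m`!%:R != 0 :> R by rewrite pnatr_eq0 -lt0n fact_gt0.
apply: (mulIf nz); rewrite mulrAC divfK // -natrM bin_ffact.
elim: m mk {nz} => [|m IH] mk; first by rewrite /poch big_ord0 expr0 mulr1 ffactn0.
rewrite ffactnSr natrM -IH 1?ltnW // natrB 1?ltnW // /poch big_ord_recr /= exprS; ring.
Qed.

Lemma poch_fprod s k m : (m <= k)%N ->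
  poch (1 - k%:R - (s%:R - b)) m = fprod (k - m + s) (k + s).
Proof.
elim: m => [|m IH] mk; first by rewrite subn0 fprodnn /poch big_ord0.
rewrite /poch big_ord_recr /= -/(poch _ m) IH 1?ltnW // [RHS]fprodSl; last first.
  by rewrite ltn_add2r ltn_subrL /=; apply: leq_ltn_trans mk.
rewrite -addSn subnSK // mulrC; congr (_ * _).
by rewrite natrD natrB // -natr1; ring.
Qed.

End RealLaguerre.

(** * Coordinates adapted to the value of lam *)

Section Model.
Variables (R : realType) (al lam : R).
Hypothesis al_neq0 : al != 0.
Hypothesis al_neq1 : al != 1.
Hypothesis lamP : lam = al \/ lam = 1.
Local Open Scope complex_scope.
Local Notation C := R[i].
Local Notation CF := (Cinf R).
Local Notation SF := (superfun R).
Local Notation Q := (quotSF al lam).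
Local Notation K := (@cinf_real R).
Local Notation xi := (cXi al lam).
Local Notation be := (K (beta al lam)).
Local Notation jj := (@jj R al lam).
Local Notation cls := (@cls R al lam).
Local Notation rep := (@rep R al lam).
Local Notation act := (@schroedinger_quot R al lam).
Local Notation rpolyC := (@rpolyC R).
Local Notation sf := (@sf R).
Local Notation submod L N := (submodule (quot_homog al lam) act L N).

Definition xj : CF := if lam == al then cX2 else cX1.
Definition di (f : CF) : CF := if lam == al then pd1 f else pd2 f.
Definition dj (f : CF) : CF := if lam == al then pd2 f else pd1 f.
Definition dd (f : CF) : CF := pd1 (pd2 f).
Definition ii : 'I_4 := if lam == al then i1 else i2.
(** The constant with x_3 x_4 = -2 gam x_i x_j modulo the ideal. *)
Definition gam : R := if lam == al then 1 else al.
Local Notation ga := (K gam).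
Local Notation bet := (beta al lam).
Local Notation bp := (rpolyC bet).
Local Notation gp := (rpolyC gam).
Local Notation hp := (rpolyC 2^-1).
Local Notation bC := (bet%:C : C).
Local Notation gC := (gam%:C : C).
Local Notation kap m := (m%:R - bC).
Definition E : CF := cexp (- 2) (- 2).

Lemma diD f g : di (f + g) = di f + di g.
Proof. by rewrite /di; case: (lam == al); rewrite ?pd1D ?pd2D. Qed.
Lemma djD f g : dj (f + g) = dj f + dj g.
Proof. by rewrite /dj; case: (lam == al); rewrite ?pd1D ?pd2D. Qed.
Lemma diM f g : di (f * g) = di f * g + f * di g.
Proof. by rewrite /di; case: (lam == al); rewrite ?pd1M ?pd2M. Qed.
Lemma djM f g : dj (f * g) = dj f * g + f * dj g.
Proof. by rewrite /dj; case: (lam == al); rewrite ?pd1M ?pd2M. Qed.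
Lemma dic a : di (cinf_cst a) = 0.
Proof. by rewrite /di; case: (lam == al); rewrite ?pd1c ?pd2c. Qed.
Lemma djc a : dj (cinf_cst a) = 0.
Proof. by rewrite /dj; case: (lam == al); rewrite ?pd1c ?pd2c. Qed.
Lemma dir (a : R) : di (cinf_real a) = 0. Proof. exact: dic. Qed.
Lemma djr (a : R) : dj (cinf_real a) = 0. Proof. exact: djc. Qed.
Lemma diN f : di (- f) = - di f.
Proof. by rewrite -mulN1r -(rmorphN1 (@cinf_cst R)) diM dic mul0r add0r rmorphN1 mulN1r. Qed.
Lemma djN f : dj (- f) = - dj f.
Proof. by rewrite -mulN1r -(rmorphN1 (@cinf_cst R)) djM djc mul0r add0r rmorphN1 mulN1r. Qed.
Lemma di1 : di 1 = 0. Proof. by rewrite -(rmorph1 (@cinf_cst R)) dic. Qed.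
Lemma dj1 : dj 1 = 0. Proof. by rewrite -(rmorph1 (@cinf_cst R)) djc. Qed.
Lemma di0 : di 0 = 0. Proof. by rewrite -{1}(rmorph0 (@cinf_cst R)) dic. Qed.
Lemma dj0 : dj 0 = 0. Proof. by rewrite -{1}(rmorph0 (@cinf_cst R)) djc. Qed.
Lemma din n : di n%:R = 0. Proof. by rewrite -(rmorph_nat (@cinf_cst R) n) dic. Qed.
Lemma djn n : dj n%:R = 0. Proof. by rewrite -(rmorph_nat (@cinf_cst R) n) djc. Qed.
Lemma dixi : di xi = 1.
Proof. by rewrite /di /cXi; case: (lam == al); rewrite ?pd1X1 ?pd2X2. Qed.
Lemma dixj : di xj = 0.
Proof. by rewrite /di /xj; case: (lam == al); rewrite ?pd1X2 ?pd2X1. Qed.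
Lemma djxi : dj xi = 0.
Proof. by rewrite /dj /cXi; case: (lam == al); rewrite ?pd1X2 ?pd2X1. Qed.
Lemma djxj : dj xj = 1.
Proof. by rewrite /dj /xj; case: (lam == al); rewrite ?pd1X1 ?pd2X2. Qed.
Lemma di_expE : di E = - 2 * E.
Proof.
by rewrite /di; case: (lam == al); rewrite ?pd1_exp ?pd2_exp cinf_rscaleE !rmorphN rmorph_nat.
Qed.
Lemma dj_expE : dj E = - 2 * E.
Proof.
by rewrite /dj; case: (lam == al); rewrite ?pd1_exp ?pd2_exp cinf_rscaleE !rmorphN rmorph_nat.
Qed.

Definition diE := (diD, diN, diM, dic, dir, di1, di0, din, dixi, dixj, di_expE).
Definition djE := (djD, djN, djM, djc, djr, dj1, dj0, djn, djxi, djxj, dj_expE).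

(** This Leibniz rule holds for either order of the two derivatives, so that
their commutation never enters. *)
Lemma dd_xj r : dd (xj * r) = di r + xj * dd r.
Proof.
rewrite /dd /di /xj; case: (lam == al).
  by rewrite pd2M pd2X2 mul1r pd1D pd1M pd1X2 mul0r add0r.
by rewrite pd2M pd2X1 mul0r add0r pd1M pd1X1 mul1r.
Qed.
Lemma ddD f g : dd (f + g) = dd f + dd g.
Proof. by rewrite /dd pd2D pd1D. Qed.

Lemma lam_cases : ((lam == al) = true /\ lam = al) \/
   ((lam == al) = false /\ lam = 1).
Proof.
case: lamP => ->; first by left; rewrite eqxx.
by right; rewrite eq_sym (negbTE al_neq1).
Qed.

(** * The operators on quadruples *)

Lemma bessel_iiE a b c d : bessel al lam ii (sf a b c d) =
  sf (- be * di a + xi * di (di a) + 2 * ga * be * xj * d)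
     ((1 - be) * di b + xi * di (di b))
     ((1 - be) * di c + xi * di (di c))
     ((2 - be) * di d + xi * di (di d)).
Proof.
rewrite /di /ii /cXi /xj /beta /gam.
case: lam_cases => -[-> ->]; rewrite /bessel /= !(mulxE, sdE, sfE) !scale_cinf.
  by rewrite !rmorphM rmorph1 rmorph_nat; congr sf; ring.
have e : K al * K (al^-1) = 1 by rewrite -rmorphM divff ?rmorph1.
rewrite !rmorphM rmorph1 rmorph_nat; congr sf; ring: e.
Qed.

Lemma bessel_jjE a b c d : bessel al lam jj (sf a b c d) =
  sf (- dj a + xj * dj (dj a) + 2 * ga * xi * d)
     (xj * dj (dj b)) (xj * dj (dj c)) (dj d + xj * dj (dj d)).
Proof.
rewrite /dj /jj /cXi /xj /gam.
case: lam_cases => -[-> ->]; rewrite /bessel /= !(mulxE, sdE, sfE) !scale_cinf.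
  by rewrite divff // !rmorph1 rmorph_nat; congr sf; ring.
by rewrite !rmorphM rmorph1 rmorph_nat; congr sf; ring.
Qed.

Lemma bessel_3E a b c d : bessel al lam i3 (sf a b c d) =
  sf (2 * ga * (- be * c + xi * di c + be * xj * dj c))
     (- (2 * ga * (d + xi * di d + be * xj * dj d)) + dd a) 0 (dd c).
Proof.
rewrite /di /dj /cXi /xj /beta /gam /dd.
case: lam_cases => -[-> ->]; rewrite /bessel /= !(mulxE, sdE, sfE) !scale_cinf.
  rewrite !(pd1N, pd2N, pd10, pd20).
  by rewrite !(rmorphM, rmorphD, rmorph1, rmorph_nat, rmorphN); congr sf; ring.
have e : K al * K (al^-1) = 1 by rewrite -rmorphM divff ?rmorph1.
rewrite !(pd1N, pd2N, pd10, pd20).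
rewrite !(rmorphM, rmorphD, rmorph1, rmorph_nat, rmorphN); congr sf; ring: e.
Qed.

Lemma bessel_4E a b c d : bessel al lam i4 (sf a b c d) =
  sf (- (2 * ga * (- be * b + xi * di b + be * xj * dj b))) 0
     (- (2 * ga * (d + xi * di d + be * xj * dj d)) + dd a) (- dd b).
Proof.
rewrite /di /dj /cXi /xj /beta /gam /dd.
case: lam_cases => -[-> ->]; rewrite /bessel /= !(mulxE, sdE, sfE) !scale_cinf.
  by rewrite !(pd10, pd20) !(rmorphM, rmorphD, rmorph1, rmorph_nat, rmorphN); congr sf; ring.
have e : K al * K (al^-1) = 1 by rewrite -rmorphM divff ?rmorph1.
rewrite !(pd10, pd20).
rewrite !(rmorphM, rmorphD, rmorph1, rmorph_nat, rmorphN); congr sf; ring: e.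
Qed.

Lemma mulx_iiE a b c d : mulx ii (sf a b c d) = sf (xi * a) (xi * b) (xi * c) (xi * d).
Proof. by rewrite /ii /cXi; case: (lam == al); rewrite mulxE. Qed.
Lemma mulx_jjE a b c d : mulx jj (sf a b c d) = sf (xj * a) (xj * b) (xj * c) (xj * d).
Proof. by rewrite /jj /xj; case: (lam == al); rewrite mulxE. Qed.

(** Exchanging the roles of e_1 and e_2 changes the sign in [derO]; eps absorbs
it. *)
Definition eps : R := if lam == al then 1 else -1.

Lemma dT_derO p q a b c d : dT (derO al (eps * p) (eps * q)) (sf a b c d) =
  sf (2 * ga * (xi - be * xj) * (K q * b - K p * c))
     (K p * (di a - dj a + 2 * ga * (xi - be * xj) * d))
     (K q * (di a - dj a + 2 * ga * (xi - be * xj) * d))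
     (K p * (di c - dj c) - K q * (di b - dj b)).
Proof.
rewrite /eps /di /dj /cXi /xj /beta /gam.
have e : K al * K (al^-1) = 1 by rewrite -rmorphM divff ?rmorph1.
case: (lam == al).
all: rewrite /dT big4 !(big4 (fun c => _ *: _)) !mxE /= !(mulxE, sdE, sfE) !scale_cinf.
all: rewrite !(rmorph0, rmorphM, rmorphN, rmorph1, rmorph_nat).
  by congr sf; ring.
by congr sf; ring: e.
Qed.

(** s and r are the coefficients of e_i and e_j. *)
Definition vecij (s r x y : R) : 'rV[R]_4 :=
  if lam == al then vec4 s r x y else vec4 r s x y.

Lemma dT_jL s r x y a b c d : dT (jL al (vecij s r x y)) (sf a b c d) =
  let D f := K s * xi * di f + K r * xj * dj f in
  let h := K 2^-1 in
  sf (D a + ga * (xi + be * xj) * (K x * c - K y * b))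
     (D b + h * (K s + K r) * b + h * K x * (di a + dj a) - ga * (xi + be * xj) * K x * d)
     (D c + h * (K s + K r) * c + h * K y * (di a + dj a) - ga * (xi + be * xj) * K y * d)
     (D d + (K s + K r) * d + h * K x * (di c + dj c) - h * K y * (di b + dj b)).
Proof.
rewrite /vecij /di /dj /cXi /xj /beta /gam.
have e : K al * K (al^-1) = 1 by rewrite -rmorphM divff ?rmorph1.
have e2 : K 2^-1 + K 2^-1 = 1 by rewrite -rmorphD -(rmorph1 K); congr K; field.
case: (lam == al).
all: rewrite jL_vec4 /dT big4 !(big4 (fun c => _ *: _)) !mxE /= !(mulxE, sdE, sfE) !scale_cinf.
all: rewrite !(rmorph0, rmorphD, rmorphM, rmorphN).
  by congr sf; ring: e2.
by congr sf; ring: e e2.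
Qed.

(** Equalities up to the relation 2 K(1/2) = 1, with the multiplier of that
relation made explicit. *)
Lemma half_close (X Y Z : CF) : X - Y = (1 - 2 * K 2^-1) * Z -> X = Y.
Proof.
rewrite -(rmorph_nat K 2) -rmorphM divff ?pnatr_eq0 // rmorph1 subrr mul0r.
exact: subr0_eq.
Qed.

(** * The ideal *)

(** An element lies in the ideal when the coefficients of x_3
and x_4 are divisible by x_j and the even part vanishes to second order in x_j
once x_3 x_4 is replaced by -2 gam x_i x_j. *)
Definition in_ideal (a b c d : CF) := exists p q r : CF,
  [/\ a = 2 * ga * xi * xj * d + xj * xj * p, b = xj * q & c = xj * r].

Lemma ideal_genE : [/\ ideal_gen al lam i1 = sf (2 * ga * xi * xj) 0 0 1,
  ideal_gen al lam i2 = sf (xj * xj) 0 0 0,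
  ideal_gen al lam i3 = sf 0 xj 0 0 & ideal_gen al lam i4 = sf 0 0 xj 0].
Proof.
have Xjj : sX R jj = sf xj 0 0 0.
  by rewrite /jj /xj; case: (lam == al); rewrite ?sX1E ?sX2E.
split; rewrite /ideal_gen /= -?/jj ?Xjj ?sX1E ?sX2E ?sX3E ?sX4E !smul_sf; try by congr sf; ring.
rewrite /gam /cXi /xj; case: (lam == al); rewrite !(sfD, sfZ) !scale_cinf.
  by rewrite rmorph1 rmorph_nat; congr sf; ring.
by rewrite rmorphM rmorph_nat; congr sf; ring.
Qed.

(** A combination of the generators has this form by collecting coefficients;
conversely d, p, q, r are multipliers for the four generators. *)
Lemma idealP a b c d : reflect (in_ideal a b c d) (sf a b c d \in @ideal_pred R al lam).
Proof.
have [g1 g2 g3 g4] := ideal_genE.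
apply: (iffP (asboolP _)) => [[h]|[p [q [r [-> -> ->]]]]].
  rewrite big4 g1 g2 g3 g4 (sf_eta (h i1)) (sf_eta (h i2)) (sf_eta (h i3)) (sf_eta (h i4)).
  rewrite !smul_sf !sfD => e.
  have E s := congr1 (fun f : SF => f s) e.
  have := E (false, false); have := E (true, false); have := E (false, true).
  have := E (true, true); rewrite /sf !ffunE /= => {e E}.
  move: (h i1) (h i2) (h i3) (h i4) => h1 h2 h3 h4 -> -> -> ->.
  (* the multiplier of x_j^2 once 2 gam x_i x_j times the x_3 x_4 component
     has been subtracted *)
  exists (h2 (false, false) - (2 * ga * xi) ^+ 2 * h1 (true, true)
     - 2 * ga * xi * (xj * h2 (true, true) + h4 (true, false) - h3 (false, true))).
  exists (2 * ga * xi * h1 (true, false) + xj * h2 (true, false) + h3 (false, false)).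
  exists (2 * ga * xi * h1 (false, true) + xj * h2 (false, true) + h4 (false, false)).
  by split; ring.
exists (fun n : 'I_4 => match val n with 0 => sf d 0 0 0 | 1 => sf p 0 0 0
   | 2 => sf q 0 0 0 | _ => sf r 0 0 0 end).
by rewrite big4 g1 g2 g3 g4 /= !smul_sf !sfD; congr sf; ring.
Qed.

Definition pres_ideal (P : SF -> SF) :=
  forall f, f \in @ideal_pred R al lam -> P f \in @ideal_pred R al lam.

Lemma pres_idealP P : (forall p q r d,
   P (sf (2 * ga * xi * xj * d + xj * xj * p) (xj * q) (xj * r) d) \in @ideal_pred R al lam) ->
  pres_ideal P.
Proof.
by move=> H f; rewrite (sf_eta f) => /idealP[p [q [r [-> -> ->]]]]; exact: H.
Qed.

(** For each operator the witnesses are the quotients by x_j^2, x_j and x_j that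
its formula produces from those of the argument. *)
Lemma pres_mulx_ii : pres_ideal (mulx ii).
Proof.
apply: pres_idealP => p q r d; rewrite mulx_iiE; apply/idealP.
by exists (xi * p), (xi * q), (xi * r); split; ring.
Qed.
Lemma pres_mulx_jj : pres_ideal (mulx jj).
Proof.
apply: pres_idealP => p q r d; rewrite mulx_jjE; apply/idealP.
by exists (xj * p), (xj * q), (xj * r); split; ring.
Qed.
Lemma pres_mulx_3 : pres_ideal (mulx i3).
Proof.
apply: pres_idealP => p q r d; rewrite mulx3E; apply/idealP.
by exists (- (2 * ga * xi * r)), (2 * ga * xi * d + xj * p), 0; split; ring.
Qed.
Lemma pres_mulx_4 : pres_ideal (mulx i4).
Proof.
apply: pres_idealP => p q r d; rewrite mulx4E; apply/idealP.
by exists (2 * ga * xi * q), 0, (2 * ga * xi * d + xj * p); split; ring.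
Qed.

Lemma pres_bessel_ii : pres_ideal (bessel al lam ii).
Proof.
apply: pres_idealP => p q r d; rewrite bessel_iiE // !diE; apply/idealP.
exists (- be * di p + xi * di (di p)).
by exists ((1 - be) * di q + xi * di (di q)), ((1 - be) * di r + xi * di (di r)); split; ring.
Qed.
Lemma pres_bessel_jj : pres_ideal (bessel al lam jj).
Proof.
apply: pres_idealP => p q r d; rewrite bessel_jjE // !djE; apply/idealP.
exists (3 * dj p + xj * dj (dj p)).
by exists (2 * dj q + xj * dj (dj q)), (2 * dj r + xj * dj (dj r)); split; ring.
Qed.
Lemma dd_ideal p d : dd (2 * ga * xi * xj * d + xj * xj * p) =
  2 * ga * d + 2 * ga * xi * di d + xj * (di p + dd (2 * ga * xi * d + xj * p)).
Proof.
rewrite (_ : _ + _ = xj * (2 * ga * xi * d + xj * p)); last by ring.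
by rewrite dd_xj !diE; ring.
Qed.
Lemma pres_bessel_3 : pres_ideal (bessel al lam i3).
Proof.
apply: pres_idealP => p q r d; rewrite bessel_3E // dd_ideal dd_xj !diE !djE.
apply/idealP.
exists (2 * ga * be * dj r - 2 * ga * xi * dd r).
by exists (- (2 * ga * be * dj d) + di p + dd (2 * ga * xi * d + xj * p)), 0; split; ring.
Qed.
Lemma pres_bessel_4 : pres_ideal (bessel al lam i4).
Proof.
apply: pres_idealP => p q r d; rewrite bessel_4E // dd_ideal dd_xj !diE !djE.
apply/idealP.
exists (- (2 * ga * be * dj q - 2 * ga * xi * dd q)), 0.
by exists (- (2 * ga * be * dj d) + di p + dd (2 * ga * xi * d + xj * p)); split; ring.
Qed.

Lemma pres_derE h e f : pres_ideal (dT (derE h e f)).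
Proof.
apply: pres_idealP => p q r d; rewrite dT_derE; apply/idealP.
by exists 0, (K h * q + K f * r), (K e * q - K h * r); split; ring.
Qed.
Lemma pres_derO x y : pres_ideal (dT (derO al (eps * x) (eps * y))).
Proof.
apply: pres_idealP => p q r d; rewrite dT_derO // !diE !djE; apply/idealP.
exists (- (2 * ga * be * (K y * q - K x * r))
   - 2 * ga * xi * (K x * (di r - dj r) - K y * (di q - dj q))).
pose w := 2 * ga * d + 2 * ga * xi * (di d - dj d) + xj * (di p - dj p) - 2 * p
  - 2 * ga * be * d.
by exists (K x * w), (K y * w); split; rewrite /w; ring.
Qed.
Lemma pres_jL s t x y : pres_ideal (dT (jL al (vecij s t x y))).
Proof.
apply: pres_idealP => p q r d; rewrite dT_jL //= !diE !djE; apply/idealP.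
exists (K s * xi * di p + 2 * K t * p + K t * xj * dj p + ga * be * (K x * r - K y * q)
  - ga * xi * (K x * (di r + dj r) - K y * (di q + dj q))).
pose w := K 2^-1 * (2 * ga * d + 2 * ga * xi * (di d + dj d) + xj * (di p + dj p) + 2 * p)
  - ga * be * d.
exists (K s * xi * di q + K t * q + K t * xj * dj q + K 2^-1 * (K s + K t) * q + K x * w).
exists (K s * xi * di r + K t * r + K t * xj * dj r + K 2^-1 * (K s + K t) * r + K y * w).
split; rewrite /w.
- by apply: (half_close (Z := ga * xi * xj * (K x * (xj * (di r + dj r) + r)
     - K y * (xj * (di q + dj q) + q)))); ring.
- by apply: (half_close (Z := - (ga * xi * K x * d))); ring.
- by apply: (half_close (Z := - (ga * xi * K y * d))); ring.
Qed.

(** * The polynomial model *)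

Lemma xi_comm : commr_rmorph (@cinf_cst R) xi.
Proof. by move=> x; exact: mulrC. Qed.
(** p |-> p(x_i) *)
Definition pe : {poly R[i]} -> CF := horner_morph xi_comm.
HB.instance Definition _ := GRing.RMorphism.copy pe (horner_morph xi_comm).

Lemma pe_X : pe 'X = xi. Proof. exact: horner_morphX. Qed.
Lemma pe_C c : pe c%:P = cinf_cst c. Proof. exact: horner_morphC. Qed.
Lemma pe_K r : pe (rpolyC r) = cinf_real r. Proof. exact: pe_C. Qed.
Lemma peZ k p : pe (k *: p) = k *: pe p.
Proof. by rewrite -mul_polyC rmorphM /= pe_C. Qed.

Lemma peD p q : pe (p + q) = pe p + pe q. Proof. exact: rmorphD. Qed.
Lemma peB p q : pe (p - q) = pe p - pe q. Proof. exact: rmorphB. Qed.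
Lemma peN p : pe (- p) = - pe p. Proof. exact: rmorphN. Qed.
Lemma peM p q : pe (p * q) = pe p * pe q. Proof. exact: rmorphM. Qed.
Lemma pe0 : pe 0 = 0. Proof. exact: rmorph0. Qed.
Lemma pe1 : pe 1 = 1. Proof. exact: rmorph1. Qed.
Lemma pe_nat n : pe n%:R = n%:R. Proof. exact: rmorph_nat. Qed.
Definition peE := (peD, peB, peN, peM, pe0, pe1, pe_nat, pe_X, pe_K).

Lemma di_pe p : di (pe p) = pe p^`().
Proof.
elim/poly_ind: p => [|p c IH]; first by rewrite deriv0 !rmorph0 di0.
rewrite derivD derivM derivX derivC addr0 mulr1 !(rmorphD, rmorphM) /= pe_X pe_C.
by rewrite !diE IH; ring.
Qed.
Lemma dj_pe p : dj (pe p) = 0.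
Proof.
elim/poly_ind: p => [|p c IH]; first by rewrite !rmorph0 dj0.
rewrite !(rmorphD, rmorphM) /= pe_X pe_C.
by rewrite !djE IH; ring.
Qed.
Lemma dd_pe p : dd (pe p * E) = - 2 * (pe p^`() - 2 * pe p) * E.
Proof.
have -> f : dd f = if lam == al then di (dj f)
                          else dj (di f).
  by rewrite /dd /di /dj; case: (lam == al).
by case: (lam == al); rewrite !(diE, djE, di_pe, dj_pe); ring.
Qed.

Implicit Types a b c d : {poly C}.

(** The operator induced by P on the quotient, meaningful when P is linear and
preserves the ideal ([qop_cls]). *)
Definition qop (P : SF -> SF) (q : Q) : Q := cls (P (rep q)).

Lemma qop_cls P f : lin_op P -> pres_ideal P -> qop P (cls f) = cls (P f).
Proof.
move=> lP iP; apply/cls_eq; rewrite addrC -scaleN1r -lP; apply: iP.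
by rewrite scaleN1r addrC; apply/cls_eq; rewrite repK.
Qed.

Lemma cls_sf (a b c d a' b' c' d' : CF) : in_ideal (a - a') (b - b') (c - c') (d - d') ->
  cls (sf a b c d) = cls (sf a' b' c' d').
Proof. by move=> H; apply/cls_eq; rewrite sfN sfD; apply/idealP. Qed.

Definition emb a b c d : Q :=
  cls (sf ((pe a + pe b * xj) * E) (pe c * E) (pe d * E) 0).

Lemma embZD k a b c d a' b' c' d' : k *: emb a b c d + emb a' b' c' d' =
  emb (k *: a + a') (k *: b + b') (k *: c + c') (k *: d + d').
Proof.
rewrite /emb -clsZ -clsD sfZ sfD; congr (cls (sf _ _ _ _));
  rewrite ?scaler0 ?addr0 // !peD !peZ !cinf_scaleE; ring.
Qed.
Lemma emb0 : emb 0 0 0 0 = 0.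
Proof. by have := embZD (-1) 0 0 0 0 0 0 0 0; rewrite !scaler0 !addr0 scaleN1r addNr. Qed.
Lemma embZ k a b c d : k *: emb a b c d = emb (k *: a) (k *: b) (k *: c) (k *: d).
Proof. by rewrite -[LHS]addr0 -[X in _ + X]emb0 embZD !addr0. Qed.
Lemma embD a b c d a' b' c' d' : emb a b c d + emb a' b' c' d' =
  emb (a + a') (b + b') (c + c') (d + d').
Proof. by rewrite -[emb a b c d]scale1r embZD !scale1r. Qed.

Lemma act_mulx_ii a b c d :
  qop (mulx ii) (emb a b c d) = emb ('X * a) ('X * b) ('X * c) ('X * d).
Proof.
rewrite /emb qop_cls; [|exact: lin_mulx|exact: pres_mulx_ii].
by rewrite mulx_iiE; rewrite ?peE; congr (cls (sf _ _ _ _)); ring.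
Qed.

(** The representative produced by an operator and the one of the model may
differ by an element of the ideal; the witnesses are then the discrepancies
divided by x_j^2, x_j and x_j. *)
Lemma act_mulx_jj a b c d : qop (mulx jj) (emb a b c d) = emb 0 a 0 0.
Proof.
rewrite /emb qop_cls; [|exact: lin_mulx|exact: pres_mulx_jj].
rewrite mulx_jjE; apply: cls_sf; exists (pe b * E), (pe c * E), (pe d * E).
by rewrite ?peE; split; ring.
Qed.

Lemma act_mulx_3 a b c d :
  qop (mulx i3) (emb a b c d) = emb 0 (- (2 * gp * 'X * d)) a 0.
Proof.
rewrite /emb qop_cls; [|exact: lin_mulx|exact: pres_mulx_3].
rewrite mulx3E; apply: cls_sf; exists 0, (pe b * E), 0.
by rewrite ?peE; split; ring.
Qed.

Lemma act_mulx_4 a b c d :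
  qop (mulx i4) (emb a b c d) = emb 0 (2 * gp * 'X * c) 0 a.
Proof.
rewrite /emb qop_cls; [|exact: lin_mulx|exact: pres_mulx_4].
rewrite mulx4E; apply: cls_sf; exists 0, 0, (pe b * E).
by rewrite ?peE; split; ring.
Qed.

(** Conjugation by E turns d/dt into d/dt - 2, so this is the conjugate of
(-k + t d/dt) d/dt. *)
Definition Bop (k : {poly R[i]}) a := 'X * a^`()^`() - (4 * 'X + k) * a^`() + (4 * 'X + 2 * k) * a.

Lemma act_bessel_ii a b c d : qop (bessel al lam ii) (emb a b c d) =
  emb (Bop bp a) (Bop bp b) (Bop (bp - 1) c) (Bop (bp - 1) d).
Proof.
rewrite /emb qop_cls; [|exact: lin_bessel|exact: pres_bessel_ii].
rewrite bessel_iiE // !(diE, di_pe) /Bop.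
rewrite ?peE.
by congr (cls (sf _ _ _ _)); ring.
Qed.

Lemma act_bessel_jj a b c d : qop (bessel al lam jj) (emb a b c d) =
  emb (2 * a - b) (2 * (2 * a - b)) 0 0.
Proof.
rewrite /emb qop_cls; [|exact: lin_bessel|exact: pres_bessel_jj].
rewrite bessel_jjE // !(djE, dj_pe); apply: cls_sf.
by exists (4 * pe b * E), (4 * pe c * E), (4 * pe d * E); rewrite ?peE; split; ring.
Qed.

Lemma dd_emb a b : dd ((pe a + pe b * xj) * E) =
  (- 2 * (pe a^`() - 2 * pe a) + pe b^`() - 2 * pe b) * E + xj * dd (pe b * E).
Proof.
have -> : (pe a + pe b * xj) * E = pe a * E + xj * (pe b * E) by ring.
by rewrite ddD dd_xj dd_pe !(diE, di_pe); ring.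
Qed.

Lemma deriv_sub2 a b : (b - 2 * a)^`() = b^`() - 2 * a^`().
Proof. by rewrite derivB !mulr_natl derivMn. Qed.

Lemma act_bessel_3 a b c d : qop (bessel al lam i3) (emb a b c d) =
  emb (gp * (2 * 'X * d^`() - 2 * bp * d - 4 * 'X * d))
      (gp * (4 * 'X * d^`() - 4 * bp * d - 8 * 'X * d))
      ((b - 2 * a)^`() - 2 * (b - 2 * a)) 0.
Proof.
rewrite /emb qop_cls; [|exact: lin_bessel|exact: pres_bessel_3].
rewrite bessel_3E // dd_emb !dd_pe !(diE, di_pe, djE, dj_pe); apply: cls_sf.
rewrite deriv_sub2.
by exists 0, (- 2 * (pe b^`() - 2 * pe b) * E), 0; rewrite ?peE; split; ring.
Qed.

Lemma act_bessel_4 a b c d : qop (bessel al lam i4) (emb a b c d) =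
  emb (- (gp * (2 * 'X * c^`() - 2 * bp * c - 4 * 'X * c)))
      (- (gp * (4 * 'X * c^`() - 4 * bp * c - 8 * 'X * c)))
      0 ((b - 2 * a)^`() - 2 * (b - 2 * a)).
Proof.
rewrite /emb qop_cls; [|exact: lin_bessel|exact: pres_bessel_4].
rewrite bessel_4E // dd_emb !dd_pe !(diE, di_pe, djE, dj_pe); apply: cls_sf.
rewrite deriv_sub2.
by exists 0, 0, (- 2 * (pe b^`() - 2 * pe b) * E); rewrite ?peE; split; ring.
Qed.

Lemma act_derE h e f a b c d : qop (dT (derE h e f)) (emb a b c d) =
  emb 0 0 (rpolyC h * c + rpolyC f * d) (rpolyC e * c - rpolyC h * d).
Proof.
rewrite /emb qop_cls; [|exact: lin_dT|exact: pres_derE].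
by rewrite dT_derE; rewrite ?peE; congr (cls (sf _ _ _ _)); ring.
Qed.

Lemma act_derO x y a b c d : qop (dT (derO al (eps * x) (eps * y))) (emb a b c d) =
  emb (2 * gp * 'X * (rpolyC y * c - rpolyC x * d))
      (2 * gp * (rpolyC y * ('X * c^`() - bp * c) - rpolyC x * ('X * d^`() - bp * d)))
      (rpolyC x * (a^`() - b)) (rpolyC y * (a^`() - b)).
Proof.
rewrite /emb qop_cls; [|exact: lin_dT|exact: pres_derO].
rewrite dT_derO // !(diE, di_pe, djE, dj_pe); apply: cls_sf.
by exists 0, (K x * pe b^`() * E), (K y * pe b^`() * E); rewrite ?peE; split; ring.
Qed.

Lemma act_jL s t x y a b c d : qop (dT (jL al (vecij s t x y))) (emb a b c d) =
  emb (rpolyC s * 'X * (a^`() - 2 * a) + gp * 'X * (rpolyC x * d - rpolyC y * c))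
      (rpolyC s * 'X * (b^`() - 2 * b) + rpolyC t * (b - 2 * a)
       + gp * bp * (rpolyC x * d - rpolyC y * c)
       - gp * 'X * (rpolyC x * (d^`() - 4 * d) - rpolyC y * (c^`() - 4 * c)))
      (rpolyC s * 'X * (c^`() - 2 * c) + hp * rpolyC (s + t) * c
       + hp * rpolyC x * (a^`() + b - 4 * a))
      (rpolyC s * 'X * (d^`() - 2 * d) + hp * rpolyC (s + t) * d
       + hp * rpolyC y * (a^`() + b - 4 * a)).
Proof.
rewrite /emb qop_cls; [|exact: lin_dT|exact: pres_jL].
rewrite dT_jL //= !(diE, di_pe, djE, dj_pe); apply: cls_sf.
exists (- (2 * K t * pe b * E)).
exists (- (2 * K t * pe c * E) + K 2^-1 * K x * (pe b^`() - 4 * pe b) * E).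
exists (- (2 * K t * pe d * E) + K 2^-1 * K y * (pe b^`() - 4 * pe b) * E).
rewrite ?peE (rmorphD K); split; try by ring.
by apply: (half_close (Z := ga * xi * xj * (K x * (pe d^`() - 4 * pe d)
  - K y * (pe c^`() - 4 * pe c)) * E)); ring.
Qed.

(** On the line x_j = 0 a polynomial in x_i times E vanishes only if the
polynomial does, see [pe_div_xj]. *)
Definition ev (f : CF) (t : R) : C := f (if lam == al then (t, 0) else (0, t)).

Lemma evD f g t : ev (f + g) t = ev f t + ev g t. Proof. by []. Qed.
Lemma evM f g t : ev (f * g) t = ev f t * ev g t. Proof. by []. Qed.
Lemma ev_xj t : ev xj t = 0.
Proof. by rewrite /ev /xj; case: (lam == al). Qed.
Lemma ev_xi t : ev xi t = t%:C.
Proof. by rewrite /ev /cXi; case: (lam == al). Qed.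
Lemma ev_cst k t : ev (cinf_cst k) t = k. Proof. by []. Qed.
Lemma ev_E t : ev E t != 0.
Proof.
rewrite /ev /E /=; rewrite eq_complex /= negb_and.
by rewrite (gt_eqF (expR_gt0 _)).
Qed.
Lemma ev_pe p t : ev (pe p) t = p.[t%:C].
Proof.
elim/poly_ind: p => [|p c IH]; first by rewrite pe0 horner0.
by rewrite !peE pe_C evD evM IH ev_xi ev_cst !hornerE.
Qed.

Lemma poly_zero (p : {poly C}) : (forall t : R, p.[t%:C] = 0) -> p = 0.
Proof.
move=> H; apply: (@roots_geq_poly_eq0 _ p (map (fun n => (n%:R : R)%:C) (iota 0 (size p)))).
- by apply/allP => x /mapP[n _ ->]; rewrite /root H.
- rewrite map_inj_uniq ?iota_uniq // => m n /= [] /eqP.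
  by rewrite eqr_nat => /eqP.
- by rewrite size_map size_iota.
Qed.

Lemma pe_div_xj p q : pe p * E = xj * q -> p = 0.
Proof.
move=> e; apply: poly_zero => t; have := congr1 (ev^~ t) e.
by rewrite !evM ev_xj ev_pe mul0r => /eqP; rewrite mulf_eq0 (negbTE (ev_E t)) orbF => /eqP.
Qed.

(** Restricting to x_j = 0 kills c, d and a; then b appears by applying the
derivative in x_j before restricting. *)
Lemma emb_comp_eq0 a b c d : in_ideal ((pe a + pe b * xj) * E) (pe c * E) (pe d * E) 0 ->
  [/\ a = 0, b = 0, c = 0 & d = 0].
Proof.
case=> p [q [r [e1 /pe_div_xj -> /pe_div_xj ->]]].
have a0 : a = 0.
  apply: (@pe_div_xj _ (xj * p - pe b * E)).
  by rewrite -[LHS](addrK (pe b * xj * E)) -mulrDl e1; ring.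
split=> //; rewrite {}a0 in e1.
have := congr1 dj e1; rewrite pe0 !(djE, dj_pe) => e2.
apply: (@pe_div_xj _ (2 * p + xj * dj p + 2 * pe b * E)).
apply: subr0_eq; move/eqP: e2; rewrite -subr_eq0 => /eqP <-; ring.
Qed.

Lemma emb_inj a b c d a' b' c' d' : emb a b c d = emb a' b' c' d' ->
  [/\ a = a', b = b', c = c' & d = d'].
Proof.
move=> /cls_eq; rewrite sfN sfD => /idealP e.
have [] := @emb_comp_eq0 (a - a') (b - b') (c - c') (d - d').
  rewrite !peB; case: e => p [q [r [e1 e2 e3]]]; exists p, q, r.
  by split; rewrite -?e1 -?e2 -?e3; move: e1 e2 e3; rewrite !subr0 => e1 e2 e3;
   rewrite ?mulr0 ?add0r in e1 *; rewrite -?e1 -?e2 -?e3; ring.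
by do 4!move/subr0_eq ->.
Qed.

Lemma emb_even a b c d : quot_homog al lam false (emb a b c d) -> c = 0 /\ d = 0.
Proof.
case=> f [hf]; rewrite (sf_eta f) (hf (true, false)) // (hf (false, true)) //.
by move=> /cls_eq; rewrite sfN sfD !subr0 => /idealP [p [q [r [_ /pe_div_xj -> /pe_div_xj ->]]]].
Qed.
Lemma emb_odd a b c d : quot_homog al lam true (emb a b c d) -> a = 0 /\ b = 0.
Proof.
case=> f [hf]; rewrite (sf_eta f) (hf (false, false)) // (hf (true, true)) //.
move=> /cls_eq; rewrite sfN sfD !subr0 => /idealP [p [q [r [e _ _]]]].
have [] := @emb_comp_eq0 a b 0 0; last by move=> -> ->.
by exists p, 0, 0; split; rewrite ?pe0 ?mul0r ?mulr0 // e mulr0.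
Qed.
Lemma even_emb a b : quot_homog al lam false (emb a b 0 0).
Proof.
by exists (sf ((pe a + pe b * xj) * E) (pe 0 * E) (pe 0 * E) 0); split=> // -[[] []] //;
  rewrite ffunE /= ?pe0 ?mul0r.
Qed.
Lemma odd_emb c d : quot_homog al lam true (emb 0 0 c d).
Proof.
exists (sf ((pe 0 + pe 0 * xj) * E) (pe c * E) (pe d * E) 0); split=> // -[[] []] //.
all: by move=> _; rewrite ffunE /= ?pe0 ?mul0r ?addr0 ?mul0r.
Qed.

(** Modulo x_j^2 every exponential in x_j is affine in x_j. *)
Lemma exp_j (k : R) : exists g : CF, (if lam == al then cexp 0 k else cexp k 0) =
  1 + K k * xj + xj ^+ 2 * g.
Proof.
rewrite /xj; case: (lam == al).
  by have [g ->] := cexp_rem2 k; exists g.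
by have [g ->] := cexp_rem1 k; exists g.
Qed.

Lemma cexp_ijE (k l : R) : l = k - 2 -> cexp_ij al lam (- 2) l =
  E * (if lam == al then cexp 0 k else cexp k 0).
Proof.
move=> ->; rewrite /cexp_ij /E; case: (lam == al).
  by rewrite cexpD addr0 (addrC (- 2) k).
by rewrite cexpD addr0 (addrC (- 2) k).
Qed.

Lemma uvecE p : cls (sscal (pe p * E)) = emb p 0 0 0.
Proof. by rewrite sscalE /emb !pe0 !mul0r addr0. Qed.

Lemma uvec'E p : cls (sscal (pe p * cexp_ij al lam (- 2) 2)) = emb p (4 * p) 0 0.
Proof.
rewrite (@cexp_ijE 4); last by ring.
have [g ->] := exp_j 4.
rewrite sscalE; apply: cls_sf; exists (pe p * E * g), 0, 0.
by rewrite !peE rmorph_nat; split; ring.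
Qed.

Lemma vvec3E p : cls (mulx i3 (sscal (pe p * cexp_ij al lam (- 2) 0))) = emb 0 0 p 0.
Proof.
rewrite (@cexp_ijE 2); last by ring.
have [g ->] := exp_j 2.
rewrite sscalE mulx3E; apply: cls_sf; exists 0, (pe p * E * (2 + xj * g)), 0.
by rewrite !peE rmorph_nat; split; ring.
Qed.
Lemma vvec4E p : cls (mulx i4 (sscal (pe p * cexp_ij al lam (- 2) 0))) = emb 0 0 0 p.
Proof.
rewrite (@cexp_ijE 2); last by ring.
have [g ->] := exp_j 2.
rewrite sscalE mulx4E; apply: cls_sf; exists 0, 0, (pe p * E * (2 + xj * g)).
by rewrite !peE rmorph_nat; split; ring.
Qed.

Lemma polyfun_expand f : polyfun f -> exists a b r, f = pe a + pe b * xj + xj * xj * r.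
Proof.
case=> n [u ->].
pose good f := exists a b r, f = pe a + pe b * xj + xj * xj * r.
have good0 : good 0 by exists 0, 0, 0; rewrite pe0; ring.
have goodD f1 f2 : good f1 -> good f2 -> good (f1 + f2).
  move=> [a [b [r ->]]] [a' [b' [r' ->]]]; exists (a + a'), (b + b'), (r + r').
  by rewrite !peD; ring.
have goodZ k f1 : good f1 -> good (k *: f1).
  move=> [a [b [r ->]]]; exists (k *: a), (k *: b), (k *: r).
  by rewrite !peZ !cinf_scaleE; ring.
have goodM f1 f2 : good f1 -> good f2 -> good (f1 * f2).
  move=> [a [b [r ->]]] [a' [b' [r' ->]]].
  exists (a * a'), (a * b' + b * a').
  exists (pe b * pe b' + (pe a + pe b * xj) * r' + r * (pe a' + pe b' * xj) + xj * xj * r * r').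
  by rewrite !peE; ring.
have good1 : good 1 by exists 1, 0, 0; rewrite !peE; ring.
have goodi : good xi by exists 'X, 0, 0; rewrite !peE; ring.
have goodj : good xj by exists 0, 1, 0; rewrite !peE; ring.
have [gX1 gX2] : good cX1 /\ good cX2.
  by move: goodi goodj; rewrite /cXi /xj; case: (lam == al).
have goodX f1 m : good f1 -> good (f1 ^+ m).
  by move=> g; elim: m => [|m IH]; rewrite ?expr0 // exprS; exact: goodM.
apply: (big_ind good) => // p _; apply: (big_ind good) => // q _.
by apply/goodZ/goodM; exact: goodX.
Qed.

Lemma pe_sum n (p : {poly C}) : (size p <= n)%N -> pe p = \sum_(m < n) p`_m *: xi ^+ m.
Proof.
move=> le_n; rewrite /pe /horner_morph (@horner_coef_wide _ n) ?size_map_poly //.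
by apply: eq_bigr => m _; rewrite coef_map cinf_scaleE.
Qed.

Lemma polyfun_pe a b : polyfun (pe a + pe b * xj).
Proof.
pose N := maxn (size a) (size b).
pose u p q : C := match q with 0%N => a`_p | 1%N => b`_p | _ => 0 end.
have e : pe a + pe b * xj = \sum_(p < N.+2) \sum_(q < N.+2) u p q *: (xi ^+ p * xj ^+ q).
  have leN k : (k <= N -> k <= N.+2)%N by move=> h; apply: leq_trans h _; rewrite ltnW.
  rewrite (@pe_sum N.+2 a) ?(@pe_sum N.+2 b); try by rewrite leN // leq_max leqnn ?orbT.
  rewrite mulr_suml -big_split; apply: eq_bigr => p _ /=.
  rewrite !big_ord_recl big1 /= => [|i _]; last by rewrite scale0r.
  by rewrite expr0 expr1 mulr1 addr0 !cinf_scaleE mulrA.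
exists N.+2; rewrite e /cXi /xj; case: (lam == al).
  by exists u.
exists (fun p q => u q p); rewrite exchange_big; apply: eq_bigr => p _ /=.
by apply: eq_bigr => q _; rewrite mulrC.
Qed.

(** A polynomial superfunction is expanded to first order in x_j, and its
x_3 x_4 component is absorbed into the coefficient of x_j. *)
Lemma WmodP q : Wmod al lam q <-> exists a b c d, q = emb a b c d.
Proof.
split=> [[P [pP ->]]|[a [b [c [d ->]]]]].
  have [a [b [r0 e0]]] := polyfun_expand (pP (false, false)).
  have [c [c' [r1 e1]]] := polyfun_expand (pP (true, false)).
  have [d [d' [r2 e2]]] := polyfun_expand (pP (false, true)).
  have [f [f' [r3 e3]]] := polyfun_expand (pP (true, true)).
  rewrite (sf_eta P) e0 e1 e2 e3 sscalE smul_sf.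
  exists a, (b - 2 * rpolyC gam * 'X * f), c, d.
  apply: cls_sf; exists ((r0 - 2 * ga * xi * (pe f' + xj * r3)) * E).
  exists ((pe c' + xj * r1) * E), ((pe d' + xj * r2) * E).
  by rewrite !peE /E; split; ring.
exists (sf (pe a + pe b * xj) (pe c) (pe d) 0); split.
  have pf0 p : polyfun (pe p) by have := polyfun_pe p 0; rewrite pe0 mul0r addr0.
  move=> [[] []]; rewrite ffunE /=; [|exact: pf0|exact: pf0|exact: polyfun_pe].
  by have := pf0 0; rewrite pe0.
by rewrite sscalE smul_sf /emb /E; congr (cls (sf _ _ _ _)); ring.
Qed.

Local Notation cpoly := (map_poly (real_complex R)).

Definition lag (s k : nat) : {poly C} := cpoly (lagR bet s k).

Lemma size_lag s k : size (lag s k) = k.+1.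
Proof. by rewrite size_map_poly size_lagR. Qed.
Lemma lag0 s : lag s 0 = 1.
Proof. by rewrite /lag lagR0 rmorph1. Qed.
Lemma cpolyC (r : R) : cpoly r%:P = rpolyC r.
Proof. by rewrite map_polyC. Qed.
Lemma lag_deriv k : (lag 0 k.+1)^`() = 4 * k.+1%:R * lag 1 k.
Proof. by rewrite deriv_map lagR_deriv !rmorphM !rmorph_nat. Qed.
Lemma lag_rec k : lag 0 k.+1 = 4 * 'X * lag 1 k + (rpolyC bet - k%:R) * lag 0 k.
Proof.
rewrite /lag lagR_rec rmorphD !rmorphM /= map_polyX rmorph_nat.
by rewrite cpolyC rmorphB rmorph_nat.
Qed.
Lemma lag_euler k : 'X * (lag 1 k)^`() = rpolyC bet * lag 1 k - (rpolyC bet - k%:R) * lag 0 k.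
Proof.
have := congr1 cpoly (lagR_euler bet k).
by rewrite rmorphB !rmorphM /= map_polyX !cpolyC -deriv_map rmorphB rmorph_nat.
Qed.
Lemma lag_contig k : lag 1 k.+1 = lag 0 k.+1 - k.+1%:R * lag 1 k.
Proof. by rewrite /lag lagR_contig rmorphB rmorphM /= rmorph_nat. Qed.

Lemma Upoly_lag s k : Upoly k (s%:R - bet) (4 *: xi) = pe (lag s k).
Proof.
rewrite (pe_sum (n := k.+1)) ?size_lag // /Upoly (reindex_inj rev_ord_inj) /=.
apply: eq_bigr => m _; rewrite subSS subKn -1?ltnS //.
rewrite poch_opp ?leq_subr // poch_fprod ?leq_subr // subKn -1?ltnS // bin_sub -1?ltnS //.
rewrite coef_map coef_lagR !cinf_scaleE exprMn mulrA -rmorphXn -rmorphM; congr (cinf_cst _ * _).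
by rewrite /= !(rmorphM, rmorphXn) /= !rmorph_nat; ring.
Qed.

Lemma UtildeE k : Utilde al lam k = pe (lag 0 k).
Proof. by rewrite -Upoly_lag sub0r. Qed.
Lemma VtildeE k : Vtilde al lam k = pe (lag 1 k).
Proof. by rewrite -Upoly_lag. Qed.

Lemma uvec_emb k : uvec al lam k = emb (lag 0 k) 0 0 0.
Proof. by rewrite /uvec UtildeE uvecE. Qed.
Lemma uvec'_emb k : uvec' al lam k = emb (lag 0 k) (4 * lag 0 k) 0 0.
Proof. by rewrite /uvec' UtildeE uvec'E. Qed.
Lemma vvec3_emb k : vvec al lam i3 k = emb 0 0 (lag 1 k) 0.
Proof. by rewrite /vvec VtildeE vvec3E. Qed.
Lemma vvec4_emb k : vvec al lam i4 k = emb 0 0 0 (lag 1 k).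
Proof. by rewrite /vvec VtildeE vvec4E. Qed.

(** * Matrices of the operators on a K-type *)

(** x u_(m+1) + y u'_m + z v_(3,m) + t v_(4,m) *)
Definition kvec (m : nat) (x y z t : C) : Q :=
  emb (x%:P * lag 0 m.+1 + y%:P * lag 0 m) (4 * y%:P * lag 0 m)
      (z%:P * lag 1 m) (t%:P * lag 1 m).

Lemma kvecE m x y z t : kvec m x y z t = emb (x%:P * lag 0 m.+1 + y%:P * lag 0 m)
  (4 * y%:P * lag 0 m) (z%:P * lag 1 m) (t%:P * lag 1 m).
Proof. by []. Qed.

(** Up to the factor -i/2, the action of e_n^- - e_n^+. *)
Definition qT (n : 'I_4) (q : Q) : Q := 4 *: qop (mulx n) q - qop (bessel al lam n) q.

Lemma deriv_nat n : (n%:R : {poly C})^`() = 0.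
Proof. by rewrite -polyC_natr derivC. Qed.
Definition deriv_simp := (derivD, derivB, derivN, derivM, derivC, derivX, deriv_nat).

Lemma lag_deriv0 m : (lag 0 m)^`() = 4 * lag 0 m - 4 * lag 1 m.
Proof.
case: m => [|m]; first by rewrite !lag0 -polyC1 derivC subrr.
by rewrite lag_deriv lag_contig; ring.
Qed.
Lemma lag_euler' m : 'X * (lag 1 m)^`()^`() =
  (rpolyC bet - 1) * (lag 1 m)^`() - (rpolyC bet - m%:R) * (4 * lag 0 m - 4 * lag 1 m).
Proof.
have := congr1 (@deriv C) (lag_euler m); rewrite /rpolyC !deriv_simp lag_deriv0.
move=> e; apply: subr0_eq; move/eqP: e; rewrite -subr_eq0 => /eqP <-; ring.
Qed.

Lemma lag_rel m :
  'X * (lag 1 m)^`() = bC%:P * lag 1 m - (bC%:P - m%:R) * lag 0 m /\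
  'X * (lag 1 m)^`()^`() =
    (bC%:P - 1) * (lag 1 m)^`() - (bC%:P - m%:R) * (4 * lag 0 m - 4 * lag 1 m).
Proof. by split; [exact: lag_euler|exact: lag_euler']. Qed.

Local Ltac lag_simp :=
  rewrite ?deriv_simp ?lag_deriv ?lag_deriv0 ?lag_rec /rpolyC ?deriv_simp ?lag_deriv0.

(** Equalities up to Euler's relation for V and its derivative, with the
multipliers Z1 and Z2 of these relations made explicit. *)
Lemma lag_close m (Z1 Z2 X Y : {poly C}) :
  X - Y = Z1 * ('X * (lag 1 m)^`() - (bC%:P * lag 1 m - (bC%:P - m%:R) * lag 0 m)) +
    Z2 * ('X * (lag 1 m)^`()^`() - ((bC%:P - 1) * (lag 1 m)^`()
           - (bC%:P - m%:R) * (4 * lag 0 m - 4 * lag 1 m))) -> X = Y.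
Proof.
by have [-> ->] := lag_rel m; rewrite !subrr !mulr0 addr0 => /subr0_eq.
Qed.

Lemma qT_ii m x y z t : qT ii (kvec m x y z t) =
  kvec m ((4 * m.+1%:R - 2 * bC) * x) ((4 * m%:R - 2 * bC) * y)
    ((4 * m%:R + 2 - 2 * bC) * z) ((4 * m%:R + 2 - 2 * bC) * t).
Proof.
rewrite /qT /kvec act_mulx_ii // act_bessel_ii // -[X in 4 *: _ + X]scaleN1r !embZ embD.
rewrite /Bop !scaleN1r -!mul_polyC; congr emb; lag_simp.
- by apply: (@lag_close m (- (4 * m.+1%:R * x%:P - 4 * y%:P)) 0); ring.
- by apply: (@lag_close m (16 * y%:P) 0); ring.
- by apply: (@lag_close m (4 * z%:P) (- z%:P)); ring.
- by apply: (@lag_close m (4 * t%:P) (- t%:P)); ring.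
Qed.

Lemma qT_jj m x y z t : qT jj (kvec m x y z t) = kvec m (- 2 * x) (2 * y) 0 0.
Proof.
rewrite /qT /kvec act_mulx_jj // act_bessel_jj // -[X in 4 *: _ + X]scaleN1r !embZ embD.
by rewrite !scaleN1r -!mul_polyC; congr emb; ring.
Qed.

Lemma qT_3 m x y z t : qT i3 (kvec m x y z t) =
  kvec m (gC * t) (- (m%:R - bC) * gC * t) (8 * m.+1%:R * x + 8 * y) 0.
Proof.
rewrite /qT /kvec act_mulx_3 // act_bessel_3 // -[X in 4 *: _ + X]scaleN1r !embZ embD.
rewrite !scaleN1r -!mul_polyC; congr emb; lag_simp; last by ring.
- by apply: (@lag_close m (- (2 * gC%:P * t%:P)) 0); ring.
- by apply: (@lag_close m (- (4 * gC%:P * t%:P)) 0); ring.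
- by ring.
Qed.

Lemma qT_4 m x y z t : qT i4 (kvec m x y z t) =
  kvec m (- (gC * z)) ((m%:R - bC) * gC * z) 0 (8 * m.+1%:R * x + 8 * y).
Proof.
rewrite /qT /kvec act_mulx_4 // act_bessel_4 // -[X in 4 *: _ + X]scaleN1r !embZ embD.
rewrite !scaleN1r -!mul_polyC; congr emb; lag_simp; last by ring.
- by apply: (@lag_close m (2 * gC%:P * z%:P) 0); ring.
- by apply: (@lag_close m (4 * gC%:P * z%:P) 0); ring.
- by ring.
Qed.

Lemma derE_kvec h e f m x y z t : qop (dT (derE h e f)) (kvec m x y z t) =
  kvec m 0 0 (h%:C * z + f%:C * t) (e%:C * z - h%:C * t).
Proof. by rewrite act_derE /rpolyC; congr emb; ring. Qed.

(** The image of the odd part is spanned by u + (m - beta) u', and the kernel on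
the even part by u + (m + 1) u'. *)
Lemma derO_kvec h e m x y z t : qop (dT (derO al (eps * h) (eps * e))) (kvec m x y z t) =
  kvec m (gC / 2 * (e%:C * z - h%:C * t)) (gC / 2 * (m%:R - bC) * (e%:C * z - h%:C * t))
    (4 * h%:C * (m.+1%:R * x - y)) (4 * e%:C * (m.+1%:R * x - y)).
Proof.
have g2 : gC%:P = 2 * (gC / 2)%:P :> {poly C}.
  by rewrite -[2]polyC_natr -polyCM mulrC divfK ?pnatr_eq0.
rewrite act_derO //; congr emb; lag_simp; rewrite ?g2.
- by ring.
- by apply: (@lag_close m (4 * (gC / 2)%:P * (e%:C%:P * z%:P - h%:C%:P * t%:P)) 0); ring.
- by ring.
- by ring.
Qed.

(** * The action of the subalgebras through basic operators *)

Local Open Scope classical_set_scope.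

Lemma actE X q : act X q =
  - (2 * 'i) *: \sum_n (tkk_neg X 0 n)%:C *: qop (mulx n) q
  + ((lam_L al lam (tkk_L X))%:C *: q - qop (dT (jL al (tkk_L X))) q)
  + qop (dT (tkk_D X)) q
  + - ('i / 2) *: \sum_n (tkk_pos X 0 n)%:C *: qop (bessel al lam n) q.
Proof.
have clsN f : cls (- f) = - cls f by rewrite -scaleN1r clsZ scaleN1r.
rewrite /schroedinger_quot /schroedinger !clsD !clsN !clsZ repK.
rewrite /mulx_lin /bessel_lin !(big4 (fun i => _ *: _)) !clsD !clsZ.
by [].
Qed.

Lemma i_neq0 : 'i != 0 :> C.
Proof. exact: neq0Ci. Qed.

Lemma jL0 : jL al 0 = 0 :> 'M[R]_4.
Proof.
by apply/matrixP => i j; rewrite jLE jmulE; move: j; apply: forall4; rewrite !mxE /=; ring.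
Qed.
Lemma dT0 f : dT 0 f = 0 :> SF.
Proof. by rewrite /dT big1 // => i _; rewrite big1 // => j _; rewrite mxE scale0r. Qed.
Lemma qop_dT0 q : qop (dT 0) q = 0.
Proof.
rewrite /qop dT0; apply: (addrI (cls 0)).
by rewrite -clsD !addr0.
Qed.
Lemma lam_L0 : lam_L al lam 0 = 0.
Proof. by rewrite /lam_L !mxE !mul0r addr0. Qed.

Lemma sum_basis (V : lmodType C) (n : 'I_4) (F : 'I_4 -> V) :
  \sum_j (eb R n 0 j)%:C *: F j = F n.
Proof.
rewrite (bigD1 n) //= big1 => [|j jn]; first by rewrite addr0 /eb mxE !eqxx /= scale1r.
by rewrite /eb mxE (negbTE jn) andbF scale0r.
Qed.
Lemma sum_zero (V : lmodType C) (F : 'I_4 -> V) :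
  \sum_j ((0 : 'rV[R]_4) 0 j)%:C *: F j = 0.
Proof. by rewrite big1 // => j _; rewrite mxE scale0r. Qed.

Lemma act_D D q : act (Tkk 0 0 D 0) q = qop (dT D) q.
Proof.
by rewrite actE /= !sum_zero !scaler0 lam_L0 jL0 qop_dT0 scale0r subr0 !add0r addr0.
Qed.
Lemma act_neg n q : act (Tkk (eb R n) 0 0 0) q = - (2 * 'i) *: qop (mulx n) q.
Proof.
by rewrite actE /= sum_zero sum_basis !scaler0 lam_L0 jL0 !qop_dT0 scale0r subr0 !addr0.
Qed.
Lemma act_pos n q : act (Tkk 0 0 0 (eb R n)) q = - ('i / 2) *: qop (bessel al lam n) q.
Proof.
by rewrite actE /= sum_zero sum_basis !scaler0 lam_L0 jL0 !qop_dT0 scale0r subr0 !add0r.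
Qed.
Lemma act_L v q : act (Tkk 0 v 0 0) q = (lam_L al lam v)%:C *: q - qop (dT (jL al v)) q.
Proof. by rewrite actE /= !sum_zero !scaler0 !qop_dT0 !addr0 add0r. Qed.
Lemma act_T (a : 'rV[R]_4) D q : act (Tkk a 0 D (- a)) q =
  qop (dT D) q - ('i / 2) *: \sum_n (a 0 n)%:C *: qT n q.
Proof.
rewrite actE /= lam_L0 jL0 qop_dT0 scale0r subr0 addr0.
rewrite [X in - (2 * 'i) *: X](_ : _ = \sum_n (a 0 n)%:C *: qop (mulx n) q) //.
rewrite addrAC addrC; congr (_ + _).
rewrite -scaleNr !scaler_sumr -big_split; apply: eq_bigr => n _ /=.
rewrite /qT mxE rmorphN /= !scalerBr !scalerA -scaleNr; congr (_ *: _ + _ *: _); last by ring.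
by field.
Qed.

Definition subsp (M : set Q) := M 0 /\ forall (k : C) u v, M u -> M v -> M (k *: u + v).

Section Subspace.
Variables (M : set Q) (sM : subsp M).
Lemma sub0 : M 0. Proof. by case: sM. Qed.
Lemma subD u v : M u -> M v -> M (u + v).
Proof. by case: sM => _ H Mu Mv; rewrite -[u]scale1r; exact: H. Qed.
Lemma subZ k u : M u -> M (k *: u).
Proof. by case: sM => M0 H Mu; rewrite -[_ *: u]addr0; exact: H. Qed.
Lemma subZK k u : k != 0 -> M (k *: u) -> M u.
Proof. by move=> k0 /(subZ k^-1); rewrite scalerA mulVf // scale1r. Qed.
Lemma subN u : M u -> M (- u).
Proof. by move=> Mu; rewrite -scaleN1r; exact: subZ. Qed.
Lemma sub_sum (F : 'I_4 -> Q) : (forall n, M (F n)) -> M (\sum_n F n).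
Proof. by move=> H; apply: big_ind => //; [exact: sub0|exact: subD]. Qed.
End Subspace.

(** Closure under the basic operators amounts to closure under the action of
k_0, k and g respectively, see [submod_k0P], [submod_kP], [submod_gP]; these
operators have explicit formulas in the model. *)
Definition k0_closed (M : set Q) := forall h e f x y q, M q ->
  M (qop (dT (derE h e f)) q) /\ M (qop (dT (derO al (eps * x) (eps * y))) q).
Definition k_closed (M : set Q) := k0_closed M /\ forall n q, M q -> M (qT n q).
Definition g_closed (M : set Q) := k0_closed M /\ forall n q, M q ->
  [/\ M (qop (mulx n) q), M (qop (bessel al lam n) q) &
      forall v, M (qop (dT (jL al v)) q)].

Lemma eps2 : eps * eps = 1.
Proof. by rewrite /eps; case: ifP => _; rewrite ?mulr1 ?mulrNN ?mulr1. Qed.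

Lemma qop_dTD T1 T2 q : qop (dT (T1 + T2)) q = qop (dT T1) q + qop (dT T2) q.
Proof. by rewrite /qop dTD clsD. Qed.

Lemma k0_closed_Der M D q : subsp M -> k0_closed M -> Der al D -> M q -> M (qop (dT D) q).
Proof.
move=> sM cM /DerP [h [e [f [x [y ->]]]]] Mq; rewrite qop_dTD.
rewrite -[x]mul1r -[y]mul1r -eps2 -!mulrA.
by have [] := cM h e f (eps * x) (eps * y) q Mq; exact: subD.
Qed.

Definition graded (N : set Q) := forall u, N u -> exists u0 u1,
  [/\ N u0, N u1, quot_homog al lam false u0, quot_homog al lam true u1 & u = u0 + u1].

Lemma submod_k0P N : submod (alg_k0 al) N <->
  [/\ subsp N, graded N & k0_closed N].
Proof.
split=> [[N0 NZD Ng Na]|[[N0 NZD] Ng Nc]].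
  split=> // h e f x y q Nq; rewrite -!act_D; split; apply: Na => //.
    by exists (derE h e f); split; [exact: DerE|].
  by exists (derO al (eps * x) (eps * y)); split; [exact: DerO|].
split=> // X u [D [dD ->]] Nu; rewrite act_D.
exact: k0_closed_Der.
Qed.

Lemma submod_kP N : submod (alg_k al) N <->
  [/\ subsp N, graded N & k_closed N].
Proof.
split=> [[N0 NZD Ng Na]|[[N0 NZD] Ng [Nc NT]]].
  have sN : subsp N by [].
  split=> //; split=> [h e f x y q Nq|n q Nq].
    rewrite -!act_D; split; apply: Na => //.
      by exists 0, (derE h e f); split; [exact: DerE|rewrite oppr0].
    by exists 0, (derO al (eps * x) (eps * y)); split; [exact: DerO|rewrite oppr0].
  have : N (act (Tkk (eb R n) 0 0 (- eb R n)) q).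
    by apply: Na => //; exists (eb R n), 0; split=> //; exact: Der0.
  rewrite act_T qop_dT0 add0r sum_basis -scaleNr; apply: subZK => //.
  by rewrite oppr_eq0 mulf_neq0 ?i_neq0 // invr_eq0 pnatr_eq0.
have sN : subsp N by [].
split=> // X u [a [D [dD ->]]] Nu; rewrite act_T.
apply: subD => //; first exact: k0_closed_Der.
by apply: subN => //; apply: subZ => //; apply: sub_sum => // n; apply: subZ => //; exact: NT.
Qed.

Lemma submod_gP N : submod (alg_g al) N <->
  [/\ subsp N, graded N & g_closed N].
Proof.
split=> [[N0 NZD Ng Na]|[[N0 NZD] Ng [Nc NT]]].
  have sN : subsp N by [].
  split=> //; split=> [h e f x y q Nq|n q Nq].
    by rewrite -!act_D; split; apply: Na => //; [exact: DerE|exact: DerO].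
  split.
  - have : N (act (Tkk (eb R n) 0 0 0) q) by apply: Na => //; exact: Der0.
    rewrite act_neg; apply: subZK => //.
    by rewrite oppr_eq0 mulf_neq0 ?i_neq0 // pnatr_eq0.
  - have : N (act (Tkk 0 0 0 (eb R n)) q) by apply: Na => //; exact: Der0.
    rewrite act_pos; apply: subZK => //.
    by rewrite oppr_eq0 mulf_neq0 ?i_neq0 // invr_eq0 pnatr_eq0.
  - move=> v.
    have : N (act (Tkk 0 v 0 0) q) by apply: Na => //; exact: Der0.
    rewrite act_L => /(subN sN) /(subD sN (subZ sN (lam_L al lam v)%:C Nq)).
    by rewrite opprB addrC subrK.
have sN : subsp N by [].
have NT1 n q (Nq : N q) : N (qop (mulx n) q) by have [] := NT n q Nq.
have NT2 n q (Nq : N q) : N (qop (bessel al lam n) q) by have [] := NT n q Nq.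
have NT3 v q (Nq : N q) : N (qop (dT (jL al v)) q) by have [_ _ ] := NT i1 q Nq.
split=> // X u dD Nu; rewrite actE; do 3?apply: subD => //.
- by apply: subZ => //; apply: sub_sum => // n; apply: subZ => //; exact: NT1.
- by apply: subD => //; [exact: subZ|apply: subN => //; exact: NT3].
- exact: k0_closed_Der.
- by apply: subZ => //; apply: sub_sum => // n; apply: subZ => //; exact: NT2.
Qed.

(** * Submodules of the K-types *)

Lemma irr_intro L (M : set Q) u0 : submod L M -> M u0 -> u0 <> 0 ->
  (forall N u, submod L N -> N `<=` M -> N u -> u <> 0 -> M `<=` N) ->
  irreducible_module (quot_homog al lam) act L M.
Proof.
move=> sM Mu0 u0n0 H; split=> //; first by move=> M0; apply: u0n0; move: Mu0; rewrite M0.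
move=> N sN NM; have [N0|/existsNP[u /not_implyP[Nu un0]]] := pselect (N `<=` [set 0]).
  by left; apply/seteqP; split=> // u ->; case: sN.
by right; apply/seteqP; split=> //; exact: H Nu un0.
Qed.

(** Even and odd parts of an element of W are unique, by [emb_even], [emb_odd]. *)
Lemma graded_split N a b c d : graded N -> (forall u, N u -> exists a b c d, u = emb a b c d) ->
  N (emb a b c d) -> N (emb a b 0 0) /\ N (emb 0 0 c d).
Proof.
move=> gN NW /gN [u0 [u1 [N0 N1]]].
have [a0 [b0 [c0 [d0 e0]]]] := NW _ N0; have [a1 [b1 [c1 [d1 e1]]]] := NW _ N1.
move: N0 N1; rewrite {}e0 {}e1 => N0 N1.
move=> /emb_even[c00 d00] /emb_odd [a10 b10]; move: N0 N1.
rewrite c00 d00 a10 b10 embD !addr0 !add0r => N0 N1 /emb_inj [-> -> -> ->].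
by split.
Qed.

Lemma kvecZD m k x y z t x' y' z' t' : k *: kvec m x y z t + kvec m x' y' z' t' =
  kvec m (k * x + x') (k * y + y') (k * z + z') (k * t + t').
Proof. by rewrite /kvec embZD -!mul_polyC; congr emb; ring. Qed.
Lemma kvec00 m : kvec m 0 0 0 0 = 0.
Proof. by rewrite -emb0 /kvec; congr emb; ring. Qed.
Lemma kvecZ m k x y z t : k *: kvec m x y z t = kvec m (k * x) (k * y) (k * z) (k * t).
Proof. by rewrite -[LHS]addr0 -(kvec00 m) kvecZD !addr0. Qed.
Lemma kvecD m x y z t x' y' z' t' : kvec m x y z t + kvec m x' y' z' t' =
  kvec m (x + x') (y + y') (z + z') (t + t').
Proof. by rewrite -[kvec m x y z t]scale1r kvecZD !mul1r. Qed.

Lemma lag_neq0 s m : lag s m != 0.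
Proof. by rewrite -size_poly_eq0 size_lag. Qed.

Lemma kvec_inj m x y z t x' y' z' t' : kvec m x y z t = kvec m x' y' z' t' ->
  [/\ x = x', y = y', z = z' & t = t'].
Proof.
have cancel s n (p q : C) : p%:P * lag s n = q%:P * lag s n -> p = q.
  by move=> /(mulIf (lag_neq0 s n)) /polyC_inj.
move=> /emb_inj [e1 e2 /cancel -> /cancel ->].
have yy : y = y'.
  apply: (cancel 0 m); apply: (@mulfI _ (4%:R : {poly C})); last by rewrite !mulrA.
  by rewrite -polyC_natr polyC_eq0 pnatr_eq0.
by move: e1; rewrite yy => /addIr /cancel ->.
Qed.

Lemma kvec_eq0 m x y z t : kvec m x y z t = 0 -> [/\ x = 0, y = 0, z = 0 & t = 0].
Proof. by rewrite -(kvec00 m) => /kvec_inj. Qed.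

Lemma kvec_graded N m x y z t : graded N -> (forall u, N u -> exists x y z t, u = kvec m x y z t) ->
  N (kvec m x y z t) -> N (kvec m x y 0 0) /\ N (kvec m 0 0 z t).
Proof.
move=> gN NW Nu.
have [|N0 N1] := graded_split gN _ Nu.
  by move=> u /NW [x' [y' [z' [t' ->]]]]; do 4!eexists.
by split; rewrite /kvec ?mul0r ?mulr0 ?mul0r ?addr0.
Qed.

Lemma kvec_mem (N : set Q) m x y z t x' y' z' t' : x = x' -> y = y' -> z = z' -> t = t' ->
  N (kvec m x y z t) -> N (kvec m x' y' z' t').
Proof. by move=> -> -> -> ->. Qed.

Lemma kvec_even m x y : quot_homog al lam false (kvec m x y 0 0).
Proof. by rewrite /kvec !mul0r; exact: even_emb. Qed.
Lemma kvec_odd m z t : quot_homog al lam true (kvec m 0 0 z t).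
Proof. by rewrite /kvec !(mul0r, mulr0, addr0); exact: odd_emb. Qed.

#[local] Opaque kvec.

Definition kset m (P : C -> C -> C -> C -> Prop) : set Q :=
  [set q | exists x y z t, P x y z t /\ q = kvec m x y z t].

Lemma ksetE m P x y z t : kset m P (kvec m x y z t) <-> P x y z t.
Proof.
split=> [[x' [y' [z' [t' [Pq /kvec_inj [-> -> -> ->]]]]]]|Pq] //.
by exists x, y, z, t.
Qed.

Lemma kset_subsp m P : P 0 0 0 0 -> (forall k x y z t x' y' z' t',
   P x y z t -> P x' y' z' t' -> P (k * x + x') (k * y + y') (k * z + z') (k * t + t')) ->
  subsp (kset m P).
Proof.
move=> P0 PZD; split; first by rewrite -(kvec00 m); apply/ksetE.
move=> k u v [x [y [z [t [Pu ->]]]]] [x' [y' [z' [t' [Pv ->]]]]].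
by rewrite kvecZD; apply/ksetE/PZD.
Qed.

Lemma kset_graded m (P : C -> C -> C -> C -> Prop) :
  (forall x y z t, P x y z t -> P x y 0 0 /\ P 0 0 z t) -> graded (kset m P).
Proof.
move=> H u [x [y [z [t [/H [P0 P1] ->]]]]]; exists (kvec m x y 0 0), (kvec m 0 0 z t).
split; [exact/ksetE|exact/ksetE|exact: kvec_even|exact: kvec_odd|].
by rewrite kvecD !addr0 !add0r.
Qed.

Definition Wset m := kset m (fun _ _ _ _ => True).
Definition Kset m := kset m (fun x y _ _ => y = kap m * x).
Definition Rset m := kset m (fun x y z t => [/\ y = m.+1%:R * x, z = 0 & t = 0]).

Lemma k0_closed_W m : k0_closed (Wset m).
Proof.
move=> h e f x y q [? [? [? [? [_ ->]]]]]; rewrite derE_kvec derO_kvec.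
by split; apply/ksetE.
Qed.
Lemma k0_closed_K m : k0_closed (Kset m).
Proof.
move=> h e f x y q [? [? [? [? [_ ->]]]]]; rewrite derE_kvec derO_kvec.
by split; apply/ksetE; ring.
Qed.
Lemma k0_closed_R m : k0_closed (Rset m).
Proof.
move=> h e f x y q [? [? [? [? [[-> -> ->] ->]]]]]; rewrite derE_kvec derO_kvec.
by split; apply/ksetE; split; ring.
Qed.

Lemma submod0_W m : submod (alg_k0 al) (Wset m).
Proof.
apply/submod_k0P => //; split; [exact: kset_subsp|exact: kset_graded|exact: k0_closed_W].
Qed.
Lemma submod0_K m : submod (alg_k0 al) (Kset m).
Proof.
apply/submod_k0P => //; split; [apply: kset_subsp|apply: kset_graded|exact: k0_closed_K].
- by ring.
- by move=> k x y z t x' y' z' t' -> ->; ring.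
- by move=> x y z t ->; split=> //; ring.
Qed.
Lemma submod0_R m : submod (alg_k0 al) (Rset m).
Proof.
apply/submod_k0P => //; split; [apply: kset_subsp|apply: kset_graded|exact: k0_closed_R].
- by split=> //; ring.
- by move=> k x y z t x' y' z' t' [-> -> ->] [-> -> ->]; split; ring.
- by move=> x y z t [-> -> ->]; split; split=> //; ring.
Qed.

Lemma gam_neq0 : gC != 0.
Proof.
rewrite eq_complex /= eqxx andbT /gam; case: ifP => _ //; exact: oner_neq0.
Qed.

(** The copy of sl_2 acts irreducibly on the odd part, and the odd derivations
map it onto the line of u + kappa u'. *)
Lemma odd_generates N m z t : subsp N -> k0_closed N -> N (kvec m 0 0 z t) ->
  (z != 0) || (t != 0) ->
  forall x z' t', N (kvec m x (kap m * x) z' t').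
Proof.
move=> sN cN Nzt nz.
have dE h e f q : N q -> N (qop (dT (derE h e f)) q) by move=> Nq; have [] := cN h e f 0 0 q Nq.
have dO x y q : N q -> N (qop (dT (derO al (eps * x) (eps * y))) q).
  by move=> Nq; have [] := cN 0 0 0 x y q Nq.
have scale k : k != 0 -> forall x y z' t', N (kvec m (k * x) (k * y) (k * z') (k * t')) ->
  N (kvec m x y z' t') by move=> k0 x y z' t'; rewrite -kvecZ; exact: subZK.
have [N3 N4] : N (kvec m 0 0 1 0) /\ N (kvec m 0 0 0 1).
  case/orP: nz => nz.
    have N4 : N (kvec m 0 0 0 1).
      have := dE 0 1 0 _ Nzt; rewrite derE_kvec => H; apply: (scale z nz).
      by apply: kvec_mem H; ring.
    split; [|exact: N4]; have := dE 0 0 1 _ N4; rewrite derE_kvec.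
    by apply: kvec_mem; ring.
  have N3 : N (kvec m 0 0 1 0).
    have := dE 0 0 1 _ Nzt; rewrite derE_kvec => H; apply: (scale t nz).
    by apply: kvec_mem H; ring.
  split; [exact: N3|]; have := dE 0 1 0 _ N3; rewrite derE_kvec.
  by apply: kvec_mem; ring.
have N1 : N (kvec m 1 (kap m) 0 0).
  have := dO 0 1 _ N3; rewrite derO_kvec => H; apply: (@scale (gC / 2)).
    by rewrite mulf_neq0 ?gam_neq0 // invr_eq0 pnatr_eq0.
  by apply: kvec_mem H; ring.
move=> x z' t'; have := subD sN (subZ sN x N1) (subD sN (subZ sN z' N3) (subZ sN t' N4)).
by rewrite !kvecZ !kvecD; apply: kvec_mem; ring.
Qed.

Lemma even_to_odd N m x y : k0_closed N -> N (kvec m x y 0 0) ->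
  N (kvec m 0 0 (4 * (m.+1%:R * x - y)) 0).
Proof.
move=> cN Nxy; have [_] := cN 0 0 0 1 0 _ Nxy; rewrite derO_kvec.
by apply: kvec_mem; ring.
Qed.

Lemma even_generates N m x y : subsp N -> k0_closed N -> N (kvec m x y 0 0) ->
  m.+1%:R * x - y != 0 -> forall x z' t', N (kvec m x (kap m * x) z' t').
Proof.
move=> sN cN Nxy nz; apply: (odd_generates sN cN (even_to_odd cN Nxy)).
by rewrite mulf_neq0 // pnatr_eq0.
Qed.

Lemma irr_K m : beta al lam != -1 ->
  irreducible_module (quot_homog al lam) act (alg_k0 al) (Kset m).
Proof.
move=> b1; have b1C : 1 + bC != 0.
  by rewrite -(rmorph1 (real_complex R)) -rmorphD fmorph_eq0 addrC addr_eq0.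
apply: (@irr_intro _ _ (kvec m 0 0 1 0)); first exact: submod0_K.
- by apply/ksetE; rewrite mulr0.
- by move=> /kvec_eq0 [_ _ /eqP]; rewrite oner_eq0.
move=> N u /submod_k0P[] // sN gN cN NK Nu un0 _ [x' [y' [z' [t' [-> ->]]]]].
have [x [y [z [t [yE uE]]]]] := NK _ Nu; rewrite uE in Nu un0.
have [|Ne No] := kvec_graded gN _ Nu.
  by move=> v /NK [? [? [? [? [_ ->]]]]]; do 4!eexists.
have [nz|] := boolP ((z != 0) || (t != 0)); first exact: odd_generates No nz _ _ _.
rewrite negb_or !negbK => /andP[/eqP z0 /eqP t0]; apply: (even_generates sN cN Ne).
rewrite yE (_ : _ - _ = (1 + bC) * x); last by rewrite -natr1; ring.
rewrite mulf_neq0 //; apply/eqP => x0; apply: un0.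
by rewrite yE x0 z0 t0 mulr0 kvec00.
Qed.

Lemma irr_R m : irreducible_module (quot_homog al lam) act (alg_k0 al) (Rset m).
Proof.
apply: (@irr_intro _ _ (kvec m 1 m.+1%:R 0 0)); first exact: submod0_R.
- by apply/ksetE; rewrite mulr1.
- by move=> /kvec_eq0 [/eqP]; rewrite oner_eq0.
move=> N u /submod_k0P[] // sN _ _ NR Nu un0 _ [x' [y' [z' [t' [[-> -> ->] ->]]]]].
have [x [y [z [t [[yE zE tE] uE]]]]] := NR _ Nu.
have x0 : x != 0.
  by apply/eqP => x0; apply: un0; rewrite uE yE zE tE x0 mulr0 kvec00.
have := subZ sN (x' / x) Nu; rewrite uE yE zE tE kvecZ.
by apply: kvec_mem; field.
Qed.

Lemma direct_KR m : beta al lam != -1 -> direct_sum (Wset m) (Kset m) (Rset m).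
Proof.
move=> b1; have b1C : 1 + bC != 0.
  by rewrite -(rmorph1 (real_complex R)) -rmorphD fmorph_eq0 addrC addr_eq0.
split.
  apply/seteqP; split=> [_ [x [y [z [t [_ ->]]]]]|_ [p [? [? [? [? [_ ->]]]]] [q
      [? [? [? [? [_ ->]]]]] <-]]]; last first.
    by rewrite kvecD; apply/ksetE.
  pose x1 := (m.+1%:R * x - y) / (1 + bC); pose x2 := (y - kap m * x) / (1 + bC).
  exists (kvec m x1 (kap m * x1) z t); first exact/ksetE.
  exists (kvec m x2 (m.+1%:R * x2) 0 0); first exact/ksetE.
  by rewrite kvecD /x1 /x2 -natr1; apply: (kvec_mem (N := fun v => _ = v)) erefl; field.
apply/seteqP; split=> [q [[x [y [z [t [-> ->]]]]] /ksetE [e -> ->]]|q ->].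
  have : (1 + bC) * x = 0.
    by apply: etrans (_ : m.+1%:R * x - kap m * x = 0); [rewrite -natr1; ring|rewrite e subrr].
  by move=> /eqP; rewrite mulf_eq0 (negbTE b1C) => /eqP ->; rewrite mulr0; exact: kvec00.
by rewrite -(kvec00 m); split; apply/ksetE; [|split]; rewrite ?mulr0.
Qed.

(** For beta = -1 the vector u + (m+1) u' and the odd part lie in every submodule
containing an even vector not killed by the odd derivations.  In a
decomposition one of the two components of u is such a vector, and the other
summand then meets this submodule only in zero. *)
Lemma indecomposable_W m : beta al lam = -1 ->
  indecomposable_module (quot_homog al lam) act (alg_k0 al) (Wset m).
Proof.
move=> b1; have kapE : kap m = m.+1%:R by rewrite b1 rmorphN1 opprK natr1.
split; first exact: submod0_W.
  move=> e; have : Wset m (kvec m 1 0 0 0) by apply/ksetE.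
  by rewrite e => /kvec_eq0 [/eqP]; rewrite oner_eq0.
have key A B : submod (alg_k0 al) A -> submod (alg_k0 al) B -> A `<=` Wset m ->
    B `<=` Wset m -> A `&` B = [set 0] ->
    forall x y, A (kvec m x y 0 0) -> m.+1%:R * x - y != 0 -> B = [set 0].
  move=> /submod_k0P[] // sA gA cA /submod_k0P[] // sB gB cB AW BW AB x y Axy nz.
  have gen := even_generates sA cA Axy nz.
  have AB0 q : A q -> B q -> q = 0.
    by move=> Aq Bq; have : (A `&` B) q by []; rewrite AB.
  apply/seteqP; split=> [q Bq|q ->]; last exact: sub0 sB.
  have [p [r [z [t [_ qE]]]]] := BW _ Bq; rewrite qE in Bq *.
  have [|Be Bo] := kvec_graded gB _ Bq.
    by move=> v /BW [? [? [? [? [_ ->]]]]]; do 4!eexists.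
  have [_ _ z0 t0] : [/\ (0 : C) = 0, (0 : C) = 0, z = 0 & t = 0].
    by apply: (@kvec_eq0 m); apply: (AB0 _ _ Bo); have := gen 0 z t; rewrite mulr0.
  have /kvec_eq0[_ _ /eqP + _] : kvec m 0 0 (4 * (m.+1%:R * p - r)) 0 = 0.
    apply: AB0; last exact: even_to_odd cB Be.
    by have := gen 0 (4 * (m.+1%:R * p - r)) 0; rewrite mulr0.
  rewrite mulf_eq0 pnatr_eq0 /= subr_eq0 => /eqP e.
  rewrite z0 t0 in Bq *; apply: AB0 => //.
  by have := gen p 0 0; rewrite kapE e.
move=> A B sA sB [WAB AB].
have AW : A `<=` Wset m.
  by move=> a Aa; rewrite WAB; exists a => //; exists 0; [case: sB|rewrite addr0].
have BW : B `<=` Wset m.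
  by move=> a Ba; rewrite WAB; exists 0; [case: sA|exists a => //; rewrite add0r].
have : Wset m (kvec m 1 0 0 0) by apply/ksetE.
rewrite WAB => -[a Aa [c Bc]].
have [x [y [z [t [_ aE]]]]] := AW _ Aa; have [x' [y' [z' [t' [_ cE]]]]] := BW _ Bc.
rewrite aE cE in Aa Bc *; rewrite kvecD => /kvec_inj [ex ey _ _].
have [Ae _] : A (kvec m x y 0 0) /\ A (kvec m 0 0 z t).
  apply: kvec_graded Aa; first by case/submod_k0P: sA.
  by move=> v /AW [? [? [? [? [_ ->]]]]]; do 4!eexists.
have [Be _] : B (kvec m x' y' 0 0) /\ B (kvec m 0 0 z' t').
  apply: kvec_graded Bc; first by case/submod_k0P: sB.
  by move=> v /BW [? [? [? [? [_ ->]]]]]; do 4!eexists.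
have [nz|] := boolP (m.+1%:R * x - y != 0); first by right; exact: key Ae nz.
rewrite negbK => /eqP e0; left.
apply: (key B A) Be _ => //; first by rewrite setIC.
have -> : m.+1%:R * x' - y' = m.+1%:R.
  have -> : x' = 1 - x by rewrite -ex; ring.
  have -> : y' = - y by apply/eqP; rewrite -addr_eq0 addrC ey.
  by rewrite mulrBr mulr1 opprK -[RHS]subr0 -e0; ring.
by rewrite pnatr_eq0.
Qed.

Lemma not_irreducible_W m :
  ~ irreducible_module (quot_homog al lam) act (alg_k0 al) (Wset m).
Proof.
case=> _ _ /(_ (Rset m) (submod0_R m)) []; first by move=> _ [? [? [? [? [_ ->]]]]]; exact/ksetE.
  move=> e; have : Rset m (kvec m 1 m.+1%:R 0 0) by apply/ksetE; rewrite mulr1.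
  by rewrite e => /kvec_eq0 [/eqP]; rewrite oner_eq0.
move=> e; have : Wset m (kvec m 0 0 1 0) by apply/ksetE.
by rewrite -e => /ksetE [_ /eqP]; rewrite oner_eq0.
Qed.

(** * Irreducibility under k *)

Hypothesis beta_nat : forall m : nat, beta al lam != m%:R.

Lemma forall_ij (P : 'I_4 -> Prop) : P ii -> P jj -> P i3 -> P i4 -> forall n, P n.
Proof. by rewrite /ii /jj; case: ifP => _ Pi Pj P3 P4; apply: forall4. Qed.

Lemma k_closed_W m : k_closed (Wset m).
Proof.
split; first exact: k0_closed_W.
move=> n q [x [y [z [t [_ ->]]]]]; move: n; apply: forall_ij.
- by rewrite qT_ii //; exact/ksetE.
- by rewrite qT_jj //; exact/ksetE.
- by rewrite qT_3 //; exact/ksetE.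
- by rewrite qT_4 //; exact/ksetE.
Qed.

Lemma kap_neq0 m : kap m != 0.
Proof.
rewrite subr_eq0 eq_sym -(rmorph_nat (real_complex R)).
by rewrite (inj_eq (fmorph_inj _)).
Qed.

Lemma submodK_W m : submod (alg_k al) (Wset m).
Proof.
by apply/submod_kP => //; split; [exact: kset_subsp|exact: kset_graded|exact: k_closed_W].
Qed.

(** Any nonzero vector generates the odd part and u + kappa u'.  The operator
[qT ii] has eigenvalues 4 (m+1) - 2 beta and 4 m - 2 beta on u and u', so
subtracting a multiple of the identity isolates u; then kappa u' is obtained
by difference. *)
Lemma irrK_W m : irreducible_module (quot_homog al lam) act (alg_k al) (Wset m).
Proof.
apply: (@irr_intro _ _ (kvec m 1 0 0 0)); first exact: submodK_W.
- exact/ksetE.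
- by move=> /kvec_eq0 [/eqP]; rewrite oner_eq0.
move=> N u /submod_kP[] // sN gN [cN NT] NW Nu un0.
have gen : forall x z' t', N (kvec m x (kap m * x) z' t').
  have [x [y [z [t [_ uE]]]]] := NW _ Nu; rewrite uE in Nu un0.
  have [|Ne No] := kvec_graded gN _ Nu.
    by move=> v /NW [? [? [? [? [_ ->]]]]]; do 4!eexists.
  have [nz|] := boolP ((z != 0) || (t != 0)).
    exact: (odd_generates sN cN No nz).
  rewrite negb_or !negbK => /andP[/eqP z0 /eqP t0].
  have [x0|x0] := eqVneq x 0.
    apply: (even_generates sN cN Ne); rewrite x0 mulr0 sub0r oppr_eq0.
    by apply/eqP => y0; apply: un0; rewrite x0 y0 z0 t0 kvec00.
  have N1 : N (kvec m (4 * x) 0 0 0).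
    have := subD sN (NT ii _ Ne) (subZ sN (- (4 * m%:R - 2 * bC)) Ne).
    rewrite qT_ii kvecZ kvecD; apply: kvec_mem; rewrite -?natr1; ring.
  apply: (even_generates sN cN N1).
  by rewrite subr0 !mulf_neq0 // pnatr_eq0.
have N1 : N (kvec m 4 0 0 0).
  have := subD sN (NT ii _ (gen 1 0 0)) (subZ sN (- (4 * m%:R - 2 * bC)) (gen 1 0 0)).
  rewrite qT_ii kvecZ kvecD; apply: kvec_mem; rewrite -?natr1; ring.
move=> _ [x [y [z [t [_ ->]]]]]; have k0 := kap_neq0 m.
have := subD sN (subZ sN ((x - y / kap m) / 4) N1) (gen (y / kap m) z t).
rewrite kvecZ kvecD; apply: kvec_mem; by field.
Qed.

Definition W0set : set Q := [set q | exists x : C, q = emb x%:P 0 0 0].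

Lemma W0_subsp : subsp W0set.
Proof.
split; first by exists 0; rewrite polyC0 emb0.
move=> k u v [x ->] [y ->]; exists (k * x + y).
by rewrite embZD !scaler0 !addr0 -mul_polyC -polyCM -polyCD.
Qed.

Lemma W0_graded : graded W0set.
Proof.
move=> u [x ->]; exists (emb x%:P 0 0 0), 0; split; rewrite ?addr0 //.
- by exists x.
- by exists 0; rewrite polyC0 emb0.
- exact: even_emb.
- by rewrite -emb0; exact: odd_emb.
Qed.

Lemma W0_closed : k_closed W0set.
Proof.
have W00 a b c d : a = 0 -> b = 0 -> c = 0 -> d = 0 -> W0set (emb a b c d).
  by move=> -> -> -> ->; exists 0; rewrite polyC0.
have W01 p a b c d : a = p%:P -> b = 0 -> c = 0 -> d = 0 -> W0set (emb a b c d).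
  by move=> -> -> -> ->; exists p.
split=> [h e f x y q [p ->]|n q [p ->]].
  rewrite act_derE act_derO // derivC.
  by split; apply: W00; rewrite ?(derivC, deriv0); ring.
move: n; apply: forall_ij; rewrite /qT.
- rewrite act_mulx_ii act_bessel_ii -[X in 4 *: _ + X]scaleN1r !embZ embD.
  apply: (W01 (- (2 * bC * p))); rewrite /Bop /rpolyC -!mul_polyC ?(derivC, deriv0); ring.
- rewrite act_mulx_jj act_bessel_jj -[X in 4 *: _ + X]scaleN1r !embZ embD.
  by apply: (W01 (- (2 * p))); rewrite -!mul_polyC; ring.
- rewrite act_mulx_3 // act_bessel_3 // -[X in 4 *: _ + X]scaleN1r !embZ embD deriv_sub2.
  by apply: W00; rewrite -!mul_polyC ?(derivC, deriv0); ring.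
- rewrite act_mulx_4 // act_bessel_4 // -[X in 4 *: _ + X]scaleN1r !embZ embD deriv_sub2.
  by apply: W00; rewrite -!mul_polyC ?(derivC, deriv0); ring.
Qed.

Lemma irrK_W0 : irreducible_module (quot_homog al lam) act (alg_k al) W0set.
Proof.
apply: (@irr_intro _ _ (emb 1%:P 0 0 0)).
- apply/submod_kP => //; split; [exact: W0_subsp|exact: W0_graded|exact: W0_closed].
- by exists 1.
- by rewrite -emb0 => /emb_inj [/eqP]; rewrite polyC_eq0 oner_eq0.
move=> N u /submod_kP[] // sN _ _ NW Nu un0 _ [y ->].
have [x uE] := NW _ Nu; have x0 : x != 0.
  by apply/eqP => x0; apply: un0; rewrite uE x0 polyC0 emb0.
have := subZ sN (y / x) Nu.
by rewrite uE embZ !scaler0 -mul_polyC -polyCM divfK.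
Qed.

(** * Irreducibility under g *)

#[local] Opaque emb qop.

Lemma emb_mem (N : set Q) a b c d a' b' c' d' : a = a' -> b = b' -> c = c' -> d = d' ->
  N (emb a b c d) -> N (emb a' b' c' d').
Proof. by move=> -> -> -> ->. Qed.

Definition Wall : set Q := [set q | exists a b c d, q = emb a b c d].

Lemma Wall_closed : g_closed Wall.
Proof.
split=> [h e f x y q [a [b [c [d ->]]]]|n q [a [b [c [d ->]]]]].
  by rewrite act_derE act_derO //; split; do 4!eexists.
split.
- move: n; apply: forall_ij.
  + by rewrite act_mulx_ii; do 4!eexists.
  + by rewrite act_mulx_jj; do 4!eexists.
  + by rewrite act_mulx_3; do 4!eexists.
  + by rewrite act_mulx_4; do 4!eexists.
- move: n; apply: forall_ij.
  + by rewrite act_bessel_ii //; do 4!eexists.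
  + by rewrite act_bessel_jj //; do 4!eexists.
  + by rewrite act_bessel_3 //; do 4!eexists.
  + by rewrite act_bessel_4 //; do 4!eexists.
- move=> v.
  have -> : v = vecij (v 0 ii) (v 0 jj) (v 0 i3) (v 0 i4).
    rewrite /vecij /ii /jj; case: (lam == al);
      by apply/rowP; apply: forall4; rewrite !vec4_nth.
  by rewrite act_jL //; do 4!eexists.
Qed.

Lemma Wall_submod : submod (alg_g al) Wall.
Proof.
apply/submod_gP => //; split; last exact: Wall_closed.
  split; first by exists 0, 0, 0, 0; rewrite emb0.
  by move=> k u v [a [b [c [d ->]]]] [a' [b' [c' [d' ->]]]]; rewrite embZD; do 4!eexists.
move=> u [a [b [c [d ->]]]]; exists (emb a b 0 0), (emb 0 0 c d).
split; [by do 4!eexists|by do 4!eexists|exact: even_emb|exact: odd_emb|].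
by rewrite embD !addr0 !add0r.
Qed.

(** A combination of B(x_i), L_(e_i), multiplication by x_i and the identity acts
on the coefficient of x_j by this operator, see [NiL]. *)
Definition lowering (b : {poly C}) : {poly C} := 'X * b^`()^`() - bC *: b^`().

Lemma coef_lowering b n : (lowering b)`_n = n.+1%:R * (n%:R - bC) * b`_n.+1.
Proof.
have dE (p : {poly C}) k : p^`()`_k = k.+1%:R * p`_k.+1 by rewrite coef_deriv mulr_natl.
by rewrite coefB coefZ coefXM dE; case: n => [|n] /=; rewrite ?dE; ring.
Qed.

Lemma size_lowering (b : {poly C}) n : size b = n.+2 -> size (lowering b) = n.+1.
Proof.
move=> sb; apply/eqP; rewrite eqn_leq; apply/andP; split.
  apply/leq_sizeP => j nj; rewrite coef_lowering nth_default ?mulr0 //.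
  by rewrite sb ltnS.
rewrite ltnNge; apply/negP => /leq_sizeP /(_ n (leqnn n)) /eqP.
rewrite coef_lowering !mulf_eq0 pnatr_eq0 (negbTE (kap_neq0 n)) /=.
have : lead_coef b != 0 by rewrite lead_coef_eq0 -size_poly_eq0 sb.
by rewrite /lead_coef sb => /negbTE /= ->.
Qed.

(** Lowering the degree step by step reaches a nonzero constant, from which
multiplication by X gives all polynomials. *)
Lemma lowering_generates (P : {poly C} -> Prop) b p :
  (forall k q r, P q -> P r -> P (k *: q + r)) -> P 0 ->
  (forall q, P q -> P ('X * q)) -> (forall q, P q -> P (lowering q)) ->
  b != 0 -> P b -> P p.
Proof.
move=> Pcomb P0 PX PL b0 Pb.
suff P1 : P 1.
  elim/poly_ind: p => [|q c IH]; first exact: P0.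
  by have := Pcomb c _ _ P1 (PX _ IH); rewrite addrC mulrC -mul_polyC mulr1.
have [n sb] : exists n, size b = n.+1.
  by exists (size b).-1; rewrite prednK // size_poly_gt0.
elim: n b sb Pb {b0} => [|n IH] b sb Pb; last exact: (IH _ (size_lowering sb) (PL _ Pb)).
have /size_poly1P [c c0 bE] : size b == 1%N by apply/eqP.
have := Pcomb c^-1 _ _ Pb P0.
by rewrite bE -mul_polyC -polyCM mulVf // addr0 polyC1; apply.
Qed.

Section Generate.
Variables (N : set Q) (sN : subsp N) (cN : g_closed N).
Let Ni b := N (emb 0 b 0 0).

Let Ni_comb k b b' : Ni b -> Ni b' -> Ni (k *: b + b').
Proof.
move=> Hb Hb'; have [_ /(_ k _ _ Hb Hb')] := sN.
by rewrite embZD !scaler0 !addr0.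
Qed.
Let Ni0 : Ni 0. Proof. by rewrite /Ni emb0; case: sN. Qed.
Let NiX b : Ni b -> Ni ('X * b).
Proof. by move=> Hb; have [_ /(_ ii _ Hb) [+ _ _]] := cN; rewrite act_mulx_ii !mulr0. Qed.

Let NiL b : Ni b -> Ni (lowering b).
Proof.
move=> Hb; have [_ /(_ ii _ Hb) [_ NB /(_ (vecij 1 0 0 0)) NL]] := cN.
rewrite act_bessel_ii in NB.
rewrite act_jL in NL.
have {}NL : Ni ('X * (b^`() - 2 * b)).
  by apply: emb_mem NL; rewrite /rpolyC ?deriv0; ring.
have {}NB : Ni (Bop (rpolyC (beta al lam)) b).
  by apply: emb_mem NB; rewrite /Bop ?deriv0 //; ring.
have := Ni_comb (- 4) (NiX Hb) (Ni_comb (- (2 * bC)) Hb (Ni_comb 8 (NiX Hb) (Ni_comb 4 NL NB))).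
apply: emb_mem => //; rewrite /lowering /Bop -!mul_polyC /rpolyC; ring.
Qed.

Let Ni_all b p : b != 0 -> Ni b -> Ni p.
Proof. by apply: lowering_generates; [exact: Ni_comb|exact: Ni0|exact: NiX|exact: NiL]. Qed.

(** From all b(x_i) x_j E, the operator B(x_j) gives all a(x_i) E, and
multiplication by x_3 and x_4 gives the odd part. *)
Lemma N_all b0 : b0 != 0 -> Ni b0 -> Wall `<=` N.
Proof.
move=> nz Hb0 _ [a [b [c [d ->]]]].
have H p : N (emb 0 p 0 0) by exact: Ni_all nz Hb0.
have [_ cG] := cN.
have Ha p : N (emb p 0 0 0).
  have [_ HB _] := cG jj _ (H p); rewrite act_bessel_jj in HB.
  have := subD sN (subZ sN (-1) HB) (H (- (2 * p))).
  by rewrite embZ embD; apply: emb_mem; rewrite -?mul_polyC; ring.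
have Hc p : N (emb 0 0 p 0).
  have [HB _ _] := cG i3 _ (Ha p); rewrite act_mulx_3 in HB.
  by apply: emb_mem HB; ring.
have Hd p : N (emb 0 0 0 p).
  have [HB _ _] := cG i4 _ (Ha p); rewrite act_mulx_4 in HB.
  by apply: emb_mem HB; ring.
have := subD sN (subD sN (Ha a) (H b)) (subD sN (Hc c) (Hd d)).
by rewrite !embD; apply: emb_mem; ring.
Qed.

End Generate.

Lemma irr_Wall : irreducible_module (quot_homog al lam) act (alg_g al) Wall.
Proof.
apply: (@irr_intro _ _ (emb 1 0 0 0)); first exact: Wall_submod.
- by do 4!eexists.
- by rewrite -emb0 => /emb_inj [/eqP]; rewrite oner_eq0.
move=> N u /submod_gP[] // sN gN cN NW Nu un0.
have [a [b [c [d uE]]]] := NW _ Nu; rewrite uE in Nu un0.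
have [Ne No] := graded_split gN NW Nu; have [_ cG] := cN.
have g0 : 2 * rpolyC gam * 'X != 0.
  rewrite !mulf_neq0 ?polyX_eq0 // ?polyC_eq0 ?gam_neq0 //.
  by rewrite -polyC_natr polyC_eq0 pnatr_eq0.
have [a0|a0] := eqVneq a 0; last first.
  apply: (N_all sN cN a0); have [HB _ _] := cG jj _ Ne.
  by rewrite act_mulx_jj in HB.
have [b0|b0] := eqVneq b 0; last first.
  by rewrite a0 in Ne; exact: (N_all sN cN b0 Ne).
have [c0|c0] := eqVneq c 0; last first.
  apply: (N_all sN cN (mulf_neq0 g0 c0)); have [HB _ _] := cG i4 _ No.
  by rewrite act_mulx_4 in HB.
have [d0|d0] := eqVneq d 0; last first.
  have nz : - (2 * rpolyC gam * 'X * d) != 0 by rewrite oppr_eq0 mulf_neq0.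
  apply: (N_all sN cN nz); have [HB _ _] := cG i3 _ No.
  by rewrite act_mulx_3 in HB.
by case: un0; rewrite a0 b0 c0 d0 emb0.
Qed.

(** * The decomposition into K-types *)

Local Notation Wc := (Wcomp al lam).

Lemma uvec_kvec m x y : x *: uvec al lam m.+1 + y *: uvec' al lam m = kvec m x y 0 0.
Proof.
rewrite uvec_emb // uvec'_emb // !embZ embD kvecE -!mul_polyC.
apply: (emb_mem (N := fun v => _ = v)) erefl; ring.
Qed.
Lemma vvec_kvec m z t : z *: vvec al lam i3 m + t *: vvec al lam i4 m = kvec m 0 0 z t.
Proof.
rewrite vvec3_emb // vvec4_emb // !embZ embD kvecE -!mul_polyC.
apply: (emb_mem (N := fun v => _ = v)) erefl; ring.
Qed.

Lemma WcompS m : Wc m.+1 = Wset m.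
Proof.
apply/seteqP; split=> [_ [c ->]|_ [x [y [z [t [_ ->]]]]]].
  rewrite !big_ord_recl big_ord0 /= addr0 addrA uvec_kvec vvec_kvec kvecD.
  exact/ksetE.
exists (fun n => match n with 0 => x | 1 => y | 2 => z | _ => t end).
rewrite !big_ord_recl big_ord0 /= addr0 addrA uvec_kvec vvec_kvec kvecD.
by rewrite !addr0 !add0r.
Qed.

Lemma Wcomp0 : Wc 0 = W0set.
Proof.
have e : cls (sscal (cexp (- 2) (- 2))) = emb 1 0 0 0.
  by rewrite -uvecE pe1 mul1r.
apply/seteqP; split=> [_ [c ->]|_ [x ->]].
  exists (c 0%N); rewrite big_ord_recl big_ord0 /= addr0 e embZ -!mul_polyC.
  by apply: (emb_mem (N := fun v => _ = v)) erefl; ring.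
exists (fun=> x); rewrite big_ord_recl big_ord0 /= addr0 e embZ -!mul_polyC.
by apply: (emb_mem (N := fun v => _ = v)) erefl; ring.
Qed.

Lemma KcompS m : Kcomp al lam m.+1 = Kset m.
Proof.
have kE : (m.+1%:R - 1 - beta al lam)%:C = kap m :> C.
  by rewrite -natr1 addrK rmorphB rmorph_nat.
have uE : uvec al lam m.+1 + kap m *: uvec' al lam m = kvec m 1 (kap m) 0 0.
  by rewrite -uvec_kvec scale1r.
apply/seteqP; split=> [_ [c ->]|_ [x [y [z [t [-> ->]]]]]].
  rewrite !big_ord_recl big_ord0 /= kE uE addr0 vvec_kvec kvecZ kvecD.
  by apply/ksetE; ring.
exists (fun n => match n with 0 => x | 1 => z | _ => t end).
rewrite !big_ord_recl big_ord0 /= kE uE addr0 vvec_kvec kvecZ kvecD.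
by apply: (kvec_mem (N := fun v => _ = v)) erefl; ring.
Qed.

Lemma RcompS m : Rcomp al lam m.+1 = Rset m.
Proof.
have uE : uvec al lam m.+1 + m.+1%:R *: uvec' al lam m = kvec m 1 m.+1%:R 0 0.
  by rewrite -uvec_kvec scale1r.
apply/seteqP; split=> [_ [c ->]|_ [x [y [z [t [[-> -> ->] ->]]]]]].
  rewrite !big_ord_recl big_ord0 /= uE addr0 kvecZ.
  by apply/ksetE; split; ring.
exists (fun=> x); rewrite !big_ord_recl big_ord0 /= uE addr0 kvecZ.
by apply: (kvec_mem (N := fun v => _ = v)) erefl; ring.
Qed.

Lemma WmodE : Wmod al lam = Wall.
Proof. by apply/seteqP; split=> q /WmodP. Qed.

(** The polynomials have one leading term in each degree, so they span. *)
Lemma lag_span s (P : {poly C} -> Prop) p :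
  (forall k q r, P q -> P r -> P (k *: q + r)) -> P 0 -> (forall m, P (lag s m)) -> P p.
Proof.
move=> Pcomb P0 PL.
suff H n : forall q : {poly C}, (size q <= n)%N -> P q by exact: (H (size p)).
elim: n => [q|n IH q sq].
  by rewrite leqn0 size_poly_eq0 => /eqP ->.
have ln : lead_coef (lag s n) != 0 by rewrite lead_coef_eq0 lag_neq0.
pose k := q`_n / lead_coef (lag s n).
have -> : q = k *: lag s n + (q - k *: lag s n) by rewrite addrC subrK.
apply: Pcomb => //; apply: IH; apply/leq_sizeP => j; rewrite leq_eqVlt => /orP[/eqP <-|nj].
  rewrite coefB coefZ /k.
  by move: ln; rewrite lead_coefE size_lag /= => ln; rewrite divfK // subrr.
rewrite coefB coefZ !nth_default ?mulr0 ?subr0 // ?size_lag //.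
exact: leq_trans sq nj.
Qed.

Definition Wsums : set Q := [set v | exists n (u : nat -> Q),
  (forall k, (k < n)%N -> Wc k (u k)) /\ v = \sum_(k < n) u k].

Lemma Wcomp_subsp k : subsp (Wc k).
Proof.
case: k => [|m]; first by rewrite Wcomp0; exact: W0_subsp.
by rewrite WcompS; exact: kset_subsp.
Qed.

Lemma Wsums_subsp : subsp Wsums.
Proof.
split; first by exists 0%N, (fun=> 0); split=> //; rewrite big_ord0.
move=> k u v [n [f [fW ->]]] [n' [f' [fW' ->]]].
pose pad n (f : nat -> Q) i := if (i < n)%N then f i else 0.
have padE j (h : nat -> Q) N : (j <= N)%N -> \sum_(i < j) h i = \sum_(i < N) pad j h i.
  move=> jN; rewrite (big_ord_widen N h jN) big_mkcond /=.
  by apply: eq_bigr => i _.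
have padW j h i : (forall l, (l < j)%N -> Wc l (h l)) -> Wc i (pad j h i).
  by rewrite /pad => H; case: ifP => [/H //|_]; exact: sub0 (Wcomp_subsp i).
exists (maxn n n'), (fun i => k *: pad n f i + pad n' f' i); split=> [i _|].
  by have [_] := Wcomp_subsp i; apply; exact: padW.
rewrite (padE n f (maxn n n')) ?leq_maxl // (padE n' f' (maxn n n')) ?leq_maxr //.
by rewrite scaler_sumr -big_split.
Qed.

Lemma Wcomp_Wsums k v : Wc k v -> Wsums v.
Proof.
move=> Wv; exists k.+1, (fun i => if i == k then v else 0); split=> [i ik|].
  by case: eqP => [->|_] //; exact: sub0 (Wcomp_subsp i).
rewrite big_ord_recr /= eqxx big1 ?add0r // => i _.
by rewrite ltn_eqF.
Qed.

Lemma Wall_Wsums : Wall = Wsums.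
Proof.
apply/seteqP; split=> [_ [a [b [c [d ->]]]]|_ [n [u [uW ->]]]]; last first.
  apply: big_ind => [|p q [a [b [c [d ->]]]] [a' [b' [c' [d' ->]]]]|i _].
  - by exists 0, 0, 0, 0; rewrite emb0.
  - by rewrite embD; do 4!eexists.
  have := uW i (ltn_ord i); case: (val i) => [|m].
    by rewrite Wcomp0 => -[x ->]; do 4!eexists.
  by rewrite WcompS => -[x [y [z [t [_ ->]]]]]; rewrite kvecE; do 4!eexists.
have [S0 SZD] := Wsums_subsp; have sS := Wsums_subsp.
have Sk m x y z t : Wsums (kvec m x y z t).
  by apply: (@Wcomp_Wsums m.+1); rewrite WcompS; apply/ksetE.
have Sa p : Wsums (emb p 0 0 0).
  apply: (@lag_span 0 (fun p => Wsums (emb p 0 0 0))) => [k q r Hq Hr||m].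
  - by have := SZD k _ _ Hq Hr; rewrite embZD; apply: emb_mem; rewrite ?scaler0 ?addr0.
  - by rewrite emb0.
  case: m => [|m].
    by apply: (@Wcomp_Wsums 0); rewrite Wcomp0; exists 1; rewrite lag0.
  have := Sk m 1 0 0 0; rewrite kvecE; apply: emb_mem; ring.
have Sb p : Wsums (emb 0 p 0 0).
  apply: (@lag_span 0 (fun p => Wsums (emb 0 p 0 0))) => [k q r Hq Hr||m].
  - by have := SZD k _ _ Hq Hr; rewrite embZD; apply: emb_mem; rewrite ?scaler0 ?addr0.
  - by rewrite emb0.
  have nz : 4 != 0 :> C by rewrite pnatr_eq0.
  apply: (subZK sS nz).
  have := SZD (-1) _ _ (Sa (lag 0 m)) (Sk m 0 1 0 0).
  rewrite kvecE embZD embZ; apply: emb_mem; rewrite -!mul_polyC; ring.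
have Sc p : Wsums (emb 0 0 p 0).
  apply: (@lag_span 1 (fun p => Wsums (emb 0 0 p 0))) => [k q r Hq Hr||m].
  - by have := SZD k _ _ Hq Hr; rewrite embZD; apply: emb_mem; rewrite ?scaler0 ?addr0.
  - by rewrite emb0.
  have := Sk m 0 0 1 0; rewrite kvecE; apply: emb_mem; ring.
have Sd p : Wsums (emb 0 0 0 p).
  apply: (@lag_span 1 (fun p => Wsums (emb 0 0 0 p))) => [k q r Hq Hr||m].
  - by have := SZD k _ _ Hq Hr; rewrite embZD; apply: emb_mem; rewrite ?scaler0 ?addr0.
  - by rewrite emb0.
  have := Sk m 0 0 0 1; rewrite kvecE; apply: emb_mem; ring.
have := subD sS (subD sS (Sa a) (Sb b)) (subD sS (Sc c) (Sd d)).
by rewrite !embD; apply: emb_mem; ring.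
Qed.

(** The K-types of index less than n lie in the n-th step of this filtration by
degree, which meets W_n only in zero. *)
Definition filt n : set Q := [set q | exists a b c d, [/\ q = emb a b c d,
  (size a <= n)%N, (size b <= n.-1)%N, (size c <= n.-1)%N & (size d <= n.-1)%N]].

Lemma filt_subsp n : subsp (filt n).
Proof.
split; first by exists 0, 0, 0, 0; rewrite emb0 !size_poly0; split.
move=> k u v [a [b [c [d [-> sa sb sc sd]]]]] [a' [b' [c' [d' [-> sa' sb' sc' sd']]]]].
rewrite embZD; exists (k *: a + a'), (k *: b + b'), (k *: c + c'), (k *: d + d').
have sz i (p q : {poly C}) : (size p <= i)%N -> (size q <= i)%N -> (size (k *: p + q)%R <= i)%N.
  move=> sp sq; apply: leq_trans (size_polyD _ _) _; rewrite geq_max sq andbT.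
  exact: leq_trans (size_scale_leq _ _) sp.
by split=> //; exact: sz.
Qed.

Lemma filt_le n n' : (n <= n')%N -> filt n `<=` filt n'.
Proof.
move=> nn' _ [a [b [c [d [-> sa sb sc sd]]]]]; exists a, b, c, d.
have nn1 : (n.-1 <= n'.-1)%N by rewrite -!subn1 leq_sub2r.
by split=> //; [exact: leq_trans sa nn'|exact: leq_trans sb nn1
  |exact: leq_trans sc nn1|exact: leq_trans sd nn1].
Qed.

Lemma size_cst_lag (x : C) s m n : (m < n)%N -> (size (x%:P * lag s m)%R <= n)%N.
Proof.
by move=> mn; rewrite mul_polyC (leq_trans (size_scale_leq _ _)) // size_lag.
Qed.

Lemma Wcomp_filt k : Wc k `<=` filt k.+1.
Proof.
case: k => [|m] q.
  rewrite Wcomp0 => -[x ->]; exists x%:P, 0, 0, 0.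
  by rewrite !size_poly0 size_polyC; split=> //; case: (x != 0).
rewrite WcompS => -[x [y [z [t [_ ->]]]]]; rewrite kvecE.
do 4!eexists; split; [reflexivity| | | |]; rewrite ?size_cst_lag //.
  by apply: leq_trans (size_polyD _ _) _; rewrite geq_max !size_cst_lag.
by rewrite -polyC_natr -polyCM size_cst_lag.
Qed.

Lemma Wcomp_filt0 k q : Wc k q -> filt k q -> q = 0.
Proof.
have coef0P (x : C) s m (p : {poly C}) : (size p <= m)%N ->
    p = x%:P * lag s m -> x = 0.
  move=> sp pE; apply/eqP; apply: contraTT sp => x0.
  by rewrite pE mul_polyC size_scale // size_lag ltnn.
case: k => [|m].
  rewrite Wcomp0 => -[x ->] [a [b [c [d [/emb_inj [-> _ _ _] + _ _ _]]]]].
  by rewrite leqn0 size_poly_eq0 => /eqP ->; rewrite emb0.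
rewrite WcompS => -[x [y [z [t [_ ->]]]]] [a [b [c [d [kE sa sb sc sd]]]]].
rewrite kvecE in kE; case/emb_inj: kE => ea eb ec ed.
have z0 := coef0P _ _ _ _ sc (esym ec); have t0 := coef0P _ _ _ _ sd (esym ed).
have y0 : y = 0.
  have : 4 * y = 0 by apply: (coef0P _ 0 m b) => //; rewrite -eb polyCM polyC_natr.
  by move=> /eqP; rewrite mulf_eq0 pnatr_eq0 => /eqP.
have x0 : x = 0.
  by apply: (coef0P _ 0 m.+1 a) => //; rewrite -ea y0 polyC0 mul0r addr0.
by rewrite x0 y0 z0 t0 kvec00.
Qed.

Lemma direct_Wcomp : direct_sum_seq (Wmod al lam) Wc.
Proof.
split; first by rewrite WmodE Wall_Wsums.
elim=> [|n IH] u uW //; rewrite big_ord_recr /= => e.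
have un : u n = 0.
  apply: (@Wcomp_filt0 n); first exact: uW.
  have -> : u n = - \sum_(k < n) u k by apply/eqP; rewrite -addr_eq0 addrC e.
  have sF := filt_subsp n; apply: (subN sF); apply: big_ind => [|p q Fp Fq|i _].
  - exact: sub0 sF.
  - exact: (subD sF Fp Fq).
  have iW : Wc i (u i) by apply: uW; exact: ltn_trans (ltn_ord i) (ltnSn n).
  exact: filt_le (ltn_ord i) _ (Wcomp_filt iW).
move=> k; rewrite ltnS leq_eqVlt => /orP[/eqP -> //|]; apply: IH.
  by move=> j jn; apply: uW; exact: ltn_trans jn _.
by rewrite un addr0 in e.
Qed.

End Model.

Theorem theorem7p7 (R : realType) (al lam : R)
    (al_neq0 : al != 0) (al_neq1 : al != 1)
    (lam_al : (lam = al /\ al \isn't a Num.nat)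
              \/ (lam = 1 /\ al^-1 \isn't a Num.nat)) :
  [/\ (* (1)(a) *)
      al != -1 -> forall k : nat, (0 < k)%N ->
        [/\ irreducible_rep (alg_k0 al) (Kcomp al lam k),
            irreducible_rep (alg_k0 al) (Rcomp al lam k) &
            direct_sum (Wcomp al lam k) (Kcomp al lam k) (Rcomp al lam k)],
      (* (1)(b) *)
      al = -1 -> forall k : nat, (0 < k)%N ->
        indecomposable_rep (alg_k0 al) (Wcomp al lam k) /\
        ~ irreducible_rep (alg_k0 al) (Wcomp al lam k),
      (* (2) *)
      forall k : nat, irreducible_rep (alg_k al) (Wcomp al lam k) &
      (* (3) *)
      irreducible_rep (alg_g al) (Wmod al lam) /\
        direct_sum_seq (Wmod al lam) (Wcomp al lam)].
Proof.
have lamP : lam = al \/ lam = 1 by case: lam_al => -[-> _]; [left|right].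
have beta_nat m : beta al lam != m%:R.
  rewrite /beta; apply/eqP => e; case: lam_al => -[lamE].
    by move: e; rewrite lamE eqxx => ->; rewrite natr_nat.
  by move: e; rewrite lamE eq_sym (negbTE al_neq1) => ->; rewrite natr_nat.
have beta_m1 : (beta al lam == -1) = (al == -1).
  by rewrite /beta; case: ifP => _ //; rewrite -(inj_eq invr_inj) invrK invrN1.
split.
- move=> al1 [//|m] _; rewrite KcompS // RcompS // WcompS //.
  have b1 : beta al lam != -1 by rewrite beta_m1.
  by split; [exact: irr_K|exact: irr_R|exact: direct_KR].
- move=> al1 [//|m] _; rewrite WcompS //.
  have b1 : beta al lam = -1 by apply/eqP; rewrite beta_m1 al1.
  by split; [exact: indecomposable_W|exact: not_irreducible_W].
- case=> [|m]; first by rewrite Wcomp0; exact: irrK_W0.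
  by rewrite WcompS //; exact: irrK_W.
split; last exact: direct_Wcomp.
by rewrite WmodE; exact: irr_Wall.
Qed.
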